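(* Let $P=\{p_1,\dots,p_d\}$ be a finite poset and $G$ a finite simple graph on $[d]=\{1,\dots,d\}$. Then the codegree of the Cayley sum $\mathcal{O}_P*\mathcal{Q}_G$ is $2$, the codegree of the Minkowski sum $\mathcal{O}_P+\mathcal{Q}_G$ is $1$, and the following conditions are equivalent: (i) $\mathcal{O}_P*\mathcal{Q}_G$ is Gorenstein (of index $2$); (ii) $\mathcal{O}_P+\mathcal{Q}_G$ is Gorenstein (of index $1$); (iii) $G$ is perfect. Moreover, if $G$ is perfect, then: (a) each of $\mathcal{O}_P*\mathcal{Q}_G$ and $\mathcal{O}_P+\mathcal{Q}_G$ possesses a regular unimodular triangulation; (b) each of $\mathcal{O}_P*\mathcal{Q}_G$ and $\mathcal{O}_P+\mathcal{Q}_G$ has the integer decomposition property; (c) $(\mathcal{O}_P\cap\mathbb{Z}^d)+(\mathcal{Q}_G\cap\mathbb{Z}^d)=(\mathcal{O}_P+\mathcal{Q}_G)\cap\mathbb{Z}^d$.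
   Context: For $X\subset[d]$ (identifying $p_j$ with $j$) let $\rho(X)=\sum_{j\in X}\mathbf{e}_j\in\mathbb{R}^d$, where $\mathbf{e}_j$ are the standard unit vectors. A poset ideal of $P$ is a subset $I\subset P$ such that $p_i\in I$ and $p_j\le p_i$ imply $p_j\in I$ (the empty set and $P$ are poset ideals). The order polytope $\mathcal{O}_P\subset\mathbb{R}^d$ is the convex hull of $\{\rho(I): I \text{ a poset ideal of } P\}$. A stable set of $G$ is a subset $S\subset[d]$ containing no edge of $G$ (including $\emptyset$ and singletons); the stable set polytope $\mathcal{Q}_G$ is the convex hull of $\{\rho(S): S\text{ stable in }G\}$. The Minkowski sum is $\mathcal{P}+\mathcal{Q}=\{\mathbf{x}+\mathbf{y}:\mathbf{x}\in\mathcal{P},\mathbf{y}\in\mathcal{Q}\}$; the Cayley sum $\mathcal{P}*\mathcal{Q}\subset\mathbb{R}^{d+1}$ is the convex hull of $(\mathcal{P}\times\{1\})\cup(\mathcal{Q}\times\{0\})$. A lattice polytope $\mathcal{P}\subset\mathbb{R}^n$ has the integer decomposition property (IDP) if for every integer $k\ge1$, $\mathcal{P}\cap\mathbb{Z}^n+k\mathcal{P}\cap\mathbb{Z}^n=(k+1)\mathcal{P}\cap\mathbb{Z}^n$. A full-dimensional lattice polytope $\mathcal{P}\subset\mathbb{R}^n$ is reflexive if the origin lies in its interior and its dual $\{\mathbf{x}:\langle\mathbf{x},\mathbf{y}\rangle\le1\ \forall\mathbf{y}\in\mathcal{P}\}$ is a lattice polytope; $\mathcal{P}$ is Gorenstein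 of index $r$ if $r\mathcal{P}$ is unimodularly equivalent (via an affine map preserving $\mathbb{Z}^n$) to a reflexive polytope. The codegree of a full-dimensional lattice polytope $\mathcal{P}$ is the smallest positive integer $\ell$ such that $\ell\mathcal{P}$ contains a lattice point in its interior. A graph $G$ is perfect if for every induced subgraph $H$ (including $G$), the chromatic number of $H$ equals the maximum size of a clique of $H$. *)

(* Defs.v *)
From HB Require Import structures.
From mathcomp Require Import all_boot all_order all_algebra finmap.
From mathcomp Require Import all_classical all_reals all_analysis.

Set Implicit Arguments.
Unset Strict Implicit.
Unset Printing Implicit Defensive.

Import Order.TTheory GRing.Theory Num.Theory.
Import numFieldNormedType.Exports.

Local Open Scope classical_set_scope.
Local Open Scope ring_scope.

(** Graphs on a finite type are relations; simplicity (symmetry and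
    irreflexivity) is assumed where it is needed. *)
Definition stable (T : finType) (e : rel T) (S : {set T}) : bool :=
  [forall x in S, forall y in S, ~~ e x y].

Definition clique (T : finType) (e : rel T) (K : {set T}) : bool :=
  [forall x in K, forall y in K, (x != y) ==> e x y].

Definition colorable (T : finType) (e : rel T) (k : nat) : bool :=
  [exists f : {ffun T -> 'I_k}, forall x, forall y, e x y ==> (f x != f y)].

Lemma colorable_exists (T : finType) (e : rel T) :
  irreflexive e -> exists k, colorable e k.
Proof.
move=> e_irr; exists #|T|; apply/existsP; exists [ffun x => enum_rank x].
apply/forallP => x; apply/forallP => y; apply/implyP; rewrite !ffunE.
by case: eqP => // /enum_rank_inj ->; rewrite e_irr.
Qed.

Definition chromatic_number (T : finType) (e : rel T) (e_irr : irreflexive e) :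
  nat := ex_minn (colorable_exists e_irr).

Definition clique_number (T : finType) (e : rel T) : nat :=
  \max_(K : {set T} | clique e K) #|K|.

Definition induced (T : finType) (e : rel T) (S : {set T}) :
  rel {x : T | x \in S} := fun x y => e (val x) (val y).

Lemma induced_irr (T : finType) (e : rel T) (S : {set T}) :
  irreflexive e -> irreflexive (@induced T e S).
Proof. by move=> e_irr x; apply: e_irr. Qed.

Definition perfect (T : finType) (e : rel T) (e_irr : irreflexive e) : Prop :=
  forall S : {set T},
    chromatic_number (@induced_irr T e S e_irr) = clique_number (@induced T e S).

Definition poset_ideal (disp : Order.disp_t) (P : finPOrderType disp)
    (I : {set P}) : bool :=
  [forall x in I, forall y, (y <= x)%O ==> (y \in I)].

Section Polytopes.
Context {R : realType}.

Definition conv_hull {n} (A : set 'rV[R]_n) : set 'rV[R]_n :=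
  smallest (@convex_set R 'rV[R]_n) A.

Definition lattice {n} : set 'rV[R]_n :=
  [set x | forall j, x 0 j \is a Num.int].

Definition lattice_polytope {n} (A : set 'rV[R]_n) : Prop :=
  exists V : {fset 'rV[R]_n}, [set` V] `<=` lattice /\ A = conv_hull [set` V].

Definition affinely_independent {n} (s : {fset 'rV[R]_n}) : Prop :=
  forall w : 'rV[R]_n -> R,
    \sum_(v <- s) w v = 0 -> \sum_(v <- s) w v *: v = 0 ->
    forall v, v \in s -> w v = 0.

Definition full_dimensional {n} (A : set 'rV[R]_n) : Prop :=
  exists s : {fset 'rV[R]_n},
    [/\ #|` s| = n.+1, affinely_independent s & [set` s] `<=` A].

Definition dilate {n} (k : nat) (A : set 'rV[R]_n) : set 'rV[R]_n :=
  [set k%:R *: x | x in A].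

Definition minkowski_sum {n} (A B : set 'rV[R]_n) : set 'rV[R]_n :=
  [set x + y | x in A & y in B].

Definition cayley_sum {n} (A B : set 'rV[R]_n) : set 'rV[R]_(n + 1) :=
  conv_hull ([set row_mx x (const_mx 1) | x in A] `|`
             [set row_mx y (const_mx 0) | y in B]).

Definition idp {n} (A : set 'rV[R]_n) : Prop :=
  lattice_polytope A /\
  forall k : nat, (0 < k)%N ->
    minkowski_sum (A `&` lattice) (dilate k A `&` lattice) =
    dilate k.+1 A `&` lattice.

Definition inner {n} (x y : 'rV[R]_n) : R := \sum_j x 0 j * y 0 j.

Definition dual_polytope {n} (A : set 'rV[R]_n) : set 'rV[R]_n :=
  [set x | forall y, A y -> inner x y <= 1].

Definition reflexive_polytope {n} (A : set 'rV[R]_n) : Prop :=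
  [/\ lattice_polytope A, full_dimensional A, interior A 0 &
      lattice_polytope (dual_polytope A)].

(** [unitmx] over [int] is GL_n(Z); points are row vectors, so matrices act on
    the right. *)
Definition unimodularly_equivalent {n} (A B : set 'rV[R]_n) : Prop :=
  exists (U : 'M[int]_n) (t : 'rV[int]_n), U \in unitmx /\
    B = [set x *m map_mx intr U + map_mx intr t | x in A].

Definition gorenstein {n} (r : nat) (A : set 'rV[R]_n) : Prop :=
  [/\ lattice_polytope A, full_dimensional A &
      exists2 Q, reflexive_polytope Q & unimodularly_equivalent (dilate r A) Q].

Definition has_interior_lattice_point {n} (A : set 'rV[R]_n) : Prop :=
  interior A `&` lattice !=set0.

Definition is_codegree {n} (A : set 'rV[R]_n) (l : nat) : Prop :=
  [/\ lattice_polytope A, full_dimensional A, (0 < l)%N,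
      has_interior_lattice_point (dilate l A) &
      forall m : nat, (0 < m)%N ->
        has_interior_lattice_point (dilate m A) -> (l <= m)%N].

(** Simplices are represented by their vertex sets; the empty simplex is
    allowed. *)
Definition triangulation {n} (A : set 'rV[R]_n)
    (T : set {fset 'rV[R]_n}) : Prop :=
  [/\ forall s, T s -> [set` s] `<=` A `&` lattice /\ affinely_independent s,
      forall s t, T s -> (t `<=` s)%fset -> T t,
      forall s t, T s -> T t ->
        conv_hull [set` s] `&` conv_hull [set` t] = conv_hull [set` (s `&` t)%fset] &
      A = \bigcup_(s in T) conv_hull [set` s]].

(** The simplices are the projections of the lower faces of the convex hull of
    the lifted points [(a, h a)]: the non-vertical supporting hyperplane
    [x |-> inner c x + b] cuts out exactly the vertices of [s]. *)
Definition regular_triangulation {n} (A : set 'rV[R]_n)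
    (T : set {fset 'rV[R]_n}) : Prop :=
  triangulation A T /\
  exists h : 'rV[R]_n -> R, forall s : {fset 'rV[R]_n},
    T s <->
    [set` s] `<=` A `&` lattice /\
    exists (c : 'rV[R]_n) (b : R), forall a, (A `&` lattice) a ->
      if a \in s then inner c a + b = h a else inner c a + b < h a.

(** Normalized volume 1: the edge vectors at a vertex have determinant 1 or -1,
    i.e. they form a Z-basis of the lattice. *)
Definition unimodular_simplex {n} (s : {fset 'rV[R]_n}) : Prop :=
  exists2 v : 'I_n.+1 -> 'rV[R]_n, [set` s] = range v &
    `|\det (\matrix_(i < n) (v (lift ord0 i) - v ord0))| = 1.

Definition unimodular_triangulation {n} (A : set 'rV[R]_n)
    (T : set {fset 'rV[R]_n}) : Prop :=
  triangulation A T /\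
  forall s, T s -> (forall t, T t -> (s `<=` t)%fset -> t = s) ->
    unimodular_simplex s.

Definition has_regular_unimodular_triangulation {n} (A : set 'rV[R]_n) : Prop :=
  exists2 T, regular_triangulation A T & unimodular_triangulation A T.

Definition rho {d} (X : {set 'I_d}) : 'rV[R]_d := \sum_(j in X) delta_mx 0 j.

(** The labelling [p] enumerates P as [p 0, ..., p (d - 1)]; no compatibility
    with the order of P is required. *)
Definition order_polytope {d} (disp : Order.disp_t) (P : finPOrderType disp)
    (p : 'I_d -> P) : set 'rV[R]_d :=
  conv_hull [set rho [set j | p j \in I]%SET | I in [set I | poset_ideal I]].

Definition stable_set_polytope {d} (e : rel 'I_d) : set 'rV[R]_d :=
  conv_hull [set rho S | S in [set S | stable e S]].

End Polytopes.

(* Main.v *)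
(** Write [x = u + w] for a point of [s O_P + t Q_G], taking for [u] the largest
    order-reversing function with [u <= min(x, s)].  Then [u] lies in [s O_P] and,
    when [G] is perfect, [x] belongs to the sum iff [w >= 0] has weight at most [t]
    on every clique; if [x], [s], [t] are integral, so are [u] and [w].  The level sets of [u] are
    poset ideals, and for [G] perfect an integral [w] of clique weight at most
    [t] is a sum of [t] stable sets.  This gives the integer decompositions, and
    also inequalities with integral coefficients, all tight at distance one from
    the all-ones vector, whence the Gorenstein property.

    Conversely, the facets [x_i >= 0] force the interior lattice point of a
    Gorenstein sum to be the all-ones vector; the inequalities of the sum, read
    at [1 + y] with [y] in [Q_G], then have integral coefficients and right-hand
    side one, which makes them clique inequalities, and [G] is perfect.

    The triangulations are regular for heights that are submodular on ideals and
    prefer large ideals, small stable sets, and (lexicographically) stable sets of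
    large rank.  On a cell the ideals form a chain, [u] is the canonical one above
    and [w] is pulled greedily.  Hence the barycentric coordinates of every
    integral point of the cone over a cell are integers, which already implies
    that the cells are unimodular simplices.  For the Minkowski sum a bilinear
    perturbation couples ideals and stable sets along a staircase. *)

Require Import Defs.
From mathcomp Require Import all_boot all_order all_algebra finmap.
From mathcomp Require Import all_classical all_reals all_analysis.
From mathcomp Require Import ring lra zify.

Set Implicit Arguments.
Unset Strict Implicit.
Unset Printing Implicit Defensive.

Import Order.TTheory GRing.Theory Num.Theory.
Import numFieldNormedType.Exports.

Local Open Scope classical_set_scope.
Local Open Scope ring_scope.

(** * Farkas lemma and linear programming duality *)

Section Farkas.
Context {R : realFieldType}.

(** Points are weighted through labels in a finite family. This matters for the Minkowski sum, where
    several pairs of an ideal and a stable set may give the same point; integrality is proved for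
    the weights of the pairs.

    There a tight pair need not be optimal in each component: the bilinear perturbation leaves the
    ideal and the stable set only within a bound [B] of their own minima. Heights are therefore
    multiplied by an [N] so large that one unit of height outweighs all errors of an exchange. One
    exchange argument then serves both sums, with [B = 0] for the Cayley sum.

    Perfection enters the forward direction only through [weighted_coloring], which splits integral
    weights; real points are reached by scaling, truncation and separation. Both sums share one
    system of inequalities, because the Minkowski sum is the slice of twice the Cayley sum where the
    last coordinate is one. *)

Lemma farkas_ord (I : finType) m (a : 'I_m -> I -> R) (b : I -> R) :
  (forall x : I -> R, (forall j, \sum_i x i * a j i <= 0) ->
     \sum_i x i * b i <= 0) ->
  exists2 l : 'I_m -> R, forall j, 0 <= l j &
    forall i, b i = \sum_j l j * a j i.
Proof.
elim: m a b => [|m IH] a b Hb.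
  exists (fun=> 0) => // i; rewrite big_ord0; apply/eqP.
  have pick_i (c : R) : \sum_k (if k == i then c else 0) * b k = c * b i.
    rewrite (bigD1 i) //= eqxx big1 ?addr0 // => k /negPf ->.
    by rewrite mul0r.
  have := Hb (fun k => if k == i then b i else 0).
  rewrite pick_i -expr2 => H; have {}H : b i ^+ 2 <= 0 by apply: H => -[].
  by rewrite -sqrf_eq0 eq_le H sqr_ge0.
pose a' (j : 'I_m) := a (lift ord_max j); pose am := a ord_max.
have [/IH[l l0 lE]|] := pselect (forall x : I -> R,
    (forall j, \sum_i x i * a' j i <= 0) -> \sum_i x i * b i <= 0).
  exists (fun j => oapp l 0 (unlift ord_max j)).
    by move=> j; case: unliftP => //=.
  move=> i; rewrite lE (bigD1_ord ord_max) //= unlift_none /= mul0r add0r.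
  by apply: eq_bigr => j _; rewrite liftK.
move=> /existsNP[x0 /not_implyP[x0a /negP]]; rewrite -ltNge => x0b.
have amx0 : 0 < \sum_i x0 i * am i.
  rewrite ltNge; apply/negP => H; move: x0b; rewrite ltNge Hb // => j.
  by case: (unliftP ord_max j) => [k ->|->]; [exact: x0a|exact: H].
(* [x0] is positive on [b] and on the last generator, and nonpositive on the others. Projecting
   along [am] onto the vectors orthogonal to [x0] removes one generator. The coefficient [c]
   recovered for [am] is nonnegative since each [A j] is nonpositive while [B] and [D] are
   positive. *)
pose D := \sum_i x0 i * am i.
pose A j := \sum_i x0 i * a' j i; pose B := \sum_i x0 i * b i.
pose a2 j i := a' j i - A j / D * am i; pose b2 i := b i - B / D * am i.
have dot_proj (x g : I -> R) : \sum_i x i * (g i - (\sum_k x0 k * g k) / D * am i)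
    = \sum_i (x i - (\sum_k x k * am k) / D * x0 i) * g i.
  under eq_bigr do rewrite mulrBr.
  under [RHS]eq_bigr do rewrite mulrBl.
  rewrite !sumrB; congr (_ - _).
  transitivity ((\sum_k x0 k * g k) / D * \sum_i x i * am i).
    by rewrite mulr_sumr; apply: eq_bigr => i _; rewrite mulrCA.
  transitivity ((\sum_k x k * am k) / D * \sum_i x0 i * g i); first by ring.
  by rewrite mulr_sumr; apply: eq_bigr => i _; rewrite mulrA.
have [|l l0 lE] := IH a2 b2.
  move=> x Hx; rewrite dot_proj; apply: Hb => j.
  case: (unliftP ord_max j) => [k ->|->].
    by rewrite -dot_proj; exact: Hx.
  rewrite -/am; under eq_bigr do rewrite mulrBl -[_ / D * _ * _]mulrA.
  by rewrite sumrB -mulr_sumr -/D -mulrA mulVf ?mulr1 ?subrr // gt_eqF.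
pose c := B / D - \sum_j l j * (A j / D).
exists (fun j => oapp l c (unlift ord_max j)).
  move=> j; case: unliftP => [k _ //=|_ /=].
  rewrite subr_ge0; apply: (@le_trans _ _ 0).
    apply: sumr_le0 => k _; rewrite mulr_ge0_le0 // mulr_le0_ge0 //.
      exact: x0a.
    by rewrite invr_ge0 ltW.
  by rewrite divr_ge0 // ltW.
move=> i; rewrite (bigD1_ord ord_max) //= unlift_none /=.
under eq_bigr do rewrite liftK /=.
have := lE i; rewrite /b2 => /eqP; rewrite subr_eq => /eqP ->.
have -> : \sum_j l j * a2 j i =
    \sum_j l j * a' j i - (\sum_j l j * (A j / D)) * am i.
  by rewrite mulr_suml -sumrB; apply: eq_bigr => j _; rewrite /a2; ring.
by rewrite /c /a' /am; ring.
Qed.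

Lemma farkas (I J : finType) (a : J -> I -> R) (b : I -> R) :
  (forall x : I -> R, (forall j, \sum_i x i * a j i <= 0) ->
     \sum_i x i * b i <= 0) ->
  exists2 l : J -> R, forall j, 0 <= l j & forall i, b i = \sum_j l j * a j i.
Proof.
move=> Hb; have [|l l0 lE] := @farkas_ord I #|J| (fun j => a (enum_val j)) b.
  by move=> x Hx; apply: Hb => j; rewrite -[j]enum_rankK; apply: Hx.
exists (fun j => l (enum_rank j)) => // i.
rewrite lE (reindex (@enum_rank J)); last exact/onW_bij/enum_rank_bij.
by apply: eq_bigr => j _; rewrite enum_rankK.
Qed.

(** Optimality is encoded as feasibility: the primal equations, the dual inequalities and the
    absence of a duality gap form one linear system in nonnegative unknowns, to which the Farkas
    lemma applies. *)
Lemma lp_duality (I J : finType) (P : J -> I -> R) (h : J -> R) (X : I -> R) :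
  (exists2 l : J -> R, forall j, 0 <= l j & forall i, \sum_j l j * P j i = X i) ->
  (exists y : I -> R, forall j, \sum_i y i * P j i <= h j) ->
  exists l : J -> R, exists y : I -> R,
    [/\ forall j, 0 <= l j, forall i, \sum_j l j * P j i = X i,
        forall j, \sum_i y i * P j i <= h j &
        \sum_j l j * h j <= \sum_i y i * X i].
Proof.
move=> [l0 l0_ge0 l0E] [y0 y0P].
(* Generators: the primal weights, the positive and negative parts of [y], the slacks of the dual
   inequalities, the slack of the gap. Coordinates: the primal equations, the dual inequalities, the
   gap. *)
pose gen (g : (J + (I + I)) + (J + unit)) (k : (I + J) + unit) : R :=
  match g, k with
  | inl (inl j), inl (inl i) => P j i
  | inl (inl j), inr _ => h j
  | inl (inr (inl i)), inl (inr j) => P j i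
  | inl (inr (inl i)), inr _ => - X i
  | inl (inr (inr i)), inl (inr j) => - P j i
  | inl (inr (inr i)), inr _ => X i
  | inr (inl j), inl (inr j') => (j == j')%:R
  | inr (inr _), inr _ => 1
  | _, _ => 0
  end.
pose tgt (k : (I + J) + unit) : R :=
  match k with inl (inl i) => X i | inl (inr j) => h j | inr _ => 0 end.
have sum_unit (F : unit -> R) : \sum_u F u = F tt.
  by rewrite (bigD1 tt) //= big1 ?addr0 // => -[].
have sum0 (T : finType) (F : T -> R) : \sum_t F t * 0 = 0.
  by apply: big1 => t _; rewrite mulr0.
have [x Hx|l l_ge0 lE] := @farkas _ _ gen tgt.
  pose q i := x (inl (inl i)); pose mu j := x (inl (inr j)); pose th := x (inr tt).
  have H1 j : \sum_i q i * P j i + th * h j <= 0.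
    have := Hx (inl (inl j)); rewrite !big_sumType sum_unit /= !sum0.
    by rewrite addr0.
  have H2 i : \sum_j mu j * P j i - th * X i <= 0.
    have := Hx (inl (inr (inl i))); rewrite !big_sumType sum_unit /= !sum0.
    by rewrite add0r mulrN.
  have H3 i : - (\sum_j mu j * P j i) + th * X i <= 0.
    have := Hx (inl (inr (inr i))); rewrite !big_sumType sum_unit /= !sum0.
    by rewrite add0r -sumrN; under eq_bigr do rewrite mulrN.
  have H4 j : mu j <= 0.
    have := Hx (inr (inl j)); rewrite !big_sumType sum_unit /= !sum0.
    rewrite add0r mulr0 addr0 (bigD1 j) //= eqxx mulr1 big1 ?addr0 // => k.
    by rewrite eq_sym => /negPf ->; rewrite mulr0.
  have H5 : th <= 0.
    have := Hx (inr (inr tt)); rewrite !big_sumType sum_unit /= !sum0.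
    by rewrite !add0r mulr1.
  rewrite !big_sumType sum_unit /= mulr0 addr0.
  have E i : \sum_j mu j * P j i = th * X i.
    by apply/eqP; rewrite eq_le; move: (H2 i) (H3 i) => ? ?; apply/andP; split; lra.
  have swap (u : J -> R) (v : I -> R) : \sum_j u j * (\sum_i v i * P j i) =
      \sum_i v i * (\sum_j u j * P j i).
    under eq_bigr do rewrite mulr_sumr.
    rewrite exchange_big /=; apply: eq_bigr => i _.
    by rewrite mulr_sumr; apply: eq_bigr => j _; rewrite mulrCA.
  (* [th] is the multiplier of the gap. If it vanishes, the given feasible points [l0] and [y0]
     bound the two halves of the target; if it is negative, dividing by it turns [q] and [mu] into
     feasible points and weak duality concludes. *)
  have [th0|th0] := eqVneq th 0.
    have qX : \sum_i q i * X i <= 0.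
      under eq_bigr do rewrite -l0E.
      rewrite -swap; apply: sumr_le0 => j _; apply: mulr_ge0_le0 => //.
      by have := H1 j; rewrite th0 mul0r addr0.
    suff muh : \sum_j mu j * h j <= 0 by move: qX muh => /=; lra.
    apply: (@le_trans _ _ (\sum_j mu j * (\sum_i y0 i * P j i))).
      by apply: ler_sum => j _; rewrite ler_wnM2l.
    by rewrite swap sumr_le0 // => i _; rewrite E th0 mul0r mulr0.
  have {th0}H5 : th < 0 by rewrite lt_neqAle th0.
  have e1 : th * (\sum_i q i * X i) = \sum_j mu j * (\sum_i q i * P j i).
    by rewrite swap mulr_sumr; apply: eq_bigr => i _; rewrite mulrCA -E.
  rewrite -(ler_nM2l H5) mulr0 mulrDr e1 mulr_sumr -big_split /=.
  by apply: sumr_ge0 => j _; rewrite [th * _]mulrCA -mulrDr mulr_le0.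
exists (fun j => l (inl (inl j))).
exists (fun i => l (inl (inr (inl i))) - l (inl (inr (inr i)))); split => //.
- move=> i; have := lE (inl (inl i)); rewrite !big_sumType sum_unit /= => ->.
  by rewrite !sum0 !mulr0 !addr0.
- move=> j; have := lE (inl (inr j)); rewrite !big_sumType sum_unit /= => ->.
  rewrite !sum0 add0r mulr0 addr0.
  under eq_bigr do rewrite mulrBl.
  rewrite sumrB -[X in X <= _]addr0 lerD //.
    by under [X in _ <= _ + X]eq_bigr do rewrite mulrN; rewrite sumrN.
  by apply: sumr_ge0 => k _; rewrite mulr_ge0 ?ler0n.
- have := lE (inr tt); rewrite !big_sumType sum_unit /= mulr1.
  rewrite !sum0 add0r.
  under [X in _ + (X + _) + _]eq_bigr do rewrite mulrN.
  rewrite sumrN; under [X in _ -> _ <= X]eq_bigr do rewrite mulrBl.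
  by rewrite sumrB; have := l_ge0 (inr (inr tt)); lra.
Qed.
End Farkas.

(** * Convex hulls of finite families *)

Section ConvexHull.
Context {R : realType}.

Lemma convex_setD n (C : set 'rV[R]_n) (x y : 'rV[R]_n) (a b : R) :
  convex_set (C : set (convex_lmodType 'rV[R]_n)) -> 0 <= a -> 0 <= b -> 0 < a + b ->
  C x -> C y -> C ((a + b)^-1 *: (a *: x + b *: y)).
Proof.
move=> cC a0 b0 ab0 Cx Cy.
have p0 : 0 <= a / (a + b) by rewrite divr_ge0 // ltW.
have p1 : a / (a + b) <= 1 by rewrite ler_pdivrMr // mul1r lerDl.
have := cC x y (Itv01 p0 p1); rewrite !inE => /(_ Cx Cy).
rewrite /conv /= => Cxy; suff -> : (a + b)^-1 *: (a *: x + b *: y) =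
  (a / (a + b)) *: x + (1 - a / (a + b)) *: y by [].
rewrite scalerDr !scalerA mulrC; congr (_ + _ *: _).
by field; rewrite gt_eqF.
Qed.

Lemma conv_hullP n (J : finType) (f : J -> 'rV[R]_n) (x : 'rV[R]_n) :
  conv_hull (range f) x <-> exists l : J -> R,
    [/\ forall j, 0 <= l j, \sum_j l j = 1 & x = \sum_j l j *: f j].
Proof.
split.
  have : (fun A B : set 'rV[R]_n => A `<=` B) (conv_hull (range f)) [set x | exists l : J -> R,
    [/\ forall j, 0 <= l j, \sum_j l j = 1 & x = \sum_j l j *: f j]].
    apply: smallest_sub.
      move=> y z t; rewrite !inE => -[l [l0 l1 ->]] [m [m0 m1 ->]].
      exists (fun j => t%:num * l j + (1 - t%:num) * m j); split.
      - move=> j; rewrite addr_ge0 // mulr_ge0 //.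
      - by rewrite big_split /= -!mulr_sumr l1 m1 !mulr1 addrC subrK.
      - rewrite /conv /=.
        under [RHS]eq_bigr do rewrite scalerDl -!scalerA.
        by rewrite big_split /= -!scaler_sumr.
    move=> _ [j _ <-]; exists (fun k => (k == j)%:R); split.
    - by move=> k; rewrite ler0n.
    - by rewrite (bigD1 j) //= eqxx big1 ?addr0 // => k /negPf ->.
    - by rewrite (bigD1 j) //= eqxx scale1r big1 ?addr0 // => k /negPf ->; rewrite scale0r.
  by apply.
move=> [l [l0 l1 ->]] C [cC fC].
have {}fC j : C (f j) by apply: fC; exists j.
(* Partial sums are normalised by their total weight, so that each step combines just two points of
   [C]; on the full index list the total is one. *)
suff H (s : seq J) : 0 < \sum_(j <- s) l j ->
    C ((\sum_(j <- s) l j)^-1 *: \sum_(j <- s) l j *: f j).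
  by have := H (index_enum J); rewrite l1 invr1 scale1r; apply.
elim: s => [|j s IH]; first by rewrite big_nil ltxx.
rewrite !big_cons => pos.
have [s0|s0] := eqVneq (\sum_(k <- s) l k) 0.
  have -> : \sum_(k <- s) l k *: f k = 0.
    move/eqP: s0; rewrite psumr_eq0 // => /allP s0.
    by rewrite big_seq big1 // => k /s0 /eqP ->; rewrite scale0r.
  rewrite s0 !addr0 in pos *; rewrite scalerA mulVf ?scale1r //.
  by rewrite gt_eqF.
have S0 : 0 < \sum_(k <- s) l k by rewrite lt_neqAle eq_sym s0 sumr_ge0.
have -> : \sum_(k <- s) l k *: f k = (\sum_(k <- s) l k) *:
   ((\sum_(k <- s) l k)^-1 *: \sum_(k <- s) l k *: f k).
  by rewrite scalerA mulfV ?scale1r.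
by apply: convex_setD => //; [exact: ltW|exact: IH].
Qed.

Lemma convex_combination n (J : finType) (f : J -> 'rV[R]_n) (l : J -> R) :
  (forall j, 0 <= l j) -> \sum_j l j = 1 -> conv_hull (range f) (\sum_j l j *: f j).
Proof. by move=> *; apply/conv_hullP; exists l. Qed.

Lemma conv_hull_sub n (A B : set 'rV[R]_n) :
  A `<=` conv_hull B -> conv_hull A `<=` conv_hull B.
Proof.
move=> AB x Ax; move=> C [cC BC]; apply: Ax; split => // y /AB; exact.
Qed.

Lemma sub_conv_hull n (A : set 'rV[R]_n) : A `<=` conv_hull A.
Proof. by move=> x Ax C [_]; apply. Qed.

Lemma fset_range n (V : {fset 'rV[R]_n}) :
  [set` V] = range (fun v : V => val v).
Proof.
apply/seteqP; split => [x /= xV|_ [v _ <-]]; last exact: valP.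
by exists [` xV]%fset.
Qed.

Lemma range_fset n (J : finType) (f : J -> 'rV[R]_n) :
  exists V : {fset 'rV[R]_n}, [set` V] = range f.
Proof.
exists [fset f j | j in J]%fset; apply/seteqP; split => x /=.
  by move=> /imfsetP[j _ ->]; exists j.
by move=> [j _ <-]; apply/imfsetP; exists j.
Qed.

Lemma conv_hull_fsetP n (V : {fset 'rV[R]_n}) (x : 'rV[R]_n) :
  conv_hull [set` V] x <-> exists w : 'rV[R]_n -> R,
    [/\ forall v, 0 <= w v, \sum_(v <- V) w v = 1 & x = \sum_(v <- V) w v *: v].
Proof.
rewrite fset_range conv_hullP; split.
  move=> [l [l0 l1 ->]]; exists (fun v => oapp l 0 (insub v)); split.
  - by move=> v; case: insub => //=.
  - by rewrite big_seq_fsetE /= -l1; apply: eq_bigr => j _; rewrite valK.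
  - by rewrite big_seq_fsetE /=; apply: eq_bigr => j _; rewrite valK.
move=> [w [w0 w1 ->]]; exists (fun v => w (val v)); split => //.
- by rewrite -w1 big_seq_fsetE.
- by rewrite big_seq_fsetE.
Qed.

Lemma innerE n (c x : 'rV[R]_n) : inner c x = \sum_j c 0 j * x 0 j.
Proof. by []. Qed.

Lemma inner_sumr n (J : Type) (r : seq J) (P : pred J) (c : 'rV[R]_n) (f : J -> 'rV[R]_n) (l : J -> R) :
  inner c (\sum_(j <- r | P j) l j *: f j) = \sum_(j <- r | P j) l j * inner c (f j).
Proof.
rewrite /inner; under [RHS]eq_bigr do rewrite mulr_sumr.
rewrite exchange_big /=; apply: eq_bigr => i _.
rewrite summxE mulr_sumr; apply: eq_bigr => j _.
by rewrite mxE mulrCA.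
Qed.

Lemma innerC n (c x : 'rV[R]_n) : inner c x = inner x c.
Proof. by apply: eq_bigr => i _; rewrite mulrC. Qed.

Lemma innerDr n (c x y : 'rV[R]_n) : inner c (x + y) = inner c x + inner c y.
Proof. by rewrite /inner -big_split /=; apply: eq_bigr => i _; rewrite mxE mulrDr. Qed.

Lemma innerZr n (c x : 'rV[R]_n) (a : R) : inner c (a *: x) = a * inner c x.
Proof. by rewrite /inner mulr_sumr; apply: eq_bigr => i _; rewrite mxE mulrCA. Qed.

Lemma innerNr n (c x : 'rV[R]_n) : inner c (- x) = - inner c x.
Proof. by rewrite -scaleN1r innerZr mulN1r. Qed.

Lemma innerBr n (c x y : 'rV[R]_n) : inner c (x - y) = inner c x - inner c y.
Proof. by rewrite innerDr innerNr. Qed.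

Lemma innerDl n (c d x : 'rV[R]_n) : inner (c + d) x = inner c x + inner d x.
Proof. by rewrite !(innerC _ x) innerDr. Qed.

Lemma innerZl n (c x : 'rV[R]_n) (a : R) : inner (a *: c) x = a * inner c x.
Proof. by rewrite !(innerC _ x) innerZr. Qed.

Lemma innerNl n (c x : 'rV[R]_n) : inner (- c) x = - inner c x.
Proof. by rewrite !(innerC _ x) innerNr. Qed.

Lemma inner0r n (c : 'rV[R]_n) : inner c 0 = 0.
Proof. by rewrite -(scale0r (0 : 'rV[R]_n)) innerZr mul0r. Qed.

Lemma inner_delta n (c : 'rV[R]_n) i : inner c (delta_mx 0 i) = c 0 i.
Proof.
rewrite /inner (bigD1 i) //= big1 ?mxE ?eqxx ?mulr1 ?addr0 // => j /negPf ji.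
by rewrite mxE ji andbF mulr0.
Qed.

Lemma inner_row_mx n m (c x : 'rV[R]_n) (d y : 'rV[R]_m) :
  inner (row_mx c d) (row_mx x y) = inner c x + inner d y.
Proof.
rewrite /inner big_split_ord /=; congr (_ + _); apply: eq_bigr => i _.
  by rewrite !row_mxEl.
by rewrite !row_mxEr.
Qed.

(** The point is placed at height one: membership in a hull becomes membership in a cone, and the
    component of a functional at [tt] is its constant term. *)
Definition homogenize n (y : 'rV[R]_n) (k : 'I_n + unit) : R :=
  if k is inl i then y 0 i else 1.

Lemma dot_homogenize n (y : 'I_n + unit -> R) (z : 'rV[R]_n) :
  \sum_k y k * homogenize z k = inner (\row_i y (inl i)) z + y (inr tt).
Proof.
rewrite big_sumType /=; congr (_ + _).
  by apply: eq_bigr => i _; rewrite mxE.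
by rewrite (bigD1 tt) //= mulr1 big1 ?addr0 // => -[].
Qed.

Lemma conv_hull_separation n (J : finType) (f : J -> 'rV[R]_n) (x : 'rV[R]_n) :
  ~ conv_hull (range f) x -> exists (c : 'rV[R]_n) (b : R),
    (forall j, inner c (f j) + b <= 0) /\ 0 < inner c x + b.
Proof.
move=> Nx; apply: contrapT => NE; apply: Nx.
have [y Hy|l l0 lE] := @farkas _ _ _ (fun j => homogenize (f j)) (homogenize x).
  rewrite dot_homogenize leNgt; apply/negP => pos; apply: NE.
  exists (\row_i y (inl i)), (y (inr tt)); split => // j.
  by rewrite -dot_homogenize.
apply/conv_hullP; exists l; split => //.
  by have := lE (inr tt); rewrite /= => ->; apply: eq_bigr => j _; rewrite mulr1.
apply/rowP => i; have := lE (inl i); rewrite /= => ->; rewrite summxE.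
by apply: eq_bigr => j _; rewrite mxE.
Qed.

End ConvexHull.

(** * Perfect graphs and poset ideals *)

Section Graphs.
Local Open Scope nat_scope.
Local Open Scope set_scope.
Context {T : finType} {e : rel T}.

Lemma stableP (S : {set T}) :
  reflect {in S &, forall x y, ~~ e x y} (stable e S).
Proof.
apply: (iffP forall_inP) => [H x y xS yS|H x xS]; last first.
  by apply/forall_inP => y yS; exact: H.
by have /forall_inP := H x xS; exact.
Qed.

Lemma cliqueP (K : {set T}) :
  reflect {in K &, forall x y, x != y -> e x y} (clique e K).
Proof.
apply: (iffP forall_inP) => [H x y xS yS|H x xS].
  by have /forall_inP := H x xS => /(_ y yS) /implyP.
by apply/forall_inP => y yS; apply/implyP; exact: H.
Qed.

Lemma stable_sub (S S' : {set T}) : S' \subset S -> stable e S -> stable e S'.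
Proof.
move=> /fintype.subsetP sub /stableP st; apply/stableP => x y /sub xS /sub.
exact: st.
Qed.

Lemma clique_sub (K K' : {set T}) : K' \subset K -> clique e K -> clique e K'.
Proof.
move=> /fintype.subsetP sub /cliqueP cl; apply/cliqueP => x y /sub xS /sub.
exact: cl.
Qed.

Lemma clique0 : clique e finset.set0.
Proof. by apply/cliqueP => x y; rewrite inE. Qed.

Lemma clique1 x : clique e [set x].
Proof. by apply/cliqueP => y z; rewrite !inE => /eqP -> /eqP ->; rewrite eqxx. Qed.

Lemma stable0 : stable e finset.set0.
Proof. by apply/stableP => x y; rewrite inE. Qed.

Lemma card_stable_clique (S K : {set T}) :
  stable e S -> clique e K -> #|S :&: K| <= 1.
Proof.
move=> /stableP st /cliqueP cl; apply/card_le1_eqP => x y.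
rewrite !inE => /andP[xS xK] /andP[yS yK]; apply/eqP/negPn/negP => xy.
by have := cl _ _ yK xK xy; rewrite (negPf (st _ _ yS xS)).
Qed.

Lemma sum_count (F : seq {set T}) (K : {set T}) :
  \sum_(v in K) count (fun S : {set T} => v \in S) F = \sum_(S <- F) #|S :&: K|.
Proof.
elim: F => [|S F IH]; first by rewrite big_nil big1.
rewrite big_cons -IH /= big_split /=; congr addn.
rewrite -sum1_card big_mkcond [RHS]big_mkcond /=; apply: eq_bigr => v _.
by rewrite inE; case: (v \in K); case: (v \in S).
Qed.

End Graphs.

Section Perfect.
Local Open Scope nat_scope.
Local Open Scope set_scope.
Context {T : finType} {e : rel T} {e_irr : irreflexive e}.

Lemma stable1 x : stable e [set x].
Proof. by apply/stableP => y z; rewrite !inE => /eqP -> /eqP ->; rewrite e_irr. Qed.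

Lemma perfect_coloring (S : {set T}) (N : nat) : perfect e_irr ->
  (forall K : {set T}, clique e K -> K \subset S -> #|K| <= N) ->
  exists F : seq {set T}, [/\ size F = N, all (stable e) F &
    forall v, count (fun S' : {set T} => v \in S') F = (v \in S)].
Proof.
move=> /(_ S) perfS bound.
have : chromatic_number (induced_irr (S:=S) e_irr) <= N.
  rewrite perfS; apply/bigmax_leqP => K /cliqueP clK.
  rewrite -(card_imset _ val_inj); apply: bound.
    apply/cliqueP => _ _ /imsetP[x xK ->] /imsetP[y yK ->] xy.
    by apply: (clK x y xK yK); apply: contraNneq xy => ->.
  by apply/fintype.subsetP => _ /imsetP[x xK ->]; exact: valP.
rewrite /chromatic_number; case: ex_minnP => m /existsP[f fP] _ mN.
pose col (v : T) : option nat := omap (fun x => nat_of_ord (f x)) (insub v).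
exists [seq [set v | col v == Some i] | i <- iota 0 N]; split.
- by rewrite size_map size_iota.
- apply/allP => _ /mapP[i _ ->]; apply/stableP => x y; rewrite !inE /col.
  case: insubP => //= x' xS <-; case: insubP => //= y' yS <- /eqP[<-] /eqP[].
  move=> /val_inj/esym xy; apply/negP => exy.
  by have /forallP/(_ x')/forallP/(_ y')/implyP/(_ exy) := fP; rewrite xy eqxx.
- move=> v; rewrite count_map.
  transitivity (count (fun i => col v == Some i) (iota 0 N)).
    by apply: eq_count => i /=; rewrite inE.
  rewrite /col; case: insubP => [x xS _|/negPf ->] /=; last first.
    by apply/eqP; rewrite -leqn0 leqNgt -has_count; apply/hasPn.
  rewrite xS -(eq_count (a1 := pred1 (nat_of_ord (f x)))); last first.
    by move=> i /=; rewrite eq_sym.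
  by rewrite count_uniq_mem ?iota_uniq // mem_iota add0n leq0n (leq_trans (ltn_ord _) mN).
Qed.

Lemma weighted_coloring (y : T -> nat) (N : nat) : perfect e_irr ->
  (forall K : {set T}, clique e K -> \sum_(v in K) y v <= N) ->
  exists F : seq {set T}, [/\ size F = N, all (stable e) F &
    forall v, count (fun S : {set T} => v \in S) F = y v].
Proof.
move=> perf; have [m] := ubnP (\sum_v y v).
elim: m y N => // m IH y N sum_y bound.
have [/existsP[x yx]|/existsPn y1] := boolP [exists x, 1 < y x]; last first.
  have {}y1 v : y v = (v \in [set v | 0 < y v]).
    by rewrite inE; have := y1 v; case: (y v) => [|[]].
  have [|F [sF stF cF]] := @perfect_coloring [set v | 0 < y v] N perf.
    move=> K clK /fintype.subsetP sub; apply: leq_trans (bound K clK).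
    by rewrite -sum1_card; apply: leq_sum => v /sub; rewrite inE.
  by exists F; split => // v; rewrite cF -y1.
pose y' v := y v - (v == x).
have y'E v : y' v + (v == x) = y v.
  by rewrite /y'; case: eqP => [->|_]; rewrite ?addn0 ?subn0 // subnK // ltnW.
have y'_le v : y' v <= y v by rewrite leq_subr.
have sum_y' : \sum_v y' v < \sum_v y v.
  rewrite [ltnLHS](bigD1 x) //= [ltnRHS](bigD1 x) //= -addSn leq_add //.
    by rewrite -(y'E x) eqxx addn1.
  by apply: leq_sum => v _.
have [||F [sF stF cF]] := IH y' N; first exact: leq_trans sum_y' _.
  by move=> K /bound; apply: leq_trans; apply: leq_sum => v _.
have /hasP[S SF xS] : has (fun S : {set T} => x \in S) F.
  by rewrite has_count cF /y' eqxx subn_gt0.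
have stS : stable e S by move/allP: stF; apply.
pose y2 v := y v - (v \in S).
have S_le_y v : (v \in S) <= y v.
  case vS: (v \in S) => //=; apply: leq_trans (y'_le v).
  by rewrite -cF -has_count; apply/hasP; exists S.
have N0 : 0 < N by rewrite -sF -has_predT; apply/hasP; exists S.
have y2E (K : {set T}) : \sum_(v in K) y2 v + #|S :&: K| = \sum_(v in K) y v.
  rewrite -sum1_card [X in _ + X]big_mkcond [X in X + _]big_mkcond.
  rewrite [RHS]big_mkcond -big_split /=; apply: eq_bigr => v _; rewrite inE /y2.
  by case: (v \in K); rewrite ?andbF // andbT -[RHS](subnK (S_le_y v)); case: (v \in S).
have [||F2 [sF2 /= stF2 cF2]] := IH y2 N.-1.
- have := y2E finset.setT; rewrite finset.setIT ![\sum_(v in _) _](eq_bigl predT) => [y2S|v|v]; rewrite ?inE //.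
  rewrite -ltnS; apply: leq_trans sum_y; rewrite ltnS -y2S -[ltnLHS]addn0 ltn_add2l card_gt0.
  by apply/finset.set0Pn; exists x.
- move=> K clK; rewrite -ltnS prednK //.
  have [SK|] := posnP #|S :&: K|; last first.
    by move=> SK; apply: leq_trans (bound K clK); rewrite -y2E -[ltnLHS]addn0 ltn_add2l.
  (* A clique missing [S] misses [x], so [y] and [y'] agree on it; its weight is counted by the [N]
     classes of [F], of which [S] contributes nothing. *)
  have xK : x \notin K.
    by apply/negP => xK; move/eqP: SK; rewrite cards_eq0 => /eqP/finset.setP/(_ x); rewrite !inE xS xK.
  have -> : \sum_(v in K) y2 v = \sum_(S' <- F) #|S' :&: K|.
    have := y2E K; rewrite SK addn0 => ->; rewrite -sum_count; apply: eq_bigr => v vK.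
    by rewrite cF -y'E; case: eqP xK => [<-|]; rewrite ?vK ?addn0.
  rewrite (big_rem S SF) /= SK add0n.
  have -> : N = (size (rem S F)).+1 by rewrite size_rem // sF prednK.
  rewrite ltnS -sum1_size [leqLHS]big_seq [leqRHS]big_seq; apply: leq_sum => S' S'F.
  exact: card_stable_clique (allP stF _ (mem_rem S'F)) clK.
exists (S :: F2); split => /=; first by rewrite sF2 prednK.
  by rewrite stS.
by move=> v; rewrite cF2 subnKC.
Qed.

Lemma perfect_of_coloring :
  (forall (S : {set T}) (N : nat),
    (forall K : {set T}, clique e K -> K \subset S -> #|K| <= N) ->
    exists F : seq {set T}, [/\ size F = N, all (stable e) F &
      {in S, forall v, has (fun S' : {set T} => v \in S') F}]) ->
  perfect e_irr.
Proof.
move=> col S; apply/eqP; rewrite eqn_leq; apply/andP; split.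
  rewrite /chromatic_number; case: ex_minnP => m _; apply.
  have [|F [sF /allP stF coverF]] := col S (clique_number (Defs.induced (S:=S) e)).
    move=> K /cliqueP clK /fintype.subsetP KS.
    pose K' := [set x : {x | x \in S} | val x \in K].
    have -> : #|K| = #|K'|.
      rewrite -(card_imset _ val_inj); apply: eq_card => x.
      apply/idP/imsetP => [xK|[x' x'K ->]]; last by rewrite inE in x'K.
      by exists (exist _ x (KS x xK)); rewrite ?inE.
    rewrite /clique_number; apply: (@leq_bigmax_cond _ _ (fun K => #|pred_of_set K|)).
    apply/cliqueP => x y; rewrite !inE => xK yK xy; apply: clK => //.
  have fP (x : {x | x \in S}) :
      find (fun S' : {set T} => val x \in S') F < clique_number (Defs.induced (S:=S) e).
    by rewrite -[X in _ < X]sF -has_find; apply: coverF; exact: valP.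
  apply/existsP; exists [ffun x => Ordinal (fP x)].
  apply/forallP => x; apply/forallP => y; apply/implyP; apply: contraL.
  rewrite !ffunE => /eqP[xy].
  have /stF/stableP : nth finset.set0 F (find (fun S' : {set T} => val x \in S') F) \in F.
    by rewrite mem_nth // sF.
  have in_color (z : {x | x \in S}) :
      val z \in nth finset.set0 F (find (fun S' : {set T} => val z \in S') F).
    by apply: (@nth_find _ finset.set0 (fun S' : {set T} => val z \in S')); apply: coverF; exact: valP.
  by apply; rewrite ?in_color // xy in_color.
apply/bigmax_leqP => K /cliqueP clK; rewrite /chromatic_number.
case: ex_minnP => m /existsP[f fP] _.
have <- : #|f @: K| = #|K|.
  apply: card_in_imset => x y xK yK fxy; apply/eqP/negPn/negP => /(clK _ _ xK yK) exy.
  by have /forallP/(_ x)/forallP/(_ y)/implyP/(_ exy) := fP; rewrite fxy eqxx.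
by apply: leq_trans (max_card _) _; rewrite card_ord.
Qed.

End Perfect.

Section Ideals.
Local Open Scope nat_scope.
Local Open Scope set_scope.
Context {T : finType} {le : rel T}.

Definition ideal (X : {set T}) : bool :=
  [forall i in X, forall j, le j i ==> (j \in X)].

Lemma idealP (X : {set T}) :
  reflect (forall i j, i \in X -> le j i -> j \in X) (ideal X).
Proof.
apply: (iffP forall_inP) => [H i j iX|H i iX].
  by have /forallP/(_ j)/implyP := H i iX.
by apply/forallP => j; apply/implyP; exact: H.
Qed.

Lemma ideal_layers (u : T -> nat) (s : nat) :
  (forall i, u i <= s) -> (forall i j, le j i -> u i <= u j) ->
  exists F : seq {set T}, [/\ size F = s, all ideal F &
    forall v, count (fun I : {set T} => v \in I) F = u v].
Proof.
move=> us umon; exists [seq [set i | l < u i] | l <- iota 0 s]; split.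
- by rewrite size_map size_iota.
- apply/allP => _ /mapP[l _ ->]; apply/idealP => i j; rewrite !inE => lu /umon.
  exact: leq_trans.
- move=> v; rewrite count_map.
  transitivity (count (fun l => l < u v) (iota 0 s)).
    by apply: eq_count => l /=; rewrite inE.
  rewrite -(subnKC (us v)) iotaD count_cat add0n.
  have /eqP -> : count (fun l => l < u v) (iota 0 (u v)) == size (iota 0 (u v)).
    by rewrite -all_count; apply/allP => l; rewrite mem_iota add0n.
  rewrite size_iota (_ : count _ _ = 0) ?addn0 //; apply/eqP.
  rewrite -leqn0 leqNgt -has_count; apply/hasPn => l.
  by rewrite mem_iota -leqNgt => /andP[].
Qed.

Lemma idealI (X Y : {set T}) : ideal X -> ideal Y -> ideal (X :&: Y).
Proof.
move=> /idealP iX /idealP iY; apply/idealP => i j; rewrite !inE => /andP[iiX iiY] ji.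
by rewrite (iX i j) // (iY i j).
Qed.

Lemma idealU (X Y : {set T}) : ideal X -> ideal Y -> ideal (X :|: Y).
Proof.
move=> /idealP iX /idealP iY; apply/idealP => i j; rewrite !inE => /orP[ii|ii] ji.
  by rewrite (iX i j).
by rewrite (iY i j) ?orbT.
Qed.

Lemma ideal0 : ideal finset.set0.
Proof. by apply/idealP => i j; rewrite inE. Qed.

Lemma idealT : ideal finset.setT.
Proof. by apply/idealP => i j; rewrite !inE. Qed.

End Ideals.

(** * Regular triangulations from integral coordinates *)

Section Auxiliary.
Context {R : realType}.

Lemma small_multiple (T : eqType) (s : seq T) (g delta : T -> R) :
  {in s, forall v, 0 < delta v} ->
  exists2 eps : R, 0 < eps & {in s, forall v, eps * g v < delta v}.
Proof.
move=> pos; suff [eps eps0 H] : exists2 eps : R, 0 < eps &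
    {in s, forall v, eps * `|g v| < delta v}.
  exists eps => // v vs; apply: le_lt_trans (H v vs).
  by rewrite ler_pM2l // ler_norm.
elim: s pos => [|v s IH] pos; first by exists 1.
have [|eps eps0 H] := IH; first by move=> u us; apply: pos; rewrite inE us orbT.
have dv : 0 < delta v by apply: pos; rewrite mem_head.
pose eps1 := delta v / (1 + `|g v|).
have eps1_gt0 : 0 < eps1 by rewrite divr_gt0 // ltr_pwDl.
exists (Num.min eps eps1); first by rewrite lt_min eps0.
move=> u; rewrite inE => /predU1P[->|us].
  apply: (@le_lt_trans _ _ (eps1 * `|g v|)).
    by rewrite ler_wpM2r // ge_min lexx orbT.
  by rewrite -mulrA gtr_pMr // mulrC ltr_pdivrMr ?mul1r ?ltrDr // ltr_pwDl.
by apply: le_lt_trans (H u us); rewrite ler_wpM2r // ge_min lexx.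
Qed.

Lemma sum_fset_sub (V : nmodType) (T : choiceType) (s X : {fset T}) (F : T -> V) :
  (s `<=` X)%fset ->
  \sum_(v <- X) (if v \in s then F v else 0) = \sum_(v <- s) F v.
Proof.
move=> sX; rewrite -big_mkcond -big_filter; apply: perm_big.
apply: uniq_perm; rewrite ?filter_uniq ?fset_uniq // => v.
rewrite mem_filter; case vs: (v \in s) => //=.
exact: (fsubsetP sX).
Qed.

Lemma int_lt1_eq0 (x : R) : x \is a Num.int -> `|x| < 1 -> x = 0.
Proof. by move=> xint; apply: contraTeq => x0; rewrite -leNgt norm_intr_ge1. Qed.

Lemma det_int m (A : 'M[R]_m) :
  (forall i j, A i j \is a Num.int) -> \det A \is a Num.int.
Proof.
by move=> Aint; rewrite rpred_sum // => s _; rewrite rpredMsign rpred_prod.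
Qed.

Lemma int_mul_eq1 (a b : R) :
  a \is a Num.int -> b \is a Num.int -> a * b = 1 -> `|a| = 1.
Proof.
move=> /intrP[m ->] /intrP[k ->]; rewrite -intrM => /eqP.
rewrite (_ : 1 = 1%:~R) // eqr_int => /eqP mk.
rewrite -intr_norm; congr _%:~R; apply/eqP.
have /eqP : (`|m| * `|k| = 1)%N by rewrite -abszM mk.
by rewrite muln_eq1 => /andP[/eqP m1 _]; rewrite -abszE m1.
Qed.

(** This is the barycentric coordinate of [v0] as an affine function. Were there none, the Farkas
    lemma would express the homogenised [v0] through the other vertices, each taken with both signs,
    and that is an affine dependence. *)
Lemma dual_functional n (s : {fset 'rV[R]_n}) (v0 : 'rV[R]_n) :
  affinely_independent s -> v0 \in s -> exists (c : 'rV[R]_n) (b : R),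
    (forall v, v \in s -> v != v0 -> inner c v + b = 0) /\ inner c v0 + b = 1.
Proof.
move=> indep v0s; pose J : finType := ((s `\ v0)%fset * bool)%type.
have [[y]|NE] := pselect (exists y : 'I_n + unit -> R,
    (forall j : J, \sum_i y i * ((-1) ^+ j.2 * homogenize (val j.1) i) <= 0) /\
    0 < \sum_i y i * homogenize v0 i).
  rewrite dot_homogenize => -[H pos]; set d := (X in 0 < X) in pos.
  exists (d^-1 *: \row_i y (inl i)), (d^-1 * y (inr tt)); split; last first.
    by rewrite innerZl -mulrDr mulVf // gt_eqF.
  move=> v vs vv0; rewrite innerZl -mulrDr -dot_homogenize.
  have vJ : v \in (s `\ v0)%fset by rewrite !inE vv0.
  have E (k : bool) : \sum_i y i * ((-1) ^+ k * homogenize v i) = (-1) ^+ k * \sum_i y i * homogenize v i.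
    by rewrite mulr_sumr; apply: eq_bigr => i _; rewrite mulrCA.
  have H1 : (-1) ^+ true * (\sum_i y i * homogenize v i) <= 0 by rewrite -E; exact: H ([` vJ]%fset, true).
  have H2 : (-1) ^+ false * (\sum_i y i * homogenize v i) <= 0 by rewrite -E; exact: H ([` vJ]%fset, false).
  rewrite expr1 mulN1r oppr_le0 in H1; rewrite expr0 mul1r in H2.
  by rewrite (_ : \sum_i _ = 0) ?mulr0 //; apply/eqP; rewrite eq_le H1 H2.
exfalso; have [y Hy|l l0 lE] := @farkas _ _ _ (fun j : J => fun i => (-1) ^+ j.2 * homogenize (val j.1) i) (homogenize v0).
  by rewrite leNgt; apply/negP => pos; apply: NE; exists y.
pose w v : R := if v == v0 then -1 else
  if insub v is Some v' then l (v', false) - l (v', true) else 0.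
have key (V : lmodType R) (F : 'rV[R]_n -> V) :
    \sum_(v <- s) w v *: F v = \sum_j l j *: ((-1) ^+ j.2 *: F (val j.1)) - F v0.
  rewrite (big_fsetD1 v0) //= {1}/w eqxx scaleN1r addrC; congr (_ - _).
  rewrite big_seq_fsetE /=.
  rewrite [RHS](eq_bigr (fun p : J => (fun v b => l (v, b) *: ((-1) ^+ b *: F (val v))) p.1 p.2)); last by case.
  rewrite -(pair_bigA _ (fun v b => l (v, b) *: ((-1) ^+ b *: F (val v)))) /=.
  apply: eq_bigr => v _; rewrite big_bool /= /w.
  have /= := valP v; rewrite !inE => /andP[/negPf -> _]; rewrite valK.
  by rewrite expr1 expr0 scaleN1r scale1r scalerN scalerBl addrC.
have /(_ v0 v0s) : forall v, v \in s -> w v = 0.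
  apply: indep.
    have := key R^o (fun=> 1); under eq_bigr do rewrite /GRing.scale /= mulr1.
    by move=> ->; rewrite -(lE (inr tt)) subrr.
  rewrite (key _ id); apply/rowP => i; rewrite !mxE.
  have := lE (inl i); rewrite /= => ->; rewrite summxE.
  rewrite (_ : \sum_j _ = \sum_j l j * ((-1) ^+ j.2 * val j.1 0 i)) ?subrr //.
  by apply: eq_bigr => j _; rewrite !mxE.
by rewrite /w eqxx => /eqP; rewrite oppr_eq0 oner_eq0.
Qed.

End Auxiliary.

Section Triangulation.
Context {R : realType} {n : nat} (X : {fset 'rV[R]_n}) (h : 'rV[R]_n -> R).

Definition feasible (c : 'rV[R]_n) (b : R) := forall v, v \in X -> inner c v + b <= h v.

Definition lower_cell : set {fset 'rV[R]_n} := [set s | (s `<=` X)%fset /\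
  exists (c : 'rV[R]_n) (b : R), forall a, a \in X ->
    if a \in s then inner c a + b = h a else inner c a + b < h a].

Definition tight_set (c : 'rV[R]_n) (b : R) : {fset 'rV[R]_n} := [fset v in X | (inner c v + b == h v)%R]%fset.

Lemma lower_cell_tight c b : feasible c b -> lower_cell (tight_set c b).
Proof.
move=> feas; split; first by apply/fsubsetP => v; rewrite !inE => /andP[].
exists c, b => a aX; rewrite !inE aX /=; case: eqP => // /eqP ne.
by rewrite lt_neqAle ne feas.
Qed.

Lemma lower_cell_feasible (s : {fset 'rV[R]_n}) c b : (forall a : 'rV[R]_n, a \in X ->
    if a \in s then inner c a + b = h a else inner c a + b < h a) -> feasible c b.
Proof.
by move=> H v vX; have := H v vX; case: ifP => _ => [->|/ltW].
Qed.

(** Integral points of the cone over a lower face have integral weights on its vertices. This takes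
    the place of a genericity condition on the heights: both affine independence and unimodularity
    are derived from it. *)
Context (integral : forall c b (w : 'rV[R]_n -> R), feasible c b ->
  (forall v, v \in X -> 0 <= w v) ->
  (forall v, v \in X -> w v != 0 -> inner c v + b = h v) ->
  \sum_(v <- X) w v \is a Num.int -> lattice (\sum_(v <- X) w v *: v) ->
  forall v, v \in X -> w v \is a Num.int).

Context (X_lattice : forall v, v \in X -> lattice v).

Context (X_span : forall (c : 'rV[R]_n) (b : R),
  (forall v, v \in X -> inner c v + b = 0) -> c = 0 /\ b = 0).

Lemma lower_cell_integral s (w : 'rV[R]_n -> R) : lower_cell s ->
  (forall v, v \in s -> 0 <= w v) ->
  \sum_(v <- s) w v \is a Num.int -> lattice (\sum_(v <- s) w v *: v) ->
  forall v, v \in s -> w v \is a Num.int.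
Proof.
move=> [sX [c [b cell]]] w0 sw lw v vs.
have := integral (w := fun v => if v \in s then w v else 0) (lower_cell_feasible cell).
move=> /(_ _ _ _ _ v (fsubsetP sX v vs)); rewrite vs; apply.
- by move=> u uX; case: ifP => // /w0.
- by move=> u uX; have := cell u uX; case: ifP => //; rewrite eqxx.
- by rewrite sum_fset_sub.
- rewrite (eq_bigr (fun v => if v \in s then w v *: v else 0)) ?sum_fset_sub //.
  by move=> u _; case: ifP; rewrite ?scale0r.
Qed.

Lemma lattice_sum (J : Type) (r : seq J) (P : pred J) (f : J -> 'rV[R]_n) :
  (forall j, P j -> lattice (f j)) -> lattice (\sum_(j <- r | P j) f j).
Proof. by move=> fL i; rewrite summxE rpred_sum // => j /fL. Qed.

(** An affine dependence, scaled below one in absolute value, perturbs the all-ones weights without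
    changing their total or their lattice sum. Integrality makes each perturbation an integer
    smaller than one, hence zero. *)
Lemma lower_cell_indep s : lower_cell s -> affinely_independent s.
Proof.
move=> cell w w0 wv v vs; have sX := fsubsetP cell.1.
pose M := 1 + \sum_(u <- s) `|w u|.
have M0 : 0 < M by rewrite ltr_pwDl // sumr_ge0.
have wM u : u \in s -> `|w u / M| < 1.
  move=> us; rewrite normrM normfV [X in _ / X]gtr0_norm // ltr_pdivrMr // mul1r.
  by rewrite /M (big_fsetD1 u) //= addrCA ltr_pwDr // ltr_pwDl // sumr_ge0.
have : 1 + w v / M \is a Num.int.
  apply: (lower_cell_integral (w := fun u => 1 + w u / M) cell) vs.
  - by move=> u /wM; rewrite ltr_norml => /andP[? _]; rewrite -lerBlDl sub0r ltW.
  - rewrite big_split /= -mulr_suml w0 mul0r addr0 big_const_seq count_predT iter_addr_0.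
    by rewrite rpred_nat.
  - under eq_bigr do rewrite scalerDl scale1r mulrC -scalerA.
    rewrite big_split /= -scaler_sumr wv scaler0 addr0 big_seq.
    by apply: lattice_sum => u /sX; exact: X_lattice.
rewrite rpredDl ?rpred1 // => /int_lt1_eq0 /(_ (wM v vs)) /eqP.
by rewrite mulf_eq0 invr_eq0 (gt_eqF M0) orbF => /eqP.
Qed.

(** The supporting functional is tilted down at the vertices to be dropped. The tilt [c'] is the sum
    of their dual functionals, and [eps] is small enough to keep the result strictly below the
    heights outside [s]. *)
Lemma lower_cell_sub s t : lower_cell s -> (t `<=` s)%fset -> lower_cell t.
Proof.
move=> cell ts; have indep := lower_cell_indep cell.
have [sX [c [b cellP]]] := cell; split; first exact: fsubset_trans ts sX.
have /choice[cb cbP] : forall v0, exists cb : 'rV[R]_n * R, v0 \in s ->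
    (forall v, v \in s -> v != v0 -> inner cb.1 v + cb.2 = 0) /\ inner cb.1 v0 + cb.2 = 1.
  move=> v0; have [v0s|] := boolP (v0 \in s); last by exists (0, 0).
  by have [c' [b' ?]] := dual_functional indep v0s; exists (c', b').
pose c' := \sum_(v <- (s `\` t)%fset) 1 *: (cb v).1.
pose b' := \sum_(v <- (s `\` t)%fset) (cb v).2.
have c'E u : inner c' u + b' = \sum_(v <- (s `\` t)%fset) (inner (cb v).1 u + (cb v).2).
  by rewrite innerC inner_sumr big_split /=; congr (_ + _); apply: eq_bigr => v _; rewrite mul1r innerC.
have c't u : u \in t -> inner c' u + b' = 0.
  move=> ut; rewrite c'E big_seq big1 // => v; rewrite !inE => /andP[vt vs].
  by have [+ _] := cbP v vs; apply; [exact: (fsubsetP ts)|apply: contraNneq vt => <-].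
have c's u : u \in s -> u \notin t -> inner c' u + b' = 1.
  move=> us ut; have ust : u \in (s `\` t)%fset by rewrite !inE ut us.
  rewrite c'E (big_fsetD1 u) //= (cbP u us).2 big_seq big1 ?addr0 // => v.
  by rewrite !inE => /and3P[vu vt vs]; have [+ _] := cbP v vs; apply; rewrite // eq_sym.
have [|eps eps0 epsP] := @small_multiple R _ (X `\` s)%fset
    (fun v => - (inner c' v + b')) (fun v => h v - (inner c v + b)).
  move=> v; rewrite !inE => /andP[vs vX]; rewrite subr_gt0.
  by have := cellP v vX; rewrite (negPf vs).
exists (c - eps *: c'), (b - eps * b') => a aX.
have -> : inner (c - eps *: c') a + (b - eps * b') =
    inner c a + b - eps * (inner c' a + b').
  by rewrite innerDl innerNl innerZl; ring.
case: ifPn => [at_|ant].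
  by rewrite c't // mulr0 subr0; have := cellP a aX; rewrite (fsubsetP ts _ at_).
have := cellP a aX; have [as_ ->|nas _] := boolP (a \in s).
  by rewrite c's // mulr1 ltrBlDr ltrDl.
by have := epsP a; rewrite !inE nas aX mulrN => /(_ isT); lra.
Qed.

(** At a common point both supporting functionals take the value of the lower hull. Hence the
    weights over [t] have no slack against the functional of [s] and vanish outside [s]. *)
Lemma lower_cell_conv s t : lower_cell s -> lower_cell t ->
  conv_hull [set` s] `&` conv_hull [set` t] = conv_hull [set` (s `&` t)%fset].
Proof.
move=> [sX [c [b cs]]] [tX [c' [b' ct]]].
apply/seteqP; split; last first.
  by move=> x xst; split; move: x xst; apply: conv_hull_sub => v /=; rewrite inE => /andP[? ?];
    apply: sub_conv_hull.
move=> x [/conv_hull_fsetP[w [w0 w1 xw]] /conv_hull_fsetP[w' [w'0 w'1 xw']]].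
have inner_comb (r : {fset 'rV[R]_n}) (u : 'rV[R]_n -> R) (a : 'rV[R]_n) (d : R) :
    \sum_(v <- r) u v = 1 ->
    \sum_(v <- r) u v * (inner a v + d) = inner a (\sum_(v <- r) u v *: v) + d.
  move=> u1; under eq_bigr do rewrite mulrDr.
  by rewrite big_split /= -inner_sumr -mulr_suml u1 mul1r.
have tight_s : inner c x + b = \sum_(v <- s) w v * h v.
  rewrite {1}xw -inner_comb // big_seq [RHS]big_seq; apply: eq_bigr => v vs.
  by have := cs v (fsubsetP sX v vs); rewrite vs => ->.
have tight_t : inner c' x + b' = \sum_(v <- t) w' v * h v.
  rewrite {1}xw' -inner_comb // big_seq [RHS]big_seq; apply: eq_bigr => v vt.
  by have := ct v (fsubsetP tX v vt); rewrite vt => ->.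
have le_s v : v \in X -> inner c v + b <= h v := lower_cell_feasible cs (v := v).
have le_t v : v \in X -> inner c' v + b' <= h v := lower_cell_feasible ct (v := v).
have le1 : inner c' x + b' <= inner c x + b.
  rewrite tight_s {1}xw -inner_comb // big_seq [leRHS]big_seq; apply: ler_sum => v vs.
  by rewrite ler_wpM2l // le_t // (fsubsetP sX).
have : \sum_(v <- t) w' v * (h v - (inner c v + b)) = 0.
  apply/eqP; rewrite eq_le; apply/andP; split.
    under eq_bigr do rewrite mulrBr.
    by rewrite sumrB inner_comb // -xw' -tight_t subr_le0.
  rewrite big_seq sumr_ge0 // => v vt; rewrite mulr_ge0 // subr_ge0 le_s //.
  exact: (fsubsetP tX).
rewrite big_seq => /eqP; rewrite psumr_eq0; last first.
  by move=> v vt; rewrite mulr_ge0 // subr_ge0 le_s // (fsubsetP tX).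
move=> /allP w't.
have w'_out v : v \in t -> v \notin s -> w' v = 0.
  move=> vt vs; have vX := fsubsetP tX v vt.
  have := w't v vt; rewrite vt /= mulf_eq0 => /orP[/eqP //|].
  by rewrite subr_eq0; have := cs v vX; rewrite (negPf vs) => /lt_eqF; rewrite eq_sym => ->.
have restr (V : nmodType) (F : 'rV[R]_n -> V) : (forall v, w' v = 0 -> F v = 0) ->
    \sum_(v <- t) F v = \sum_(v <- (s `&` t)%fset) F v.
  move=> F0; rewrite -[RHS](sum_fset_sub (X := t)) ?fsubsetIr // big_seq [RHS]big_seq.
  apply: eq_bigr => v vt; rewrite inE vt andbT; case: ifPn => // vs.
  exact/F0/w'_out.
apply/conv_hull_fsetP; exists w'; split => //.
  by rewrite -restr.
by rewrite -restr // => v ->; rewrite scale0r.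
Qed.

(** Minimising the height over the convex representations of [x] is a linear program. A dual optimum
    is a supporting functional, and complementary slackness puts the optimal weights on its tight
    set. *)
Lemma lower_cell_cover x : conv_hull [set` X] x ->
  exists2 s, lower_cell s & conv_hull [set` s] x.
Proof.
rewrite {1}fset_range => /conv_hullP[l0 [l0_ge0 l0_1 xE]].
have [||l [y [l_ge0 lE]]] := @lp_duality _ _ X (fun v => homogenize (val v)) (fun v => h (val v)) (homogenize x).
- exists l0 => // -[i|[]] /=.
    by rewrite xE summxE; apply: eq_bigr => v _; rewrite mxE.
  by under eq_bigr do rewrite mulr1.
- exists (fun k => if k is inr _ then - \sum_(v : X) `|h (val v)| else 0) => v.
  rewrite dot_homogenize (_ : \row_i _ = 0); last by apply/rowP => i; rewrite !mxE.
  rewrite innerC inner0r add0r (bigD1 v) //= opprD lerBlDr; apply: le_trans (_ : h (val v) <= _).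
    by rewrite lerNl ler_normr lexx orbT.
  by rewrite lerDl sumr_ge0.
move=> feas opt; pose c : 'rV[R]_n := \row_i y (inl i); pose b := y (inr tt).
have {}feas : feasible c b by move=> v vX; have := feas [` vX]%fset; rewrite dot_homogenize.
exists (tight_set c b); first exact: lower_cell_tight.
have l1 : \sum_j l j = 1.
  by have := lE (inr tt) => /= <-; apply: eq_bigr => v _; rewrite mulr1.
have lx : x = \sum_v l v *: val v.
  apply/rowP => i; have := lE (inl i) => /= <-; rewrite summxE.
  by apply: eq_bigr => v _; rewrite mxE.
have : \sum_(v : X) l v * (h (val v) - (inner c (val v) + b)) = 0.
  apply/eqP; rewrite eq_le; apply/andP; split.
    under eq_bigr do rewrite mulrBr mulrDr.
    rewrite sumrB big_split /= -inner_sumr -mulr_suml l1 mul1r -lx.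
    by move: opt; rewrite dot_homogenize subr_le0.
  by rewrite sumr_ge0 // => v _; rewrite mulr_ge0 // subr_ge0 feas // (valP v).
move=> /eqP; rewrite psumr_eq0; last first.
  by move=> v _; rewrite mulr_ge0 // subr_ge0 feas // (valP v).
move=> /allP l_tight.
pose w v := if insub v is Some v' then l v' else 0.
have wE (V : lmodType R) (F : 'rV[R]_n -> V) :
    \sum_(v <- tight_set c b) w v *: F v = \sum_(v : X) l v *: F (val v).
  rewrite -(sum_fset_sub (X := X)); last by apply/fsubsetP => v; rewrite !inE => /andP[].
  rewrite big_seq_fsetE /=; apply: eq_bigr => v _.
  have := l_tight v (mem_index_enum _); rewrite /= mulf_eq0 subr_eq0 [h _ == _]eq_sym.
  by rewrite !inE (valP v) /= /w valK => /orP[/eqP ->|-> //]; rewrite scale0r if_same.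
apply/conv_hull_fsetP; exists w; split.
- by move=> v; rewrite /w; case: insub.
- have := wE R^o (fun=> 1); rewrite /GRing.scale /=; under eq_bigr do rewrite mulr1.
  by move=> ->; under eq_bigr do rewrite mulr1.
- by rewrite wE -lx.
Qed.

(** Ratio test: an affine function vanishing on [s] but positive somewhere on [X] can be added to
    the supporting functional until a new point becomes tight, against maximality. Applied to both
    signs, this makes the function vanish on all of [X]. *)
Lemma maximal_cell_span s : lower_cell s ->
  (forall t, lower_cell t -> (s `<=` t)%fset -> t = s) ->
  forall (c : 'rV[R]_n) (b : R),
    (forall v, v \in s -> inner c v + b = 0) -> c = 0 /\ b = 0.
Proof.
move=> [sX [c0 [b0 cell]]] smax.
have noincr (c : 'rV[R]_n) (b : R) : (forall v, v \in s -> inner c v + b = 0) ->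
    forall v, v \in X -> inner c v + b <= 0.
  move=> cs v0 v0X; rewrite leNgt; apply/negP => pos.
  pose r (v : X) := (h (val v) - (inner c0 (val v) + b0)) / (inner c (val v) + b).
  have pos' : 0 < inner c (val [` v0X]%fset) + b by [].
  case: (@arg_minP _ _ _ [` v0X]%fset (fun v => 0 < inner c (val v) + b) r pos') => v1 v1pos v1min.
  have feas0 := lower_cell_feasible cell.
  have r0 : 0 <= r v1 by apply: divr_ge0; [rewrite subr_ge0 feas0 // (valP v1)|exact: ltW].
  have E v : inner (c0 + r v1 *: c) v + (b0 + r v1 * b) =
      inner c0 v + b0 + r v1 * (inner c v + b).
    by rewrite innerDl innerZl; ring.
  have feas : feasible (c0 + r v1 *: c) (b0 + r v1 * b).
    move=> v vX; rewrite E; have [vpos|vneg] := ltP 0 (inner c v + b).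
      have := v1min [` vX]%fset vpos; rewrite {2}/r /= ler_pdivlMr //; lra.
    have := feas0 v vX; have : r v1 * (inner c v + b) <= 0 by rewrite mulr_ge0_le0.
    by lra.
  have := smax _ (lower_cell_tight feas) _.
  have -> : (s `<=` tight_set (c0 + r v1 *: c) (b0 + r v1 * b))%fset.
    apply/fsubsetP => v vs; rewrite !inE (fsubsetP sX v vs) E cs // mulr0 addr0.
    by have := cell v (fsubsetP sX v vs); rewrite vs => ->; rewrite eqxx.
  move=> /(_ isT) /fsetP /(_ (val v1)); rewrite !inE (valP v1) E /r divfK; last by rewrite gt_eqF.
  rewrite addrC subrK eqxx => /esym v1s.
  by move: v1pos; rewrite cs // ltxx.
move=> c b cs; apply: X_span => v vX; apply/eqP; rewrite eq_le noincr //=.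
have : inner (- c) v + - b <= 0.
  by apply: noincr => // u us; rewrite innerNl -opprD cs // oppr0.
by rewrite innerNl -opprD oppr_le0.
Qed.

Lemma maximal_cell_unimodular s : lower_cell s ->
  (forall t, lower_cell t -> (s `<=` t)%fset -> t = s) -> unimodular_simplex s.
Proof.
move=> cell smax; have span := maximal_cell_span cell smax.
have indep := lower_cell_indep cell; have sX := fsubsetP cell.1.
have [m sz] : exists m, size s = m.+1.
  case E: (size s) => [|m]; last by exists m.
  have [|_ /eqP] := span 0 1; last by rewrite oner_eq0.
  by move=> v; rewrite -index_mem E.
pose v (i : 'I_m.+1) : 'rV[R]_n := s`_i.
have vs i : v i \in s by rewrite mem_nth // sz.
have sum_s (V : zmodType) (F : 'rV[R]_n -> V) : \sum_(x <- s) F x = \sum_i F (v i).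
  by rewrite (big_nth 0) sz big_mkord.
pose lift_fun (mu : 'I_m.+1 -> R) (x : 'rV[R]_n) := mu (inord (index x s)).
have lift_funE mu i : lift_fun mu (v i) = mu i.
  by rewrite /lift_fun index_uniq ?fset_uniq ?sz // inord_val.
have in_s x : x \in s -> exists i, x = v i.
  move=> xs; have lt : (index x s < m.+1)%N by rewrite -sz index_mem.
  by exists (Ordinal lt); rewrite /v nth_index.
pose E := \matrix_(i < m) (v (lift ord0 i) - v ord0).
(* Barycentric weights of the edge combination [mu *m E], shifted by [N] at every vertex to become
   nonnegative; the shift only adds [N] times the sum of the vertices. *)
pose ext (mu : 'rV[R]_m) N (i : 'I_m.+1) : R :=
  if unlift ord0 i is Some j then mu 0 j + N else N - \sum_j mu 0 j.
have ext_sum mu N : \sum_i ext mu N i = N *+ m.+1.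
  rewrite (bigD1_ord ord0) //= {1}/ext unlift_none.
  under eq_bigr do rewrite /ext liftK.
  by rewrite big_split /= sumr_const card_ord addrA subrK mulrS.
have ext_vec mu N : \sum_i ext mu N i *: v i = mu *m E + N *: \sum_i v i.
  rewrite (bigD1_ord ord0) //= {1}/ext unlift_none mulmx_sum_row [in RHS](bigD1_ord ord0) //=.
  rewrite (eq_bigr (fun i => mu 0 i *: v (lift ord0 i) + N *: v (lift ord0 i))); last first.
    by move=> i _; rewrite /ext liftK scalerDl.
  rewrite [in RHS](eq_bigr (fun i => mu 0 i *: v (lift ord0 i) - mu 0 i *: v ord0)); last first.
    by move=> i _; rewrite rowK scalerBr.
  rewrite sumrB -scaler_suml big_split /= scalerBl scalerDr -scaler_sumr.
  by rewrite addrACA [RHS]addrACA; congr (_ + _); rewrite addrC.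
have freeE : row_free E.
  rewrite -kermx_eq0; apply/eqP/row_matrixP => k; rewrite row0.
  set mu := row k _; have muE : mu *m E = 0 by rewrite -row_mul mulmx_ker row0.
  have /(_ _ (vs _)) H : forall x, x \in s -> lift_fun (ext mu 0) x = 0.
    apply: indep; rewrite sum_s; under eq_bigr do rewrite lift_funE.
      by rewrite ext_sum mul0rn.
    by rewrite ext_vec muE scale0r addr0.
  by apply/rowP => j; have := H (lift ord0 j); rewrite lift_funE /ext liftK addr0 => ->; rewrite mxE.
have fullE : row_full E.
  rewrite /row_full -mxrank_tr -/(row_free E^T).
  rewrite -kermx_eq0; apply/eqP/row_matrixP => k; rewrite row0.
  set c := row k _; have cE : c *m E^T = 0 by rewrite -row_mul mulmx_ker row0.
  have cv i : inner c (v (lift ord0 i) - v ord0) = 0.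
    have /rowP/(_ i) := cE; rewrite mxE [RHS]mxE => <-.
    by apply: eq_bigr => j _; rewrite !mxE.
  apply: (span c (- inner c (v ord0)) _).1 => x /in_s[i ->].
  case: (unliftP ord0 i) => [j ->|->]; last by rewrite subrr.
  by rewrite -innerBr cv.
have mn : m = n by exact: etrans (esym (eqP freeE)) (eqP fullE).
subst m; exists v.
  apply/seteqP; split => [x /= /in_s[i ->]|_ [i _ <-]]; first by exists i.
  exact: vs.
rewrite -/E; have unitE : E \in unitmx by rewrite -row_free_unit.
have intE i j : E i j \is a Num.int.
  by rewrite !mxE rpredB // X_lattice // sX.
apply: (int_mul_eq1 (b := \det (invmx E))); last 1 first.
- by rewrite -det_mulmx mulmxV // det1.
- exact: det_int.
(* Row [k] of the inverse writes a unit vector in terms of the edges. With a natural number [N] as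
   shift, its weights represent a lattice point with integral total, so they are integers, and with
   them the entries of the row. *)
apply: det_int => k j; pose mu := row k (invmx E).
pose N : R := (Num.bound (\sum_j `|mu 0 j|))%:R.
have muN : \sum_j `|mu 0 j| <= N by rewrite ltW // archi_boundP // sumr_ge0.
have muN1 i : `|mu 0 i| <= N.
  by apply: le_trans muN; rewrite (bigD1 i) //= lerDl sumr_ge0.
have Nint : N \is a Num.int by rewrite rpred_nat.
have : lift_fun (ext mu N) (v (lift ord0 j)) \is a Num.int.
  apply: (lower_cell_integral cell) => //.
  - move=> x /in_s[i ->]; rewrite lift_funE /ext; case: unliftP => [i' _|_].
      by have := muN1 i'; rewrite ler_norml => /andP[] /=; lra.
    rewrite subr_ge0; apply: le_trans muN; apply: ler_sum => i' _; exact: ler_norm.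
  - by rewrite sum_s; under eq_bigr do rewrite lift_funE; rewrite ext_sum rpredMn.
  - rewrite sum_s; under eq_bigr do rewrite lift_funE.
    rewrite ext_vec -row_mul mulVmx // => i; rewrite !mxE rpredD ?rpred_nat //.
    by rewrite rpredM //; apply: lattice_sum => i' _; apply: X_lattice; exact: sX.
by rewrite lift_funE /ext liftK rpredDr // mxE.
Qed.

Lemma lower_cells_regular_unimodular (A : set 'rV[R]_n) :
  A = conv_hull [set` X] -> A `&` lattice = [set` X] ->
  has_regular_unimodular_triangulation A.
Proof.
move=> AX AL.
have triangT : triangulation A lower_cell.
  split.
  - move=> s cell; split; last exact: lower_cell_indep.
    by rewrite AL => v /= /(fsubsetP cell.1).
  - by move=> s t cell ts; exact: lower_cell_sub cell ts.
  - by move=> s t cs ct; exact: lower_cell_conv.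
  - apply/seteqP; split => x.
      by rewrite AX => /lower_cell_cover[s cell xs]; exists s.
    move=> [s cell]; rewrite AX; apply: conv_hull_sub => v /= vs.
    by apply: sub_conv_hull; exact: (fsubsetP cell.1).
exists lower_cell; split => //; last by move=> s; exact: maximal_cell_unimodular.
exists h => s; split => -[sX [c [b cell]]].
  split; first by rewrite AL => v /= /(fsubsetP sX).
  by exists c, b => a; rewrite AL => /cell.
split; first by apply/fsubsetP => v vs; have := sX v vs; rewrite AL.
by exists c, b => a aX; apply: cell; rewrite AL.
Qed.

End Triangulation.

(** * Integrality of the canonical decomposition *)

Section Ranks.
Context {T : finType}.

(** Cardinality is the leading digit and an enumeration breaks ties. Injectivity makes the powers of
    two in the stable heights distinct. *)
Lemma set_rank_exists : exists r : {set T} -> nat,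
  injective r /\ forall S S' : {set T}, (#|S| < #|S'|)%N -> (r S' < r S)%N.
Proof.
exists (fun S : {set T} => #|{set T}| * (#|T| - #|S|) + enum_rank S)%N; split.
  move=> S S' /(congr1 (modn^~ #|{set T}|)).
  rewrite ![(#|{set T}| * _)%N]mulnC !modnMDl !modn_small ?ltn_ord //.
  by move=> /val_inj/enum_rank_inj.
move=> S S' SS'; have S'T := max_card (mem S').
apply: (@leq_trans (#|{set T}| * (#|T| - #|S'|) + #|{set T}|)).
  by rewrite ltn_add2l ltn_ord.
rewrite -mulnSr; apply: leq_trans (leq_addr _ _); rewrite leq_mul2l.
by apply/orP; right; rewrite ltn_sub2l // (leq_trans SS').
Qed.

Lemma sum_pow2_lt (U : finType) (r : U -> nat) (A : {set U}) (n : nat) :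
  injective r -> {in A, forall a, r a < n}%N -> (\sum_(a in A) 2 ^ r a < 2 ^ n)%N.
Proof.
move=> r_inj; elim: n A => [|n IH] A rA.
  by rewrite big1 // => a /rA.
have [/existsP[a /andP[aA /eqP ra]]|/existsPn noA] := boolP [exists a, (a \in A) && (r a == n)].
  rewrite (big_setD1 a) //= ra expnS mul2n -addnn ltn_add2l; apply: IH => b.
  rewrite !inE => /andP[ba bA]; have := rA b bA; rewrite ltnS leq_eqVlt => /orP[/eqP rb|//].
  by case/negP: ba; apply/eqP/r_inj; rewrite rb ra.
apply: leq_trans (IH A _) _; last by rewrite leq_exp2l.
move=> b bA; have := rA b bA; rewrite ltnS leq_eqVlt => /orP[/eqP rb|//].
by have := noA b; rewrite bA rb eqxx.
Qed.

End Ranks.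

Section ExchangeArithmetic.
Context {R : realFieldType}.

(** Two sets of near-minimal slack are exchanged for two others at equal cost: the height drops by
    at least one, worth [N], while near-minimality tolerates only [2 * B]. [exchange_sum] does the
    same for a family of [k] sets. *)
Lemma exchange_pair (N B m1 m2 h1 h2 h1' h2' c1 c2 c1' c2' : R) :
  2 * B < N -> 0 < N -> N * h1 - c1 <= m1 + B -> N * h2 - c2 <= m2 + B ->
  m1 <= N * h1' - c1' -> m2 <= N * h2' - c2' -> c1' + c2' = c1 + c2 ->
  h1' + h2' + 1 <= h1 + h2 -> False.
Proof. by move=> NB N0 ? ? ? ? ?; rewrite -(ler_pM2l N0) !mulrDr mulr1; lra. Qed.

Lemma exchange_sum (N B m h H H' c C C' k D : R) :
  0 < N -> k * B <= D -> D < N -> N * H - C <= k * (m + B) ->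
  k * m <= N * h - c + (N * H' - C') -> C = c + C' -> h + H' + 1 <= H -> False.
Proof. by move=> N0 ? ? ? ? ?; rewrite -(ler_pM2l N0) !mulrDr mulr1; lra. Qed.

(** Strict submodularity of minus the squared cardinality: with [b] and [b'] the sizes of the two
    differences, the actual gain is [2 * b * b']. *)
Lemma sqr_exchange (a b b' : nat) : (0 < b)%N -> (0 < b')%N ->
  - (a ^ 2)%:R + (1 - ((a + b + b') ^ 2)%:R) <=
  - ((a + b) ^ 2)%:R - ((a + b') ^ 2)%:R :> R.
Proof.
move=> b0 b'0; have : 1 <= b%:R * b'%:R :> R by rewrite -natrM ler1n muln_gt0 b0.
by rewrite !natrX !natrD; lra.
Qed.

End ExchangeArithmetic.

(** * Uncrossing of ideals, pulling of stable sets, and integrality of their weights *)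

Section Core.
Context {R : realType} {T : finType} {le e : rel T} {e_irr : irreflexive e}.
Context (leR : reflexive le) (leT : transitive le) (leA : antisymmetric le).
Context (perf : perfect e_irr).
Context (r : {set T} -> nat) (r_inj : injective r)
  (r_lt : forall S S' : {set T}, (#|S| < #|S'|)%N -> (r S' < r S)%N).

(** Squares favour nested pairs of ideals, and powers of two let one stable set outweigh any family
    of sets of smaller rank. The signs are negative because cells lie on the lower hull. *)
Definition ideal_height (I : {set T}) : R := - (#|I| ^ 2)%:R.
Definition stable_height (S : {set T}) : R := - (2 ^ r S)%:R.

Context (c : T -> R) (N B m1 m2 : R) (alpha beta : {set T} -> R).

Let cost (X : {set T}) := \sum_(i in X) c i.
Let slack1 I := N * ideal_height I - cost I.
Let slack2 S := N * stable_height S - cost S.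

(** [B] is how far the slack of a used set may exceed [m1] or [m2]: zero for the Cayley sum, the
    total perturbation for the Minkowski sum. The factor covers exchanges of two sets and of a
    family of at most [#|{set T}|] stable sets. *)
Context (B_ge0 : 0 <= B) (N_large : B * (2 + #|{set T}|)%:R < N).
Context (slack1_ge : forall I, ideal (le:=le) I -> m1 <= slack1 I)
  (slack2_ge : forall S, stable e S -> m2 <= slack2 S).
Context (alpha_ge0 : forall I, 0 <= alpha I) (beta_ge0 : forall S, 0 <= beta S).
Context (alpha_supp : forall I, alpha I != 0 -> ideal (le:=le) I /\ slack1 I <= m1 + B)
  (beta_supp : forall S, beta S != 0 -> stable e S /\ slack2 S <= m2 + B).

Let N_gt2B : 2 * B < N.
Proof.
apply: le_lt_trans N_large; rewrite mulrC ler_wpM2l //.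
by rewrite natrD lerDl.
Qed.

Let N_gt0 : 0 < N.
Proof. by apply: le_lt_trans N_gt2B; rewrite mulr_ge0. Qed.

(** Uncrossing: replacing two incomparable ideals by their intersection and union keeps the cost and
    lowers the height. *)
Lemma alpha_chain (I J : {set T}) : alpha I != 0 -> alpha J != 0 ->
  (I \subset J) || (J \subset I).
Proof.
move=> /alpha_supp[idI sI] /alpha_supp[idJ sJ].
apply/negPn/negP; rewrite negb_or => /andP[nIJ nJI].
have sII := slack1_ge (idealI idI idJ); have sIU := slack1_ge (idealU idI idJ).
have costE : cost (I :&: J) + cost (I :|: J) = cost I + cost J.
  rewrite /cost ![\sum_(i in _) _]big_mkcond -!big_split /=; apply: eq_bigr => i _.
  by rewrite !inE; case: (i \in I); case: (i \in J); rewrite ?addr0 ?add0r.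
have heightE : ideal_height (I :&: J) + ideal_height (I :|: J) + 1 <=
    ideal_height I + ideal_height J.
  have IJ : (0 < #|I :\: J|)%N by rewrite card_gt0 finset.setD_eq0.
  have JI : (0 < #|J :\: I|)%N by rewrite card_gt0 finset.setD_eq0.
  have cI := cardsID J I; have cJ := cardsID I J; have cU := cardsUI I J.
  rewrite finset.setIC in cJ; rewrite /ideal_height -cI -cJ.
  have -> : #|I :|: J| = (#|I :&: J| + #|I :\: J| + #|J :\: I|)%N.
    by apply/eqP; rewrite -(eqn_add2r #|I :&: J|) cU cI -cJ [(#|I :&: J| + _)%N]addnC addnA.
  by rewrite -addrA [X in _ + X]addrC; apply: sqr_exchange.
exact: exchange_pair N_gt2B N_gt0 sI sJ sII sIU costE heightE.
Qed.

(** Otherwise [i] could move from [S] to [I]: the cost is kept, the ideal height drops by at least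
    one, and the stable height does not rise because [S :\ i] has larger rank. So the ideals absorb
    all that the order allows. *)
Lemma alpha_beta_link (I S : {set T}) i : alpha I != 0 -> beta S != 0 ->
  i \in S -> i \notin I -> ~~ ideal (le:=le) (i |: I).
Proof.
move=> /alpha_supp[idI sI] /beta_supp[stS sS] iS iI; apply/negP => idiI.
have s1 := slack1_ge idiI; have s2 := slack2_ge (stable_sub (subD1set S i) stS).
have costE : cost (i |: I) + cost (S :\ i) = cost I + cost S.
  by rewrite /cost big_setU1 //= [X in _ = _ + X](big_setD1 i) //=; ring.
have h1 : ideal_height (i |: I) + 1 <= ideal_height I.
  rewrite /ideal_height cardsU1 iI /= !natrX natrD.
  by have := ler0n R #|I|; lra.
have h2 : stable_height (S :\ i) <= stable_height S.
  rewrite /stable_height lerN2 ler_nat leq_exp2l //; apply/ltnW/r_lt.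
  by rewrite [leqRHS](cardsD1 i) iS.
apply: exchange_pair N_gt2B N_gt0 sI sS s1 s2 costE _.
by rewrite addrAC lerD.
Qed.

(** If both alternatives fail, perfection rewrites the used sets of rank below [r S] as [S] together
    with one set fewer than before. The cost is unchanged, and the single power [2 ^ r S] exceeds
    the sum of all those removed, against near-minimality. *)
Lemma beta_pull (S : {set T}) : stable e S ->
  (exists2 i, i \in S & forall S', beta S' != 0 -> (r S' < r S)%N -> i \notin S') \/
  (exists K : {set T}, [/\ clique e K, S :&: K = finset.set0 &
    forall S', beta S' != 0 -> (r S' < r S)%N -> S' :&: K != finset.set0]).
Proof.
move=> stS; have [sigma sigmaE] : exists sigma : {set {set T}}, forall S',
    (S' \in sigma) = (beta S' != 0) && (r S' < r S)%N.
  by exists [set S' : {set T} | (beta S' != 0) && (r S' < r S)%N]%SET => S'; rewrite inE.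
have [/existsP[i /andP[iS /forallP H]]|/existsPn noi] :=
    boolP [exists i, (i \in S) && [forall S' in sigma, i \notin S']].
  left; exists i => // S' bS' rS'; have := H S'.
  by rewrite sigmaE bS' rS'.
have [/existsP[K /and3P[cK /eqP SK /forallP H]]|/existsPn noK] :=
    boolP [exists K : {set T}, [&& clique e K, S :&: K == finset.set0 &
      [forall S' in sigma, S' :&: K != finset.set0]]].
  right; exists K; split => // S' bS' rS'; have := H S'.
  by rewrite sigmaE bS' rS'.
exfalso.
have covered i : i \in S -> exists2 S', S' \in sigma & i \in S'.
  move=> iS; have := noi i; rewrite iS /= => /forallPn[S'].
  by rewrite negb_imply negbK => /andP[? ?]; exists S'.
have missed K : clique e K -> S :&: K = finset.set0 ->
    exists2 S', S' \in sigma & S' :&: K = finset.set0.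
  move=> cK SK; have := noK K; rewrite cK SK eqxx /= => /forallPn[S'].
  by rewrite negb_imply negbK => /andP[? /eqP ?]; exists S'.
have sigma_st S' : S' \in sigma -> stable e S'.
  by rewrite sigmaE => /andP[/beta_supp[]].
have sigma_gt0 : (0 < #|sigma|)%N.
  have [|S' S's _] := missed finset.set0 (clique0); first exact: finset.setI0.
  by rewrite card_gt0; apply/set0Pn; exists S'.
pose cnt v := count (fun S' : {set T} => v \in S') (enum sigma).
have S_cnt v : ((v \in S) <= cnt v)%N.
  case vS: (v \in S) => //=; have [S' S's vS'] := covered v vS.
  by rewrite -has_count; apply/hasP; exists S'; rewrite ?mem_enum.
(* A clique disjoint from [S] is missed by some member of [sigma], and a clique meeting [S] loses
   one when [S] is subtracted; in both cases the residual weight is at most [#|sigma|.-1]. *)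
have cnt_clique (K : {set T}) : clique e K -> (\sum_(v in K) cnt v <= #|S :&: K| + #|sigma|.-1)%N.
  move=> cK; rewrite sum_count big_enum /=.
  have le1 S' : S' \in sigma -> (#|S' :&: K| <= 1)%N.
    by move=> /sigma_st stS'; exact: card_stable_clique stS' cK.
  have [/eqP|] := posnP #|S :&: K|.
    rewrite cards_eq0 => /eqP SK; rewrite SK cards0 add0n.
    have [S' S's S'K] := missed K cK SK; rewrite (bigD1 S') //= S'K cards0 add0n.
    apply: leq_trans (_ : \sum_(S'' in sigma :\ S') 1 <= _)%N; last first.
      by rewrite sum1_card [X in (_ <= X.-1)%N](cardsD1 S') S's.
    have E S'' : (S'' \in sigma) && (S'' != S') = (S'' \in sigma :\ S') by rewrite !inE andbC.
    by rewrite (eq_bigl _ _ E); apply: leq_sum => S''; rewrite inE => /andP[_ /le1].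
  move=> SK; apply: (@leq_trans #|sigma|); last by rewrite -{1}(prednK sigma_gt0) -add1n leq_add2r.
  by rewrite -sum1_card; apply: leq_sum => S' /le1.
have [|F [sF stF cF]] := weighted_coloring (y := fun v => (cnt v - (v \in S))%N) (N := #|sigma|.-1) perf.
  move=> K cK; have := cnt_clique K cK.
  have -> : (\sum_(v in K) cnt v = #|S :&: K| + \sum_(v in K) (cnt v - (v \in S)))%N; last by rewrite leq_add2l.
  rewrite -sum1_card big_mkcond [in RHS]big_mkcond /= [X in (_ + X)%N]big_mkcond -big_split /=.
  apply: eq_bigr => v _; rewrite inE andbC; case: (v \in K) => //=.
  by rewrite -[LHS](subnKC (S_cnt v)); case: (v \in S).
have cost_count (G : seq {set T}) :
    \sum_(S' <- G) cost S' = \sum_v c v * (count (fun S' : {set T} => v \in S') G)%:R.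
  elim: G => [|S' G IH]; first by rewrite big_nil big1 // => v _; rewrite mulr0.
  rewrite big_cons IH /cost big_mkcond -big_split /=; apply: eq_bigr => v _.
  by rewrite natrD mulrDr; case: (v \in S'); rewrite ?mulr1 ?mulr0.
have costE : \sum_(S' in sigma) cost S' = cost S + \sum_(S' <- F) cost S'.
  have -> : cost S = \sum_v (if v \in S then c v else 0) by rewrite /cost big_mkcond.
  rewrite -big_enum !cost_count -big_split /=; apply: eq_bigr => v _.
  rewrite cF -/(cnt v) natrB // mulrBr.
  by case: (v \in S); rewrite ?mulr1 ?mulr0 ?subr0 ?add0r // addrC subrK.
have upper : \sum_(S' in sigma) slack2 S' <= #|sigma|%:R * (m2 + B).
  rewrite mulr_natl -sumr_const; apply: ler_sum => S'.
  by rewrite sigmaE => /andP[/beta_supp[]].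
have lower : #|sigma|%:R * m2 <= slack2 S + \sum_(S' <- F) slack2 S'.
  rewrite -(prednK sigma_gt0) -add1n natrD mulrDl mul1r lerD ?slack2_ge //.
  rewrite -sF -sum1_size natr_sum mulr_suml big_seq [leRHS]big_seq; apply: ler_sum => S' S'F.
  by rewrite mul1r slack2_ge //; exact: (allP stF).
have height : stable_height S + \sum_(S' <- F) stable_height S' + 1 <=
    \sum_(S' in sigma) stable_height S'.
  have pow : (\sum_(S' in sigma) 2 ^ r S' < 2 ^ r S)%N.
    by apply: sum_pow2_lt; [exact: r_inj|move=> S'; rewrite sigmaE => /andP[]].
  have F_le0 : \sum_(S' <- F) stable_height S' <= 0.
    by apply: sumr_le0 => S' _; rewrite oppr_le0.
  have -> : \sum_(S' in sigma) stable_height S' = - (\sum_(S' in sigma) 2 ^ r S')%:R.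
    by rewrite natr_sum -sumrN.
  apply: (@le_trans _ _ (stable_height S + 1)); first by rewrite lerD2r gerDl.
  by rewrite lerNr opprD opprK lerBrDr -(natrD _ _ 1) addn1 ler_nat.
have sigmaB : #|sigma|%:R * B <= B * (2 + #|{set T}|)%:R.
  by rewrite mulrC ler_wpM2l // ler_nat (leq_trans (max_card _)) // leq_addl.
rewrite sumrB -mulr_sumr in upper; rewrite sumrB -mulr_sumr in lower.
exact: exchange_sum N_gt0 sigmaB N_large upper lower costE height.
Qed.

Let u i := \sum_(I : {set T} | i \in I) alpha I.
Let w i := \sum_(S : {set T} | i \in S) beta S.

Context (int_x : forall i, u i + w i \is a Num.int)
  (int_s : \sum_I alpha I \is a Num.int) (int_t : \sum_S beta S \is a Num.int).

(** Induction upwards in the order. If [i] lies in no used stable set, or in every used ideal, then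
    [u i] is a given integer. Otherwise the largest used ideal omitting [i] also omits some [j]
    below [i], and by the chain property every used ideal contains [i] exactly when it contains
    [j]. *)
Lemma layer_int i : u i \is a Num.int.
Proof.
have [k] := ubnP #|[set j | le j i]%SET|; elim: k i => // k IH i lt_k.
have [/existsP[S /andP[bS iS]]|/existsPn noS] := boolP [exists S : {set T}, (beta S != 0) && (i \in S)]; last first.
  have w0 : w i = 0.
    by apply: big1 => S iS; have := noS S; rewrite iS andbT negbK => /eqP.
  by have := int_x i; rewrite w0 addr0.
have [/existsP[I0 aI0]|/existsPn noI] := boolP [exists I : {set T}, (alpha I != 0) && (i \notin I)]; last first.
  suff -> : u i = \sum_I alpha I by [].
  rewrite [RHS](bigID (fun I : {set T} => i \in I)) /= [X in _ + X]big1 ?addr0 // => I iI.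
  by have := noI I; rewrite iI andbT negbK => /eqP.
case: (@arg_maxnP _ I0 (fun I : {set T} => (alpha I != 0) && (i \notin I)) (fun I : {set T} => #|I|) aI0).
move=> I /andP[aI iI] Imax.
have /forall_inPn[a] := alpha_beta_link aI bS iS iI.
rewrite !inE => aiI /forallPn[j]; rewrite negb_imply !inE negb_or => /and3P[ja ji jI].
have ai : a = i.
  case/orP: aiI => [/eqP //|aI']; case/negP: jI.
  by have [/idealP idI _] := alpha_supp aI; apply: idI aI' ja.
rewrite ai in ja.
have -> : u i = u j.
  rewrite /u [LHS]big_mkcond [RHS]big_mkcond; apply: eq_bigr => I' _.
  have [->|aI'] := eqVneq (alpha I') 0; first by rewrite !if_same.
  have [/idealP idI' _] := alpha_supp aI'.
  suff -> : (i \in I') = (j \in I') by [].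
  apply/idP/idP => [iI'|jI']; first exact: idI' iI' ja.
  apply/negPn/negP => iI'; have := Imax I'; rewrite aI' iI' => /(_ isT) cI'.
  case/negP: jI; case/orP: (alpha_chain aI aI') => [sub|/fintype.subsetP]; last exact.
  by have /eqP -> : I == I' by rewrite eqEcard sub.
apply: IH; rewrite -ltnS; apply: leq_trans lt_k; rewrite ltnS.
apply: proper_card; apply/properP; split.
  by apply/fintype.subsetP => k'; rewrite !inE => /leT; apply.
exists i; rewrite inE ?leR //; apply/negP => ij.
by case/negP: ji; apply/eqP/leA; rewrite ja ij.
Qed.

(** Take an element of [I] missing from the next smaller used ideal: the used ideals containing it
    are exactly those above [I], so the sum is a layer [u i]. If no smaller ideal is used, it is the
    total weight. *)
Lemma above_int I : alpha I != 0 ->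
  \sum_(I' : {set T} | I \subset I') alpha I' \is a Num.int.
Proof.
move=> aI.
have [/existsP[J0 aJ0]|/existsPn noJ] := boolP [exists J : {set T}, (alpha J != 0) && (J \proper I)]; last first.
  suff -> : \sum_(I' : {set T} | I \subset I') alpha I' = \sum_I' alpha I' by [].
  rewrite [RHS](bigID (fun I' : {set T} => I \subset I')) /= [X in _ + X]big1 ?addr0 // => I' II'.
  apply/eqP/negPn/negP => aI'; have := noJ I'; rewrite aI' /=.
  by have := alpha_chain aI aI'; rewrite (negPf II') /= properE II' => ->.
case: (@arg_maxnP _ J0 (fun J : {set T} => (alpha J != 0) && (J \proper I)) (fun J : {set T} => #|J|) aJ0).
move=> J /andP[aJ /properP[JI [i iI iJ]]] Jmax.
suff <- : u i = \sum_(I' : {set T} | I \subset I') alpha I' by exact: layer_int.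
rewrite /u [LHS]big_mkcond [RHS]big_mkcond; apply: eq_bigr => I' _.
have [->|aI'] := eqVneq (alpha I') 0; first by rewrite !if_same.
suff -> : (i \in I') = (I \subset I') by [].
apply/idP/idP => [iI'|/fintype.subsetP]; last exact.
apply/negPn/negP => II'; have := alpha_chain aI aI'; rewrite (negPf II') /= => I'I.
have := Jmax I'; rewrite aI' properE I'I II' => /(_ isT) cI'.
case/negP: iJ; case/orP: (alpha_chain aJ aI') => [sub|/fintype.subsetP]; last exact.
by have /eqP -> : J == I' by rewrite eqEcard sub.
Qed.

Lemma alpha_int I : alpha I \is a Num.int.
Proof.
have [k] := ubnP #|~: I|; elim: k I => // k IH I lt_k.
have [->|aI] := eqVneq (alpha I) 0; first by rewrite rpred0.
have := above_int aI; rewrite (bigD1 I) //= rpredDr // rpred_sum // => I' /andP[II' neq].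
apply: IH; rewrite -ltnS; apply: leq_trans lt_k; rewrite ltnS.
by rewrite -(ltn_add2l #|I|) cardsC -(cardsC I') ltn_add2r proper_card // finset.properEneq eq_sym neq.
Qed.

(** Induction from the largest rank down. [beta_pull] supplies an integral function of sets that is
    one at [S], zero on used sets of smaller rank, and of integral weighted sum: the indicator of
    containing [i], or one minus the size of the intersection with [K]. *)
Lemma beta_int S : beta S \is a Num.int.
Proof.
have [k] := ubnP (\max_S' r S' - r S)%N; elim: k S => // k IH S lt_k.
have [->|bS] := eqVneq (beta S) 0; first by rewrite rpred0.
have IH' S' : (r S < r S')%N -> beta S' \is a Num.int.
  move=> lt_r; apply: IH; rewrite -ltnS; apply: leq_trans lt_k; rewrite ltnS.
  by apply: ltn_sub2l => //; apply: leq_trans lt_r _; exact: leq_bigmax.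
have w_int i : w i \is a Num.int.
  by have := int_x i; rewrite rpredDl // layer_int.
have peel (g : {set T} -> R) : (forall S', g S' \is a Num.int) ->
    \sum_S' g S' * beta S' \is a Num.int -> g S = 1 ->
    (forall S', beta S' != 0 -> (r S' < r S)%N -> g S' = 0) -> beta S \is a Num.int.
  move=> g_int sum_int gS g0; move: sum_int; rewrite (bigD1 S) //= gS mul1r rpredDr //.
  apply: rpred_sum => S' S'S; have [lt_r|lt_r|/r_inj eq_r] := ltngtP (r S') (r S).
  - by have [->|bS'] := eqVneq (beta S') 0; rewrite ?mulr0 ?rpred0 // g0 // mul0r rpred0.
  - by rewrite rpredM // IH'.
  - by rewrite eq_r eqxx in S'S.
have [stS _] := beta_supp bS.
have [[i iS H]|[K [cK SK H]]] := beta_pull stS.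
  apply: (peel (fun S' => (i \in S')%:R)); rewrite ?iS //.
  - rewrite (eq_bigr (fun S' : {set T} => if i \in S' then beta S' else 0)).
      by rewrite -big_mkcond; exact: w_int.
    by move=> S' _; case: (i \in S'); rewrite ?mul1r ?mul0r.
  - by move=> S' bS' lt_r; rewrite (negPf (H _ bS' lt_r)).
apply: (peel (fun S' => 1 - #|S' :&: K|%:R)); rewrite ?SK ?cards0 ?subr0 //.
- by move=> S'; rewrite rpredB ?rpred1 ?rpred_nat.
- under eq_bigr do rewrite mulrBl mul1r.
  rewrite sumrB rpredB //.
  suff -> : \sum_(S' : {set T}) #|S' :&: K|%:R * beta S' = \sum_(v in K) w v by rewrite rpred_sum.
  rewrite /w; under [RHS]eq_bigr do rewrite big_mkcond /=.
  rewrite exchange_big /=; apply: eq_bigr => S' _.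
  rewrite -big_mkcondr -sum1_card natr_sum mulr_suml; apply: eq_big => v; rewrite ?inE ?mul1r //.
  by rewrite andbC.
- move=> S' bS' lt_r; have [stS' _] := beta_supp bS'.
  suff -> : #|S' :&: K| = 1%N by rewrite subrr.
  apply/eqP; rewrite eqn_leq (card_stable_clique stS' cK) card_gt0; exact: H.
Qed.

End Core.

(** * Vertices of the Cayley and Minkowski sums *)

Section Families.
Context {R : realType} {n : nat} {J : finType} (f : J -> 'rV[R]_n).

Lemma dilate_conv_hullP (k : nat) (x : 'rV[R]_n) : (0 < k)%N ->
  dilate k (conv_hull (range f)) x <-> exists l : J -> R,
    [/\ forall j, 0 <= l j, \sum_j l j = k%:R & x = \sum_j l j *: f j].
Proof.
move=> k0; have k_gt0 : 0 < k%:R :> R by rewrite ltr0n.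
split.
  move=> [y /conv_hullP[l [l0 l1 ->]] <-]; exists (fun j => k%:R * l j); split.
  - by move=> j; rewrite mulr_ge0 // ler0n.
  - by rewrite -mulr_sumr l1 mulr1.
  - by rewrite scaler_sumr; apply: eq_bigr => j _; rewrite scalerA.
move=> [l [l0 l1 ->]]; exists (k%:R^-1 *: \sum_j l j *: f j); last first.
  by rewrite scalerA mulfV ?scale1r // gt_eqF.
apply/conv_hullP; exists (fun j => k%:R^-1 * l j); split.
- by move=> j; rewrite mulr_ge0 // invr_ge0 ler0n.
- by rewrite -mulr_sumr l1 mulVf // gt_eqF.
- by rewrite scaler_sumr; apply: eq_bigr => j _; rewrite scalerA.
Qed.

Lemma dilate1 (A : set 'rV[R]_n) : dilate 1 A = A.
Proof.
apply/seteqP; split => [_ [y Ay <-]|y Ay]; first by rewrite scale1r.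
by exists y; rewrite ?scale1r.
Qed.

Lemma lattice_polytope_range : (forall j, lattice (f j)) ->
  lattice_polytope (conv_hull (range f)).
Proof.
move=> fL; have [V VE] := range_fset f; exists V; split; last by rewrite VE.
by rewrite VE => _ [j _ <-]; exact: fL.
Qed.

Lemma sum_seq_count (F : seq J) : \sum_(j <- F) f j = \sum_j (count_mem j F)%:R *: f j.
Proof.
elim: F => [|i F IH].
  by rewrite big_nil big1 // => j _; rewrite scale0r.
rewrite big_cons IH (bigD1 i) //= [RHS](bigD1 i) //= eqxx natrD scalerDl scale1r.
rewrite -addrA; congr (_ + (_ + _)); apply: eq_bigr => j /negPf ji.
by rewrite eq_sym ji.
Qed.

Lemma sum_count_size (F : seq J) : (\sum_j count_mem j F = size F)%N.
Proof.
elim: F => [|i F IH]; first by rewrite big1.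
rewrite /= (bigD1 i) //= eqxx -IH [in RHS](bigD1 i) //= add1n addSn.
congr (_ + _).+1; apply: eq_bigr => j /negPf ji.
by rewrite eq_sym ji.
Qed.

Context (f_lattice : forall j, lattice (f j))
  (f_decomp : forall k x, (0 < k)%N -> dilate k (conv_hull (range f)) x -> lattice x ->
    exists2 F : seq J, size F = k & x = \sum_(j <- F) f j).

Lemma lattice_sum_seq (F : seq J) : lattice (\sum_(j <- F) f j).
Proof. exact: lattice_sum. Qed.

Lemma lattice_points_range : conv_hull (range f) `&` lattice = range f.
Proof.
apply/seteqP; split => [x [Ax Lx]|_ [j _ <-]]; last first.
  by split => //; apply: sub_conv_hull; exists j.
have [||F sF ->] := f_decomp (k := 1) _ _ Lx; rewrite ?dilate1 //.
case: F sF => [|j [|//]] // _; rewrite big_seq1; by exists j.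
Qed.

Lemma idp_range : idp (conv_hull (range f)).
Proof.
split; first exact: lattice_polytope_range.
move=> k k0; apply/seteqP; split => x.
  move=> [y [Ay Ly] [z [Az Lz] <-]]; split; last by move=> i; rewrite mxE rpredD ?Ly ?Lz.
  move: Ay Az => /conv_hullP[l [l0 l1 ->]] /(dilate_conv_hullP _ k0)[m [m0 m1 ->]].
  apply/(dilate_conv_hullP _ (ltn0Sn k)); exists (fun j => l j + m j); split.
  - by move=> j; rewrite addr_ge0.
  - by rewrite big_split /= l1 m1 mulrS.
  - by rewrite -big_split /=; apply: eq_bigr => j _; rewrite scalerDl.
move=> [Ax Lx]; have [F sF ->] := f_decomp (ltn0Sn k) Ax Lx.
case: F sF => [//|j F] [sF]; rewrite big_cons.
exists (f j); first by split => //; apply: sub_conv_hull; exists j.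
exists (\sum_(i <- F) f i) => //; split; last exact: lattice_sum_seq.
apply/(dilate_conv_hullP _ k0); exists (fun i => (count_mem i F)%:R); split.
- by move=> i; rewrite ler0n.
- by rewrite -natr_sum sum_count_size sF.
- exact: sum_seq_count.
Qed.

Context (j0 : J) (h : J -> R).

(* A point may have several labels; the height of a point is the least height
   of its labels. *)
Lemma family_triangulation :
  (forall (c : 'rV[R]_n) (b : R), (forall j, inner c (f j) + b = 0) -> c = 0 /\ b = 0) ->
  (forall (c : 'rV[R]_n) (b : R) (l : J -> R),
    (forall j, inner c (f j) + b <= h j) -> (forall j, 0 <= l j) ->
    (forall j, l j != 0 -> inner c (f j) + b = h j) ->
    \sum_j l j \is a Num.int -> lattice (\sum_j l j *: f j) ->
    forall j, l j \is a Num.int) ->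
  has_regular_unimodular_triangulation (conv_hull (range f)).
Proof.
move=> span integral.
have /choice[canon canonP] : forall v : 'rV[R]_n, exists j, forall i, f i = v ->
    f j = v /\ h j <= h i.
  move=> v; have [[i fi]|no] := pselect (exists i, f i = v); last first.
    by exists j0 => i fi; case: no; exists i.
  have Pi : f i == v by rewrite fi.
  case: (@arg_minP _ _ _ i (fun i => f i == v) h Pi) => j /eqP fj jmin.
  by exists j => k /eqP fk; split => //; apply: jmin.
have f_canon j : f (canon (f j)) = f j by have [] := canonP (f j) j erefl.
have h_canon j : h (canon (f j)) <= h j by have [] := canonP (f j) j erefl.
have [X XE] := range_fset f.
have X_f v : (v \in X) <-> (exists j, f j = v).
  split => [vX|[j <-]].
    by have : [set` X] v by []; rewrite XE => -[j _ <-]; exists j.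
  by have : range f (f j); [exists j|rewrite -XE].
have fX j : f j \in X by apply/X_f; exists j.
apply: (lower_cells_regular_unimodular (X := X) (h := fun v => h (canon v))).
- move=> c b w feas w0 tight sw lw _ /X_f[j <-].
  pose l j := if j == canon (f j) then w (f j) else 0.
  have sumE (V : nmodType) (G : 'rV[R]_n -> V) :
      \sum_(v <- X) G v = \sum_(j | j == canon (f j)) G (f j).
    rewrite -[RHS]big_filter -(big_map f xpredT G); apply: perm_big.
    apply: uniq_perm; first exact: fset_uniq.
      rewrite map_inj_in_uniq ?filter_uniq ?index_enum_uniq // => i k.
      by rewrite !mem_filter => /andP[/eqP -> _] /andP[/eqP -> _]; rewrite !f_canon => ->.
    move=> v; apply/idP/mapP => [/X_f[i <-]|[i _ ->]]; last exact: fX.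
    by exists (canon (f i)); rewrite ?mem_filter ?mem_index_enum ?f_canon ?eqxx.
  have := integral c b l _ _ _ _ _ (canon (f j)); rewrite /l f_canon eqxx; apply.
  + by move=> i; apply: le_trans (h_canon i); exact: feas.
  + by move=> i; case: eqP => // _; exact: w0.
  + by move=> i; case: (eqVneq i) => [->|]; rewrite ?eqxx // f_canon => wi; rewrite -f_canon tight ?f_canon.
  + by rewrite -big_mkcond -(sumE _ w).
  + rewrite (eq_bigr (fun i => if i == canon (f i) then w (f i) *: f i else 0)).
      by rewrite -big_mkcond -(sumE _ (fun v => w v *: v)).
    by move=> i _; case: ifP; rewrite ?scale0r.
- by move=> _ /X_f[j <-]; exact: f_lattice.
- by move=> c b cX; apply: span => j; exact: cX.
- by rewrite XE.
- by rewrite XE lattice_points_range.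
Qed.

End Families.

Section SubtypeSums.
Context {T : finType} {P : pred T}.

Lemma sum_insub (V : nmodType) (F : {x | P x} -> V) (G : T -> V) :
  (forall y, ~~ P y -> G y = 0) -> (forall x, G (val x) = F x) ->
  \sum_y G y = \sum_(x : {x | P x}) F x.
Proof.
move=> G0 GF; rewrite (bigID P) /= [X in _ + X]big1 ?addr0 //.
rewrite (reindex_omap (val : {x | P x} -> T) insub) /=; last first.
  by move=> y Py; rewrite insubT.
by apply: eq_big => x; rewrite ?GF // valK eqxx (valP x).
Qed.

Lemma seq_sub (F : seq T) : all P F -> exists F' : seq {x | P x}, F = [seq val x | x <- F'].
Proof.
elim: F => [|x F IH] /=; first by exists [::].
by move=> /andP[Px /IH[F' ->]]; exists (exist _ x Px :: F').
Qed.

End SubtypeSums.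

Section Polytopes.
Context {R : realType} {d : nat} {le e : rel 'I_d} {e_irr : irreflexive e}.
Context (leR : reflexive le) (leT : transitive le) (leA : antisymmetric le).

Local Notation idl := {I : {set 'I_d} | ideal (le:=le) I}.
Local Notation stb := {S : {set 'I_d} | stable e S}.

Definition ideal_vertex (I : idl) : 'rV[R]_d := rho (val I).
Definition stable_vertex (S : stb) : 'rV[R]_d := rho (val S).
Definition cayley_vertex (j : idl + stb) : 'rV[R]_(d + 1) :=
  match j with
  | inl X => row_mx (ideal_vertex X) (const_mx 1)
  | inr X => row_mx (stable_vertex X) (const_mx 0)
  end.
Definition minkowski_vertex (j : idl * stb) : 'rV[R]_d :=
  ideal_vertex j.1 + stable_vertex j.2.

Lemma rhoE (X : {set 'I_d}) i : (rho X : 'rV[R]_d) 0 i = (i \in X)%:R.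
Proof.
rewrite /rho summxE; have [iX|iX] := boolP (i \in X).
  rewrite (bigD1 i) //= mxE !eqxx big1 ?addr0 // => j /andP[_ ji].
  by rewrite mxE eq_sym (negPf ji) andbF.
rewrite big1 // => j jX; rewrite mxE eqxx /=; case: eqP => // ij.
by rewrite ij jX in iX.
Qed.

Lemma cayley_sum_range :
  cayley_sum (conv_hull (range ideal_vertex)) (conv_hull (range stable_vertex)) =
  conv_hull (range cayley_vertex).
Proof.
have row_sum (I : finType) (l : I -> R) (F : I -> 'rV[R]_d) (a : R) :
    \sum_i l i = 1 -> row_mx (\sum_i l i *: F i) (const_mx a) =
    \sum_i l i *: (row_mx (F i) (const_mx a) : 'rV[R]_(d + 1)).
  move=> l1; apply/rowP => i; rewrite summxE.
  under [RHS]eq_bigr do rewrite mxE.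
  case: (splitP i) => j ij.
    rewrite (_ : i = lshift 1 j); last exact: val_inj.
    by rewrite row_mxEl summxE; apply: eq_bigr => k _; rewrite row_mxEl mxE.
  rewrite (_ : i = rshift d j); last exact: val_inj.
  rewrite row_mxEr mxE; under [RHS]eq_bigr do rewrite row_mxEr mxE.
  by rewrite -mulr_suml l1 mul1r.
apply/seteqP; split; apply: conv_hull_sub; last first.
  move=> _ [[I|S] _ <-]; apply: sub_conv_hull; [left|right].
    by exists (ideal_vertex I) => //; apply: sub_conv_hull; exists I.
  by exists (stable_vertex S) => //; apply: sub_conv_hull; exists S.
move=> _ [|] [x /conv_hullP[l [l0 l1 ->]] <-]; rewrite row_sum //; apply/conv_hullP.
  exists (fun j => if j is inl X then l X else 0); split.
  - by case.
  - by rewrite big_sumType /= [X in _ + X]big1 ?addr0.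
  - by rewrite big_sumType /= [X in _ + X]big1 ?addr0 // => S _; rewrite scale0r.
exists (fun j => if j is inr X then l X else 0); split.
- by case.
- by rewrite big_sumType /= [X in X + _]big1 ?add0r.
- by rewrite big_sumType /= [X in X + _]big1 ?add0r // => S _; rewrite scale0r.
Qed.

Lemma pair_sums (V : lmodType R) (l : idl * stb -> R) (F : idl -> V) (G : stb -> V) :
  \sum_j l j *: (F j.1 + G j.2) =
  \sum_I (\sum_S l (I, S)) *: F I + \sum_S (\sum_I l (I, S)) *: G S.
Proof.
under eq_bigr do rewrite scalerDr.
rewrite big_split /=; congr (_ + _).
  rewrite (eq_bigr (fun p => l (p.1, p.2) *: F p.1)); last by case.
  rewrite -(pair_bigA _ (fun I S => l (I, S) *: F I)) /=; apply: eq_bigr => I _.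
  by rewrite scaler_suml.
rewrite (eq_bigr (fun p => l (p.1, p.2) *: G p.2)); last by case.
rewrite -(pair_bigA _ (fun I S => l (I, S) *: G S)) /= exchange_big /=.
by apply: eq_bigr => S _; rewrite scaler_suml.
Qed.

Lemma pair_sum1 (l : idl * stb -> R) : \sum_j l j = \sum_I \sum_S l (I, S).
Proof.
by rewrite (eq_bigr (fun p => l (p.1, p.2))) ?pair_bigA //; case.
Qed.

(** Weights on pairs have marginals on ideals and on stable sets; conversely two families of weights
    of total [k] are coupled by their products divided by [k]. *)
Lemma minkowski_dilateP (k : nat) (x : 'rV[R]_d) : (0 < k)%N ->
  dilate k (conv_hull (range minkowski_vertex)) x <->
  exists (a : idl -> R) (b : stb -> R),
    [/\ forall I, 0 <= a I, forall S, 0 <= b S, \sum_I a I = k%:R, \sum_S b S = k%:R &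
        x = \sum_I a I *: ideal_vertex I + \sum_S b S *: stable_vertex S].
Proof.
move=> k0; have kN : k%:R != 0 :> R by rewrite pnatr_eq0 -lt0n.
rewrite (dilate_conv_hullP _ _ k0); split.
  move=> [l [l0 l1 ->]].
  exists (fun I => \sum_S l (I, S)), (fun S => \sum_I l (I, S)); split.
  - by move=> I; rewrite sumr_ge0.
  - by move=> S; rewrite sumr_ge0.
  - by rewrite -l1 pair_sum1.
  - by rewrite -l1 pair_sum1 exchange_big.
  - exact: pair_sums.
move=> [a [b [a0 b0 a1 b1 ->]]]; exists (fun p => k%:R^-1 * (a p.1 * b p.2)); split.
- by move=> p; rewrite mulr_ge0 ?mulr_ge0 // invr_ge0 ler0n.
- rewrite pair_sum1 /=.
  under eq_bigr do rewrite -!mulr_sumr b1 mulrCA mulVf // mulr1.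
  exact: a1.
- rewrite pair_sums /=; congr (_ + _); apply: eq_bigr => ? _; congr (_ *: _).
    by rewrite -!mulr_sumr b1 mulrCA mulVf // mulr1.
  by rewrite -mulr_sumr -mulr_suml a1 mulrA mulVf // mul1r.
Qed.

Lemma minkowski_sum_range :
  minkowski_sum (conv_hull (range ideal_vertex)) (conv_hull (range stable_vertex)) =
  conv_hull (range minkowski_vertex).
Proof.
apply/seteqP; split => x.
  move=> [_ /conv_hullP[a [a0 a1 ->]] [_ /conv_hullP[b [b0 b1 ->]] <-]].
  by rewrite -[conv_hull _]dilate1; apply/minkowski_dilateP => //; exists a, b.
rewrite -[conv_hull _]dilate1 => /minkowski_dilateP[//|a [b [a0 b0 a1 b1 ->]]].
exists (\sum_I a I *: ideal_vertex I); first exact: convex_combination.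
by exists (\sum_S b S *: stable_vertex S) => //; exact: convex_combination.
Qed.

Lemma cayley_dilateP (k : nat) (z : 'rV[R]_(d + 1)) : (0 < k)%N ->
  dilate k (conv_hull (range cayley_vertex)) z <->
  exists (a : idl -> R) (b : stb -> R),
    [/\ forall I, 0 <= a I, forall S, 0 <= b S, \sum_I a I + \sum_S b S = k%:R &
        z = row_mx (\sum_I a I *: ideal_vertex I + \sum_S b S *: stable_vertex S)
              (const_mx (\sum_I a I))].
Proof.
move=> k0; rewrite (dilate_conv_hullP _ _ k0).
have key (a : idl -> R) (b : stb -> R) :
    \sum_I a I *: cayley_vertex (inl I) + \sum_S b S *: cayley_vertex (inr S) =
    row_mx (\sum_I a I *: ideal_vertex I + \sum_S b S *: stable_vertex S)
              (const_mx (\sum_I a I)).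
  apply/rowP => i; rewrite mxE !summxE.
  under eq_bigr do rewrite mxE.
  under [X in _ + X]eq_bigr do rewrite mxE.
  case: (splitP i) => j ij.
    rewrite (_ : i = lshift 1 j); last exact: val_inj.
    rewrite row_mxEl mxE !summxE; congr (_ + _); apply: eq_bigr => ? _; by rewrite row_mxEl mxE.
  rewrite (_ : i = rshift d j); last exact: val_inj.
  rewrite row_mxEr mxE [X in _ + X]big1 ?addr0; last by move=> S _; rewrite row_mxEr mxE mulr0.
  by apply: eq_bigr => I _; rewrite row_mxEr mxE mulr1.
split.
  move=> [l [l0 l1 ->]]; exists (fun I => l (inl I)), (fun S => l (inr S)); split => //.
    by rewrite -l1 big_sumType.
  by rewrite big_sumType /= -key.
move=> [a [b [a0 b0 ab ->]]].
exists (fun j => match j with inl X => a X | inr X => b X end); split.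
- by case.
- by rewrite big_sumType.
- by rewrite big_sumType /= -key.
Qed.

(* The largest order-reversing function below [x] and [s]; [phi] records where
   the minimum over the elements below is attained, [None] standing for [s]. *)
Lemma exists_lower_envelope (x : 'I_d -> R) (s : R) :
  exists2 phi : 'I_d -> option 'I_d, (forall i j, phi i = Some j -> le j i) &
    let u i := oapp x s (phi i) in
    (forall i, u i <= s) /\ (forall i j, le j i -> u i <= x j).
Proof.
pose v (o : option 'I_d) := oapp x s o.
pose P (i : 'I_d) (o : option 'I_d) := oapp (le^~ i) true o.
pose phi i := [arg min_(o < None | P i o) v o]%O.
exists phi => [i j|/=]; rewrite /phi.
  by case: Order.TotalTheory.arg_minP => //= o Po _ E; rewrite E in Po.
split => [i|i j ji]; case: Order.TotalTheory.arg_minP => //= o Po omin.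
  exact: (omin None).
exact: (omin (Some j)).
Qed.

Lemma sum_rho_count (U : Type) (f : U -> {set 'I_d}) (H : seq U) i :
  (\sum_(k <- H) rho (f k) : 'rV[R]_d) 0 i = (count (fun X : {set 'I_d} => i \in X) (map f H))%:R.
Proof.
rewrite summxE; elim: H => [|k H IH]; first by rewrite big_nil.
by rewrite big_cons IH rhoE /= natrD.
Qed.

Lemma sum_cayley_vertices (F : seq idl) (G : seq stb) :
  \sum_(X <- F) cayley_vertex (inl X) + \sum_(X <- G) cayley_vertex (inr X) =
  row_mx (\sum_(X <- F) ideal_vertex X + \sum_(X <- G) stable_vertex X)
    (const_mx (size F)%:R).
Proof.
apply/rowP => i; rewrite mxE !summxE; case: (splitP i) => j ij.
  rewrite (_ : i = lshift 1 j); last exact: val_inj.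
  by rewrite row_mxEl mxE !summxE; congr (_ + _); apply: eq_bigr => ? _; rewrite row_mxEl.
rewrite (_ : i = rshift d j); last exact: val_inj.
rewrite row_mxEr mxE [X in _ + X]big1 ?addr0; last by move=> X _; rewrite row_mxEr mxE.
rewrite (eq_bigr (fun=> 1)); last by move=> X _; rewrite row_mxEr mxE.
by rewrite big_const_seq count_predT iter_addr_0.
Qed.

Section Decomposition.
Context (perf : perfect e_irr).

Lemma integer_decomposition (s t : nat) (x : 'rV[R]_d) (a : idl -> R) (b : stb -> R) :
  lattice x -> (forall I, 0 <= a I) -> (forall S, 0 <= b S) ->
  \sum_I a I = s%:R -> \sum_S b S = t%:R ->
  x = \sum_I a I *: ideal_vertex I + \sum_S b S *: stable_vertex S ->
  exists (F : seq idl) (G : seq stb), [/\ size F = s, size G = t &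
    x = \sum_(I <- F) ideal_vertex I + \sum_(S <- G) stable_vertex S].
Proof.
move=> Lx a0 b0 a_s b_t xE.
pose u' i := \sum_I a I * (i \in val I)%:R; pose w' i := \sum_S b S * (i \in val S)%:R.
have xE' i : x 0 i = u' i + w' i.
  rewrite xE mxE !summxE; congr (_ + _); apply: eq_bigr => j _; by rewrite mxE rhoE.
have [phi phi_le] := exists_lower_envelope (x 0) s%:R.
set u := (fun i => _) => -[us ux].
have u_int i : u i \is a Num.int by rewrite /u; case: (phi i) => [j|] /=; [exact: Lx|exact: rpred_nat].
have w'_ge0 i : 0 <= w' i by apply: sumr_ge0 => S _; rewrite mulr_ge0 // ler0n.
have u'_ge0 i : 0 <= u' i by apply: sumr_ge0 => S _; rewrite mulr_ge0 // ler0n.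
have u'u i : u' i <= u i.
  rewrite /u; case E: (phi i) => [j|] /=.
    apply: (@le_trans _ _ (u' j)); last by rewrite xE' lerDl.
    apply: ler_sum => I _; rewrite ler_wpM2l // ler_nat.
    by case iI: (i \in val I) => //; rewrite (idealP _ (valP I) _ _ iI (phi_le _ _ E)).
  rewrite -a_s; apply: ler_sum => I _; rewrite -[leRHS]mulr1 ler_wpM2l //.
  by case: (i \in val I) => /=; rewrite ?ler01.
have u_mono i j : le j i -> u i <= u j.
  move=> ji; rewrite {2}/u; case E: (phi j) => [k|] /=; last exact: us.
  by apply: ux; exact: leT (phi_le _ _ E) ji.
have u_nat i : (Num.truncn (u i))%:R = u i.
  by apply: truncnK; rewrite natrEint u_int (le_trans (u'_ge0 i)).
have w_nat i : (Num.truncn (x 0 i - u i))%:R = x 0 i - u i.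
  apply: truncnK; rewrite natrEint rpredB ?u_int ?Lx //= subr_ge0.
  by apply: ux; exact: leR.
have [||F [sF idF cF]] := @ideal_layers _ le (fun i => Num.truncn (u i)) s.
- by move=> i; rewrite -(ler_nat R) u_nat.
- by move=> i j ji; rewrite -(ler_nat R) !u_nat u_mono.
have [|G [sG stG cG]] := weighted_coloring (y := fun i => Num.truncn (x 0 i - u i)) (N := t) perf.
  move=> K cK; rewrite -(ler_nat R) natr_sum -b_t.
  apply: (@le_trans _ _ (\sum_(i in K) w' i)).
    by apply: ler_sum => i _; rewrite w_nat lerBlDl xE' lerD2r.
  rewrite exchange_big /=; apply: ler_sum => S _; rewrite -mulr_sumr -[leRHS]mulr1 ler_wpM2l //.
  rewrite -natr_sum -[1]/(1%:R) ler_nat; apply: leq_trans (card_stable_clique (valP S) cK).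
  rewrite -sum1_card big_mkcond [leqRHS]big_mkcond; apply: leq_sum => i _.
  by rewrite inE; case: (i \in K); case: (i \in val S).
have [F' FE] := seq_sub idF; have [G' GE] := seq_sub stG.
exists F', G'; split; [by rewrite -sF FE size_map|by rewrite -sG GE size_map|].
apply/rowP => i; rewrite mxE !sum_rho_count -FE -GE cF cG u_nat w_nat.
by rewrite addrC subrK.
Qed.

End Decomposition.

End Polytopes.

(** * Triangulations of the two sums *)

Section Arithmetic.
Context {R : realFieldType}.

Lemma minkowski_slack_le (a c1 c2 n1 n2 b : R) : c1 + c2 + b <= n1 + n2 + a ->
  b <= n1 - c1 + (n2 - c2) + a.
Proof. by lra. Qed.

Lemma minkowski_slack_eq (a c1 c2 n1 n2 b : R) : c1 + c2 + b = n1 + n2 + a ->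
  n1 - c1 + (n2 - c2) + a = b.
Proof. by lra. Qed.

Lemma near_min_left (s1 s2 m1 m2 a k B : R) :
  s1 + s2 + a <= m1 + m2 + k -> 0 <= a -> k <= B -> m2 <= s2 -> s1 <= m1 + B.
Proof. by lra. Qed.

Lemma near_min_right (s1 s2 m1 m2 a k B : R) :
  s1 + s2 + a <= m1 + m2 + k -> 0 <= a -> k <= B -> m1 <= s1 -> s2 <= m2 + B.
Proof. by lra. Qed.

Lemma swap_slack (sj1 sj2 sk1 sk2 kj kk kjk kkj b : R) :
  sj1 + sj2 + kj = b -> sk1 + sk2 + kk = b ->
  b <= sk1 + sj2 + kkj -> b <= sj1 + sk2 + kjk -> kj + kk <= kkj + kjk.
Proof. by lra. Qed.

Lemma rearrangement (a a' s s' : nat) : (a < a')%N -> (s < s')%N ->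
  (a' * s + a * s' < a * s + a' * s')%N.
Proof. by nia. Qed.

End Arithmetic.

Section Consequences.
Context {R : realType} {d : nat} {le e : rel 'I_d} {e_irr : irreflexive e}.
Context (leR : reflexive le) (leT : transitive le) (leA : antisymmetric le).

Local Notation idl := {I : {set 'I_d} | ideal (le:=le) I}.
Local Notation stb := {S : {set 'I_d} | stable e S}.
Local Notation ideal_vertex := (@ideal_vertex R d le).
Local Notation stable_vertex := (@stable_vertex R d e).
Local Notation cayley_vertex := (@cayley_vertex R d le e).
Local Notation minkowski_vertex := (@minkowski_vertex R d le e).

Definition full_ideal : idl := exist (fun X : {set 'I_d} => ideal (le:=le) X) _ idealT.
Definition empty_ideal : idl := exist (fun X : {set 'I_d} => ideal (le:=le) X) _ ideal0.
Definition empty_stable : stb := exist (fun X : {set 'I_d} => stable e X) _ stable0.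
Definition single_stable i : stb := exist (fun X : {set 'I_d} => stable e X) _ (stable1 (e_irr := e_irr) i).

Lemma ideal_vertex0 : ideal_vertex empty_ideal = 0.
Proof. by apply/rowP => i; rewrite rhoE !mxE inE. Qed.

Lemma ideal_vertexT : ideal_vertex full_ideal = const_mx 1.
Proof. by apply/rowP => i; rewrite rhoE !mxE inE. Qed.

Lemma stable_vertex0 : stable_vertex empty_stable = 0.
Proof. by apply/rowP => i; rewrite rhoE !mxE inE. Qed.

Lemma stable_vertex1 i : stable_vertex (single_stable i) = delta_mx 0 i.
Proof. by apply/rowP => j; rewrite rhoE !mxE inE eqxx. Qed.

Lemma rho_lattice (X : {set 'I_d}) : lattice (rho X : 'rV[R]_d).
Proof. by move=> i; rewrite rhoE rpred_nat. Qed.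

Lemma inner_rho (c : 'rV[R]_d) (X : {set 'I_d}) : inner c (rho X) = \sum_(i in X) c 0 i.
Proof.
rewrite [RHS]big_mkcond; apply: eq_bigr => i _; rewrite rhoE.
by case: (i \in X); rewrite ?mulr1 ?mulr0.
Qed.

Lemma minkowski_lattice j : lattice (minkowski_vertex j).
Proof. by move=> i; rewrite mxE rpredD // rho_lattice. Qed.

Lemma cayley_lattice j : lattice (cayley_vertex j).
Proof.
case: j => [X|X] i /=; rewrite mxE; case: splitP => k _; rewrite ?mxE ?rpred0 ?rpred1 ?rho_lattice //.
Qed.

Lemma minkowski_span (c : 'rV[R]_d) (b : R) :
  (forall j, inner c (minkowski_vertex j) + b = 0) -> c = 0 /\ b = 0.
Proof.
move=> H; have b0 : b = 0.
  have := H (empty_ideal, empty_stable).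
  by rewrite /minkowski_vertex /= ideal_vertex0 stable_vertex0 addr0 inner0r add0r.
split => //; apply/rowP => i; have := H (empty_ideal, single_stable i).
by rewrite /minkowski_vertex /= ideal_vertex0 stable_vertex1 add0r inner_delta b0 addr0 => ->; rewrite mxE.
Qed.

Lemma cayley_span (c : 'rV[R]_(d + 1)) (b : R) :
  (forall j, inner c (cayley_vertex j) + b = 0) -> c = 0 /\ b = 0.
Proof.
rewrite -[c]hsubmxK => H; have row00 : row_mx 0 (const_mx 0) = 0 :> 'rV[R]_(d + 1).
  by apply/rowP => i; rewrite !mxE; case: splitP => k; rewrite !mxE.
have b0 : b = 0.
  by have := H (inr empty_stable); rewrite /= stable_vertex0 row00 inner0r add0r.
have r0 : rsubmx c = 0.
  apply/rowP => i; have := H (inl empty_ideal).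
  rewrite /= ideal_vertex0 inner_row_mx inner0r add0r b0 addr0 /inner big_ord1 [const_mx _ _ _]mxE mulr1.
  by rewrite (ord1 i) => ->; rewrite mxE.
have l0 : lsubmx c = 0.
  apply/rowP => i; have := H (inr (single_stable i)).
  rewrite /= stable_vertex1 inner_row_mx inner_delta b0 addr0 r0.
  by rewrite innerC inner0r addr0 => ->; rewrite mxE.
by rewrite l0 r0 row_mx0.
Qed.

Section PerfectGraph.
Context (perf : perfect e_irr).

Lemma minkowski_decomp k x : (0 < k)%N -> dilate k (conv_hull (range minkowski_vertex)) x ->
  lattice x -> exists2 F, size F = k & x = \sum_(j <- F) minkowski_vertex j.
Proof.
move=> k0 /(minkowski_dilateP _ k0)[a [b [a0 b0 a1 b1 xE]]] Lx.
have [F [G [sF sG ->]]] := integer_decomposition leR leT perf Lx a0 b0 a1 b1 xE.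
exists (zip F G); first by rewrite size_zip sF sG minnn.
rewrite big_split /= -(big_map fst xpredT) -(big_map snd xpredT).
by rewrite -/unzip1 -/unzip2 unzip1_zip ?unzip2_zip // sF sG.
Qed.

Lemma cayley_decomp k x : (0 < k)%N -> dilate k (conv_hull (range cayley_vertex)) x ->
  lattice x -> exists2 F, size F = k & x = \sum_(j <- F) cayley_vertex j.
Proof.
move=> k0 /(cayley_dilateP _ k0)[a [b [a0 b0 ab xE]]] Lx.
have Sa_ge0 : 0 <= \sum_I a I by rewrite sumr_ge0.
have Sa_int : \sum_I a I \is a Num.int.
  by have := Lx (rshift d ord0); rewrite xE row_mxEr mxE.
pose s := Num.truncn (\sum_I a I).
have sE : \sum_I a I = s%:R by rewrite truncnK // natrEint Sa_int.
have sk : (s <= k)%N by rewrite -(ler_nat R) -sE -ab lerDl sumr_ge0.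
have tE : \sum_S b S = (k - s)%:R by rewrite natrB // -ab sE addrC addKr.
set y := (X in row_mx X _) in xE.
have Ly : lattice y by move=> i; have := Lx (lshift 1 i); rewrite xE row_mxEl.
have [F [G [sF sG yE]]] := integer_decomposition leR leT perf Ly a0 b0 sE tE erefl.
exists (map inl F ++ map inr G).
  by rewrite size_cat !size_map sF sG subnKC.
by rewrite big_cat !big_map /= sum_cayley_vertices sF xE yE sE.
Qed.

Lemma lattice_points_minkowski :
  minkowski_sum (conv_hull (range ideal_vertex) `&` lattice)
    (conv_hull (range stable_vertex) `&` lattice) =
  minkowski_sum (conv_hull (range ideal_vertex)) (conv_hull (range stable_vertex)) `&` lattice.
Proof.
apply/seteqP; split.
  move=> _ [x [Ox Lx] [y [Qy Ly] <-]]; split; first by exists x => //; exists y.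
  by move=> i; rewrite mxE rpredD ?Lx ?Ly.
rewrite minkowski_sum_range (lattice_points_range minkowski_lattice minkowski_decomp).
move=> _ [[I' S'] _ <-]; exists (ideal_vertex I').
  by split; [apply: sub_conv_hull; exists I'|exact: rho_lattice].
exists (stable_vertex S') => //.
by split; [apply: sub_conv_hull; exists S'|exact: rho_lattice].
Qed.

(** Ideals and stable sets are separate vertices here, so tightness is exact: the integrality lemmas
    apply with [N = 1], [B = 0] and the slack bounds [c1 + b] and [b]. *)
Lemma cayley_triangulation :
  has_regular_unimodular_triangulation (conv_hull (range cayley_vertex)).
Proof.
have [r [r_inj r_lt]] := set_rank_exists (T := 'I_d).
pose h (j : idl + stb) : R := match j with
  | inl X => ideal_height (val X) | inr X => stable_height r (val X) end.
apply: (family_triangulation cayley_lattice cayley_decomp (inl full_ideal) (h := h) cayley_span).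
move=> c b l feas l0 tight sl ll.
pose c0 : 'I_d -> R := fun i => c 0 (lshift 1 i); pose c1 := c 0 (rshift d ord0).
have innerI (X : idl) : inner c (cayley_vertex (inl X)) = \sum_(i in val X) c0 i + c1.
  rewrite -[c]hsubmxK inner_row_mx inner_rho /inner big_ord1 !mxE mulr1; congr (_ + _).
  by apply: eq_bigr => i _; rewrite mxE.
have innerS (X : stb) : inner c (cayley_vertex (inr X)) = \sum_(i in val X) c0 i.
  rewrite -[c]hsubmxK inner_row_mx inner_rho /inner big_ord1 !mxE mulr0 addr0.
  by apply: eq_bigr => i _; rewrite mxE.
pose alpha (X : {set 'I_d}) := if insub X is Some Y then l (inl Y) else 0.
pose beta (X : {set 'I_d}) := if insub X is Some Y then l (inr Y) else 0.
have alphaE (F : {set 'I_d} -> R) :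
    \sum_X alpha X * F X = \sum_(Y : idl) l (inl Y) * F (val Y).
  apply: sum_insub => [X|Y]; rewrite /alpha ?valK // => nX.
  by rewrite insubF ?mul0r //; exact: negPf.
have betaE (F : {set 'I_d} -> R) :
    \sum_X beta X * F X = \sum_(Y : stb) l (inr Y) * F (val Y).
  apply: sum_insub => [X|Y]; rewrite /beta ?valK // => nX.
  by rewrite insubF ?mul0r //; exact: negPf.
have alpha_sum : \sum_X alpha X = \sum_(Y : idl) l (inl Y).
  apply: sum_insub => [X|Y]; rewrite /alpha ?valK // => nX.
  by rewrite insubF //; exact: negPf.
have beta_sum : \sum_X beta X = \sum_(Y : stb) l (inr Y).
  apply: sum_insub => [X|Y]; rewrite /beta ?valK // => nX.
  by rewrite insubF //; exact: negPf.
have slack1_ge (X : {set 'I_d}) : ideal (le:=le) X ->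
    c1 + b <= 1 * ideal_height X - \sum_(i in X) c0 i.
  by move=> idX; have := feas (inl (exist (fun X : {set 'I_d} => ideal (le:=le) X) X idX)); rewrite innerI /= mul1r; lra.
have slack2_ge (X : {set 'I_d}) : stable e X ->
    b <= 1 * stable_height r X - \sum_(i in X) c0 i.
  by move=> stX; have := feas (inr (exist (fun X : {set 'I_d} => stable e X) X stX)); rewrite innerS /= mul1r; lra.
have alpha_supp X : alpha X != 0 -> ideal (le:=le) X /\
    1 * ideal_height X - \sum_(i in X) c0 i <= c1 + b + 0.
  rewrite /alpha; case: insubP => [Y idX <-|]; last by rewrite eqxx.
  by move=> /tight; rewrite innerI /= mul1r => tY; split; [exact: valP|lra].
have beta_supp X : beta X != 0 -> stable e X /\
    1 * stable_height r X - \sum_(i in X) c0 i <= b + 0.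
  rewrite /beta; case: insubP => [Y stX <-|]; last by rewrite eqxx.
  by move=> /tight; rewrite innerS /= mul1r => tY; split; [exact: valP|lra].
have int_x (i : 'I_d) : \sum_(X : {set 'I_d} | i \in X) alpha X + \sum_(X : {set 'I_d} | i \in X) beta X \is a Num.int.
  have := ll (lshift 1 i); rewrite summxE big_sumType /=.
  rewrite (eq_bigr (fun Y : idl => l (inl Y) * (i \in val Y)%:R)); last first.
    by move=> Y _; rewrite mxE row_mxEl rhoE.
  rewrite [X in _ + X](eq_bigr (fun Y : stb => l (inr Y) * (i \in val Y)%:R)); last first.
    by move=> Y _; rewrite mxE row_mxEl rhoE.
  rewrite -(alphaE (fun X => (i \in X)%:R)) -(betaE (fun X => (i \in X)%:R)).
  rewrite [X in _ -> X + _ \is a _]big_mkcond [X in _ -> _ + X \is a _]big_mkcond.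
  congr (_ + _ \is a _); apply: eq_bigr => X _; case: (i \in X); by rewrite ?mulr1 ?mulr0.
have int_s : \sum_X alpha X \is a Num.int.
  have := ll (rshift d ord0); rewrite summxE big_sumType /= alpha_sum.
  rewrite [X in _ + X]big1 ?addr0; last by move=> Y _; rewrite mxE row_mxEr mxE mulr0.
  by rewrite (eq_bigr (fun Y => l (inl Y))) // => Y _; rewrite mxE row_mxEr mxE mulr1.
have int_t : \sum_X beta X \is a Num.int.
  have : \sum_j l j - \sum_X alpha X \is a Num.int by rewrite rpredB.
  by rewrite big_sumType /= alpha_sum beta_sum [X in X - _ \is a _ -> _]addrC addrK.
have N_large : 0 * (2 + #|{set 'I_d}|)%:R < 1 :> R by rewrite mul0r ltr01.
have B0 : 0 <= 0 :> R by [].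
have alpha_l (Y : idl) : alpha (val Y) = l (inl Y) by rewrite /alpha valK.
have beta_l (Y : stb) : beta (val Y) = l (inr Y) by rewrite /beta valK.
case=> Y.
  by rewrite -alpha_l; apply: (alpha_int leR leT leA r_lt B0 N_large slack1_ge slack2_ge alpha_supp beta_supp int_x int_s).
by rewrite -beta_l; apply: (beta_int leR leT leA perf r_inj r_lt B0 N_large slack1_ge slack2_ge alpha_supp beta_supp int_x int_s int_t).
Qed.

(** The integrality lemmas settle the two marginals of [l]. The perturbation [kappa] determines the
    coupling: by the rearrangement inequality the support is a staircase, and the weight beyond any
    of its pairs is a tail of one marginal. *)
Lemma minkowski_triangulation :
  has_regular_unimodular_triangulation (conv_hull (range minkowski_vertex)).
Proof.
have [r [r_inj r_lt]] := set_rank_exists (T := 'I_d).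
pose kappa (j : idl * stb) : R := (#|val j.1| * r (val j.2))%:R.
pose B := \sum_j kappa j; pose N := B * (2 + #|{set 'I_d}|)%:R + 1.
have kappa_ge0 j : 0 <= kappa j by rewrite ler0n.
have kappa_le j : kappa j <= B by rewrite /B (bigD1 j) //= lerDl sumr_ge0.
have B0 : 0 <= B by rewrite sumr_ge0.
have N_large : B * (2 + #|{set 'I_d}|)%:R < N by rewrite ltrDl.
pose h (j : idl * stb) : R :=
  N * ideal_height (val j.1) + N * stable_height r (val j.2) + kappa j.
apply: (family_triangulation minkowski_lattice minkowski_decomp (full_ideal, empty_stable) (h := h) minkowski_span).
move=> c b l feas l0 tight sl ll.
pose c0 : 'I_d -> R := fun i => c 0 i.
have innerE j : inner c (minkowski_vertex j) =
    \sum_(i in val j.1) c0 i + \sum_(i in val j.2) c0 i.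
  by rewrite innerDr !inner_rho.
pose slack1 (X : {set 'I_d}) : R := N * ideal_height X - \sum_(i in X) c0 i.
pose slack2 (X : {set 'I_d}) : R := N * stable_height r X - \sum_(i in X) c0 i.
have feas' j : b <= slack1 (val j.1) + slack2 (val j.2) + kappa j.
  by have := feas j; rewrite innerE /h /slack1 /slack2; exact: minkowski_slack_le.
have tight' j : l j != 0 -> slack1 (val j.1) + slack2 (val j.2) + kappa j = b.
  by move=> /tight; rewrite innerE /h /slack1 /slack2; exact: minkowski_slack_eq.
case: (@Order.TotalTheory.arg_minP _ _ _ full_ideal xpredT (fun Y => slack1 (val Y)) isT) => I1 _ I1min.
case: (@Order.TotalTheory.arg_minP _ _ _ empty_stable xpredT (fun Y => slack2 (val Y)) isT) => S1 _ S1min.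
pose m1 := slack1 (val I1); pose m2 := slack2 (val S1).
have slack1_ge (X : {set 'I_d}) : ideal (le:=le) X -> m1 <= slack1 X.
  by move=> idX; exact: (I1min (exist (fun X : {set 'I_d} => ideal (le:=le) X) X idX)).
have slack2_ge (X : {set 'I_d}) : stable e X -> m2 <= slack2 X.
  by move=> stX; exact: (S1min (exist (fun X : {set 'I_d} => stable e X) X stX)).
have near_min j : l j != 0 -> slack1 (val j.1) <= m1 + B /\ slack2 (val j.2) <= m2 + B.
  move=> /tight' tj; have := feas' (I1, S1); rewrite -tj -/m1 -/m2 /= => bm.
  have k0 := kappa_ge0 j; have kB := kappa_le (I1, S1).
  have s1 := slack1_ge _ (valP j.1); have s2 := slack2_ge _ (valP j.2).
  by split; [exact: near_min_left bm k0 kB s2|exact: near_min_right bm k0 kB s1].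
pose alpha (X : {set 'I_d}) := \sum_(j | val j.1 == X) l j.
pose beta (X : {set 'I_d}) := \sum_(j | val j.2 == X) l j.
have nz_term (P : pred (idl * stb)) : \sum_(j | P j) l j != 0 -> exists2 j, P j & l j != 0.
  move=> sum0; have [/existsP[j /andP[Pj lj]]|/existsPn no] := boolP [exists j, P j && (l j != 0)].
    by exists j.
  case/eqP: sum0; apply: big1 => j Pj; apply/eqP/negPn.
  by have := no j; rewrite Pj.
have alpha_supp X : alpha X != 0 -> ideal (le:=le) X /\ slack1 X <= m1 + B.
  by move=> /nz_term[j /eqP <- /near_min[? _]]; split => //; exact: valP.
have beta_supp X : beta X != 0 -> stable e X /\ slack2 X <= m2 + B.
  by move=> /nz_term[j /eqP <- /near_min[_ ?]]; split => //; exact: valP.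
have alpha_ge0 X : 0 <= alpha X by rewrite sumr_ge0.
have beta_ge0 X : 0 <= beta X by rewrite sumr_ge0.
have alphaE (P : pred {set 'I_d}) : \sum_(X | P X) alpha X = \sum_(j | P (val j.1)) l j.
  rewrite (partition_big (fun j : idl * stb => val j.1) P) //; apply: eq_bigr => X PX.
  by apply: eq_bigl => j; case: eqP => [->|]; rewrite ?PX ?andbF.
have betaE (P : pred {set 'I_d}) : \sum_(X | P X) beta X = \sum_(j | P (val j.2)) l j.
  rewrite (partition_big (fun j : idl * stb => val j.2) P) //; apply: eq_bigr => X PX.
  by apply: eq_bigl => j; case: eqP => [->|]; rewrite ?PX ?andbF.
have int_s : \sum_X alpha X \is a Num.int by rewrite (alphaE predT).
have int_t : \sum_X beta X \is a Num.int by rewrite (betaE predT).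
have int_x (i : 'I_d) : \sum_(X : {set 'I_d} | i \in X) alpha X + \sum_(X : {set 'I_d} | i \in X) beta X \is a Num.int.
  rewrite (alphaE (fun X => i \in X)) (betaE (fun X => i \in X)); have := ll i; rewrite summxE.
  rewrite (eq_bigr (fun j : idl * stb => (if i \in val j.1 then l j else 0) + (if i \in val j.2 then l j else 0))).
    by rewrite big_split /= -!big_mkcond.
  move=> j _; rewrite !mxE !rhoE mulrDr.
  by case: (i \in val j.1); case: (i \in val j.2); rewrite ?mulr1 ?mulr0.
have alpha_i X : alpha X \is a Num.int.
  exact: (alpha_int leR leT leA r_lt B0 N_large slack1_ge slack2_ge alpha_supp beta_supp int_x int_s).
have beta_i X : beta X \is a Num.int.
  exact: (beta_int leR leT leA perf r_inj r_lt B0 N_large slack1_ge slack2_ge alpha_supp beta_supp int_x int_s int_t).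
have chain j k : l j != 0 -> l k != 0 -> (val j.1 \subset val k.1) || (val k.1 \subset val j.1).
  have nz i : l i != 0 -> alpha (val i.1) != 0.
    move=> li; rewrite gt_eqF // /alpha (bigD1 i) //= ltr_pwDl ?sumr_ge0 //.
    by rewrite lt_neqAle eq_sym li l0.
  by move=> /nz aj /nz ak; exact: (alpha_chain B0 N_large slack1_ge alpha_supp aj ak).
have staircase j k : l j != 0 -> l k != 0 -> (#|val j.1| < #|val k.1|)%N ->
    (r (val k.2) <= r (val j.2))%N.
  move=> /tight' tj /tight' tk lt_jk; rewrite leqNgt; apply/negP => lt_r.
  have := feas' (j.1, k.2); have := feas' (k.1, j.2); rewrite /kappa /= => f1 f2.
  have := swap_slack tj tk f1 f2; rewrite /kappa -!natrD ler_nat leqNgt => /negP; apply.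
  exact: rearrangement.
move=> j; have [m] := ubnP (#|~: val j.1| + r (val j.2))%N; elim: m j => // m IH j lt_m.
have [->|lj] := eqVneq (l j) 0; first exact: rpred0.
(* The pairs beyond [j] in both directions. All of them except [j] have smaller induction measure,
   so it is enough that their total weight is an integer. *)
pose Q (k : idl * stb) := (val j.1 \subset val k.1) && (r (val k.2) <= r (val j.2))%N.
suff : \sum_(k | Q k) l k \is a Num.int.
  rewrite (bigD1 j) /=; last by rewrite /Q subxx leqnn.
  rewrite rpredDr // rpred_sum // => k /andP[/andP[sub_jk le_r] kj].
  apply: IH; rewrite -ltnS; apply: leq_trans lt_m; rewrite ltnS.
  have leC : (#|~: val k.1| <= #|~: val j.1|)%N by rewrite subset_leq_card // finset.setCS.
  have [eq1|ne1] := eqVneq (val k.1) (val j.1); last first.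
    rewrite -addSn leq_add // -(ltn_add2l #|val j.1|) cardsC -(cardsC (val k.1)) ltn_add2r.
    by rewrite proper_card // finset.properEneq eq_sym ne1.
  rewrite eq1 ltn_add2l ltn_neqAle le_r andbT; apply: contraNneq kj => /r_inj eq2.
  by apply/eqP; rewrite (surjective_pairing k) (surjective_pairing j) (val_inj eq1) (val_inj eq2).
(* Within the support, either every ideal containing [val j.1] is paired with rank at most that of
   [j], and the sum is a tail of the ideal marginal; or some [k1] violates this, and the staircase
   forces every pair of rank at most that of [j] to have its ideal above [val j.1], giving a tail of
   the stable marginal. *)
have [/forallP right_all|/forallPn[k1]] :=
    boolP [forall k : idl * stb, (l k != 0) ==> (val j.1 \subset val k.1) ==> (r (val k.2) <= r (val j.2))%N].
  suff -> : \sum_(k | Q k) l k = \sum_(k : idl * stb | val j.1 \subset val k.1) l k.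
    by rewrite -(alphaE (fun X => val j.1 \subset X)) rpred_sum.
  rewrite big_mkcond [RHS]big_mkcond; apply: eq_bigr => k _; rewrite /Q.
  have [->|lk] := eqVneq (l k) 0; first by rewrite !if_same.
  by have := right_all k; rewrite lk /=; case: (_ \subset _) => //= ->.
rewrite !negb_imply -ltnNge => /and3P[lk1 sub1 lt1].
suff -> : \sum_(k | Q k) l k = \sum_(k : idl * stb | (r (val k.2) <= r (val j.2))%N) l k.
  by rewrite -(betaE (fun X => (r X <= r (val j.2))%N)) rpred_sum.
rewrite big_mkcond [RHS]big_mkcond; apply: eq_bigr => k _; rewrite /Q.
have [->|lk] := eqVneq (l k) 0; first by rewrite !if_same.
case le_k: (r (val k.2) <= r (val j.2))%N; rewrite ?andbF // andbT.
suff -> : val j.1 \subset val k.1 by [].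
apply/negPn/negP => nsub; have := chain j k lj lk; rewrite (negPf nsub) /= => sub_kj.
have lt_card : (#|val k.1| < #|val k1.1|)%N.
  by apply: leq_trans (subset_leq_card sub1); rewrite proper_card // properE sub_kj.
by have := staircase k k1 lk lk1 lt_card; rewrite leqNgt (leq_ltn_trans le_k lt1).
Qed.

End PerfectGraph.

End Consequences.

(** * Codegrees *)

Section FullDimensional.
Context {R : realType} {n : nat}.

Lemma full_dimensional_corner (A : set 'rV[R]_n) (x0 : 'rV[R]_n) (eps : R) :
  eps != 0 -> A x0 -> (forall i, A (x0 + eps *: delta_mx 0 i)) -> full_dimensional A.
Proof.
move=> eps0 Ax0 Axi.
pose g (o : option 'I_n) : 'rV[R]_n := if o is Some i then x0 + eps *: delta_mx 0 i else x0.
have g_inj : injective g.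
  move=> [i|] [j|] //= /rowP H.
  - have := H i; rewrite !mxE !eqxx /= => /addrI/(mulfI eps0) /eqP.
    by case: (eqVneq i j) => [->|] //= _; rewrite oner_eq0.
  - have := H i; rewrite !mxE !eqxx /= mulr1 => /eqP.
    by rewrite addrC -subr_eq0 addrK (negPf eps0).
  - have := H j; rewrite !mxE !eqxx /= mulr1 => /eqP.
    by rewrite eq_sym addrC -subr_eq0 addrK (negPf eps0).
pose s := [fset g o | o in {: option 'I_n}]%fset.
have sum_s (V : nmodType) (F : 'rV[R]_n -> V) : \sum_(v <- s) F v = \sum_o F (g o).
  rewrite -(big_map g xpredT F); apply: perm_big; apply: uniq_perm.
  - exact: fset_uniq.
  - by rewrite map_inj_uniq // index_enum_uniq.
  by move=> v; apply/imfsetP/mapP => /= -[k _ ->]; exists k; rewrite // mem_index_enum.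
exists s; split.
- by rewrite /s card_imfset //= -cardE card_option card_ord.
- move=> w; rewrite !sum_s => w0 wv.
  have wS i : w (g (Some i)) = 0.
    pose G o : 'rV[R]_n := if o is Some k then (w (g o) * eps) *: delta_mx 0 k else 0.
    have : \sum_o G o = 0.
      rewrite -[LHS]add0r -[X in X + _](scale0r x0) -w0 scaler_suml -big_split /= -[RHS]wv.
      by apply: eq_bigr => -[k|] _; rewrite /G /= ?addr0 // scalerDr scalerA.
    move=> /rowP/(_ i); rewrite summxE (bigD1 (Some i)) //= big1 ?addr0.
      by rewrite !mxE !eqxx mulr1 => /eqP; rewrite mulf_eq0 (negPf eps0) orbF => /eqP.
    move=> [k|] ki; rewrite /G !mxE //= eq_sym.
    by case: (eqVneq k i) ki => [->|]; rewrite ?eqxx //= mulr0.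
  have wN : w (g None) = 0.
    by move: w0; rewrite (bigD1 None) //= big1 ?addr0 // => -[i|] // _; exact: wS.
  by move=> v /imfsetP[[i|] _ ->].
- move=> v /= /imfsetP[k _ ->]; case: k => [i|] /=; [exact: Axi|exact: Ax0].
Qed.

Lemma interior_box (A : set 'rV[R]_n) (x : 'rV[R]_n) (delta : R) : 0 < delta ->
  (forall y : 'rV[R]_n, (forall i, `|y 0 i - x 0 i| < delta) -> A y) -> interior A x.
Proof.
move=> delta0 H; apply/nbhs_ballP; exists delta => // y xy; apply: H => i.
by have := xy.2 0 i; rewrite /ball /= distrC.
Qed.

Lemma interior_direction (A : set 'rV[R]_n) (x g : 'rV[R]_n) : interior A x ->
  exists2 eps : R, 0 < eps & A (x + eps *: g) /\ A (x - eps *: g).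
Proof.
move=> /nbhs_ballP[delta /= delta0 H].
have [|eps eps0 epsP] := @small_multiple R _ (index_enum 'I_n) (fun i => `|g 0 i|) (fun=> delta).
  by [].
exists eps => //; split; apply: H; split => // i j; rewrite /ball /= !mxE (ord1 i) opprD ?opprK addNKr ?normrN.
  by rewrite normrM gtr0_norm // epsP // mem_index_enum.
by rewrite normrM gtr0_norm // epsP // mem_index_enum.
Qed.

End FullDimensional.

Section Codegree.
Context {R : realType} {d : nat} {le e : rel 'I_d} {e_irr : irreflexive e}.

Local Notation idl := {I : {set 'I_d} | ideal (le:=le) I}.
Local Notation stb := {S : {set 'I_d} | stable e S}.
Local Notation ideal_vertex := (@ideal_vertex R d le).
Local Notation stable_vertex := (@stable_vertex R d e).
Local Notation cayley_vertex := (@cayley_vertex R d le e).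
Local Notation minkowski_vertex := (@minkowski_vertex R d le e).
Local Notation full_ideal := (@full_ideal d le).
Local Notation empty_ideal := (@empty_ideal d le).
Local Notation empty_stable := (@empty_stable d e).
Local Notation single_stable := (@single_stable d e e_irr).

(** Explicit weights: [u0] on the full ideal, [w] on the singletons, and the remainders on the empty
    ideal and the empty stable set. *)
Lemma corner_point (s t u0 : R) (w : 'rV[R]_d) :
  0 <= u0 -> u0 <= s -> (forall i, 0 <= w 0 i) -> \sum_i w 0 i <= t ->
  exists (a : idl -> R) (b : stb -> R),
    [/\ forall X, 0 <= a X, forall X, 0 <= b X, \sum_X a X = s, \sum_X b X = t &
     const_mx u0 + w = \sum_X a X *: ideal_vertex X + \sum_X b X *: stable_vertex X].
Proof.
move=> u0_ge0 u0s w0 wt.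
have pick1 (T : finType) (V : lmodType R) (Y : T) (c : R) (F : T -> V) :
    \sum_X ((X == Y)%:R * c) *: F X = c *: F Y.
  rewrite (bigD1 Y) //= eqxx mul1r big1 ?addr0 // => X /negPf ->.
  by rewrite mul0r scale0r.
have pick0 (T : finType) (Y : T) (c : R) : \sum_X (X == Y)%:R * c = c.
  by have := pick1 T R^o Y c (fun=> 1); rewrite /GRing.scale /= mulr1; under eq_bigr do rewrite mulr1.
exists (fun X => (X == full_ideal)%:R * u0 + (X == empty_ideal)%:R * (s - u0)).
exists (fun X => \sum_i (X == single_stable i)%:R * w 0 i + (X == empty_stable)%:R * (t - \sum_i w 0 i)).
split.
- by move=> X; rewrite addr_ge0 // mulr_ge0 ?ler0n // subr_ge0.
- move=> X; rewrite addr_ge0 // ?mulr_ge0 ?ler0n // ?subr_ge0 //.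
  by rewrite sumr_ge0 // => i _; rewrite mulr_ge0 ?ler0n.
- by rewrite big_split /= !pick0 addrC subrK.
- rewrite big_split /= exchange_big /= pick0.
  by under eq_bigr do rewrite pick0; rewrite addrC subrK.
- under eq_bigr do rewrite scalerDl.
  under [X in _ = _ + X]eq_bigr do rewrite scalerDl scaler_suml.
  rewrite !big_split /= exchange_big /= !pick1 ideal_vertex0 stable_vertex0 !scaler0 !addr0.
  rewrite ideal_vertexT; under eq_bigr do rewrite pick1 stable_vertex1.
  rewrite -row_sum_delta; congr (_ + _).
  by apply/rowP => i; rewrite !mxE mulr1.
Qed.

(** Chosen so that [d] coordinates of size at most [2 * delta] have sum at most [1 - delta], the
    stable weight guaranteed in [near_one]. *)
Let delta : R := (2 * d.+1%:R)^-1.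

Let delta_gt0 : 0 < delta.
Proof. by rewrite invr_gt0 mulr_gt0 // ltr0Sn. Qed.

Let delta_sum : (2 * d%:R + 2) * delta = 1.
Proof. by rewrite -natr1 /delta -[d.+1%:R]natr1; field; rewrite natr1 pnatr_eq0. Qed.

Lemma near_one (y : 'rV[R]_d) (s t : R) : (forall i, `|y 0 i - 1| < delta) ->
  1 - delta <= s -> 1 - delta <= t -> exists (a : idl -> R) (b : stb -> R),
    [/\ forall X, 0 <= a X, forall X, 0 <= b X, \sum_X a X = s, \sum_X b X = t &
     y = \sum_X a X *: ideal_vertex X + \sum_X b X *: stable_vertex X].
Proof.
move=> Hy s1 t1; pose w : 'rV[R]_d := \row_i (y 0 i - 1 + delta).
have wE i : w 0 i = y 0 i - 1 + delta by rewrite mxE.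
have dN : 0 <= d%:R * delta by rewrite mulr_ge0 ?ler0n // ltW.
have [||||a [b [a0 b0 a1 b1 ab]]] := @corner_point s t (1 - delta) w.
- by move: delta_sum dN delta_gt0; lra.
- by [].
- by move=> i; rewrite wE; have := Hy i; rewrite ltr_norml => /andP[]; lra.
- apply: le_trans t1; apply: (@le_trans _ _ (\sum_(i < d) (2 * delta))).
    apply: ler_sum => i _; rewrite wE; have := Hy i; rewrite ltr_norml => /andP[]; lra.
  rewrite sumr_const card_ord -mulr_natl; move: delta_sum delta_gt0; lra.
exists a, b; split => //; rewrite -ab; apply/rowP => i; rewrite !mxE; ring.
Qed.

Lemma interior_minkowski : interior (conv_hull (range minkowski_vertex)) (const_mx 1).
Proof.
apply: (interior_box delta_gt0) => y Hy; rewrite -[conv_hull _]dilate1.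
apply/minkowski_dilateP => //; apply: near_one; rewrite ?lerBlDr ?lerDl ?ltW //.
by move=> i; have := Hy i; rewrite mxE.
Qed.

Lemma interior_cayley : interior (dilate 2 (conv_hull (range cayley_vertex))) (const_mx 1).
Proof.
apply: (interior_box delta_gt0) => y Hy; apply/cayley_dilateP => //.
pose s := y 0 (rshift d ord0).
have Hs : `|s - 1| < delta by have := Hy (rshift d ord0); rewrite mxE.
have [|||a [b [a0 b0 a1 b1 ab]]] := @near_one (lsubmx y) s (2 - s).
- by move=> i; have := Hy (lshift 1 i); rewrite !mxE.
- by move: Hs; rewrite ltr_norml => /andP[]; lra.
- by move: Hs; rewrite ltr_norml => /andP[]; lra.
exists a, b; split => //; first by rewrite a1 b1 addrC subrK.
rewrite -ab a1 -[LHS]hsubmxK; congr row_mx.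
by apply/rowP => i; rewrite !mxE (ord1 i).
Qed.

Lemma cayley_last_bounds k z : (0 < k)%N -> dilate k (conv_hull (range cayley_vertex)) z ->
  0 <= z 0 (rshift d ord0) <= k%:R.
Proof.
move=> k0 /(cayley_dilateP _ k0)[a [b [a0 b0 ab ->]]].
by rewrite row_mxEr mxE sumr_ge0 //= -ab lerDl sumr_ge0.
Qed.

Lemma full_dimensional_minkowski : full_dimensional (conv_hull (range minkowski_vertex)).
Proof.
apply: (@full_dimensional_corner _ _ _ 0 1) => [||i]; first exact: oner_neq0.
  apply: sub_conv_hull; exists (empty_ideal, empty_stable) => //.
  by rewrite /minkowski_vertex /= ideal_vertex0 stable_vertex0 addr0.
apply: sub_conv_hull; exists (empty_ideal, single_stable i) => //.
by rewrite /minkowski_vertex /= ideal_vertex0 stable_vertex1 !add0r scale1r.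
Qed.

Lemma cayley_vertex_origin : cayley_vertex (inr empty_stable) = 0.
Proof. by rewrite /= stable_vertex0; apply/rowP => i; rewrite !mxE; case: splitP => k; rewrite !mxE. Qed.

Lemma cayley_vertex_single i : cayley_vertex (inr (single_stable i)) = delta_mx 0 (lshift 1 i).
Proof.
rewrite /= stable_vertex1; apply/rowP => j; rewrite !mxE.
case: splitP => k jk; rewrite !mxE ?eqxx /=.
  by congr (_ %:R); rewrite (_ : j = lshift 1 k) ?(inj_eq (@lshift_inj _ _)) //; exact: val_inj.
by rewrite (_ : j = rshift d k) ?eq_rlshift //; exact: val_inj.
Qed.

Lemma cayley_vertex_last : cayley_vertex (inl empty_ideal) = delta_mx 0 (rshift d ord0).
Proof.
rewrite /= ideal_vertex0; apply/rowP => j; rewrite !mxE.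
case: splitP => k jk; rewrite !mxE ?eqxx /=.
  by rewrite (_ : j = lshift 1 k) ?eq_lrshift //; exact: val_inj.
by rewrite (_ : j = rshift d k) ?(ord1 k) ?eqxx //; apply: val_inj; rewrite /= jk (ord1 k).
Qed.

Lemma full_dimensional_cayley : full_dimensional (conv_hull (range cayley_vertex)).
Proof.
apply: (@full_dimensional_corner _ _ _ 0 1) => [||i]; first exact: oner_neq0.
  by apply: sub_conv_hull; exists (inr empty_stable); rewrite // cayley_vertex_origin.
rewrite add0r scale1r; apply: sub_conv_hull; case: (splitP i) => k ik.
  exists (inr (single_stable k)) => //; rewrite cayley_vertex_single.
  by congr delta_mx; exact: val_inj.
exists (inl empty_ideal) => //; rewrite cayley_vertex_last.
by congr delta_mx; apply: val_inj; rewrite /= ik (ord1 k).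
Qed.

Lemma codegree_minkowski : is_codegree (conv_hull (range minkowski_vertex)) 1.
Proof.
split => //.
- exact: lattice_polytope_range minkowski_lattice.
- exact: full_dimensional_minkowski.
- rewrite dilate1; exists (const_mx 1); split; first exact: interior_minkowski.
  by move=> i; rewrite mxE rpred1.
Qed.

Lemma codegree_cayley : is_codegree (conv_hull (range cayley_vertex)) 2.
Proof.
split => //.
- exact: lattice_polytope_range cayley_lattice.
- exact: full_dimensional_cayley.
- exists (const_mx 1); split; first exact: interior_cayley.
  by move=> i; rewrite mxE rpred1.
(* In the undilated Cayley sum the last coordinate lies between 0 and 1, strictly so at interior
   points, which excludes lattice points. *)
move=> m m0 [z [zint Lz]]; rewrite ltn_neqAle m0 andbT; apply/eqP => m1.
rewrite -m1 in zint; have [eps eps0 [z1 z2]] := interior_direction (delta_mx 0 (rshift d ord0)) zint.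
have := cayley_last_bounds (ltn0Sn 0) z1; have := cayley_last_bounds (ltn0Sn 0) z2.
rewrite !mxE !eqxx mulr1 => /andP[lo _] /andP[_ hi].
have pos : 0 < z 0 (rshift d ord0) by move: lo eps0; lra.
have lt1 : `|z 0 (rshift d ord0)| < 1 by rewrite gtr0_norm //; move: hi eps0; lra.
by move: pos; rewrite (int_lt1_eq0 (Lz _) lt1) ltxx.
Qed.

End Codegree.

(** * Gorenstein polytopes *)

Section Duality.
Context {R : realType} {n : nat}.

Lemma inner_mulmx (x y : 'rV[R]_n) (U : 'M[R]_n) : inner (x *m U) y = inner x (y *m U^T).
Proof.
have innerM (a b : 'rV[R]_n) : inner a b = (a *m b^T) 0 0.
  by rewrite mxE; apply: eq_bigr => i _; rewrite mxE.
by rewrite !innerM trmx_mul trmxK mulmxA.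
Qed.

Lemma int_le0 (x : R) : x \is a Num.int -> x < 1 -> x <= 0.
Proof. by move=> /intrP[k ->]; rewrite -[1]/(1%:~R) ltr_int lerz0 -ltzD1 add0r. Qed.

Lemma scaled_separation (J : finType) (f : J -> 'rV[R]_n) (q : 'rV[R]_n) :
  conv_hull (range f) 0 -> ~ conv_hull (range f) q ->
  exists c : 'rV[R]_n, (forall x, conv_hull (range f) x -> inner c x <= 1) /\ 1 < inner c q.
Proof.
move=> f0 /conv_hull_separation[c [b [cb bq]]].
have cb' x : conv_hull (range f) x -> inner c x + b <= 0.
  move=> /conv_hullP[l [l0 l1 ->]]; rewrite inner_sumr -[b]mul1r -l1 mulr_suml -big_split /=.
  by apply: sumr_le0 => j _; rewrite -mulrDr mulr_ge0_le0.
have b0 : b <= 0 by have := cb' 0 f0; rewrite inner0r add0r.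
(* The midpoint between the bound [- b] valid on the hull and the value at [q]. It is positive
   because the origin lies in the hull, so dividing by it puts the threshold at one. *)
pose beta := (inner c q - b) / 2.
have beta_gt0 : 0 < beta by rewrite /beta; lra.
exists (beta^-1 *: c); split => [x /cb'|]; rewrite innerZl mulrC.
  by rewrite ler_pdivrMr // mul1r /beta; lra.
by rewrite ltr_pdivlMr // mul1r /beta; lra.
Qed.

(* A face inequality of the dual lifts back through the unimodular map, so the
   reflexive polytope can be studied in the original coordinates. *)
Lemma gorenstein_dual (r : nat) (A : set 'rV[R]_n) : gorenstein r A ->
  exists (m : 'rV[R]_n) (J : finType) (f : J -> 'rV[R]_n),
    [/\ lattice m, forall j, lattice (f j),
        forall g, exists2 eps, 0 < eps &
          dilate r A (m + eps *: g) /\ dilate r A (m - eps *: g),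
        forall x, dilate r A x <-> forall j, inner (x - m) (f j) <= 1 &
        forall g, (forall x, dilate r A x -> inner (x - m) g <= 1) ->
          conv_hull (range f) g].
Proof.
move=> [_ _ [Q [[V [VL QV]] _ Q0 [V' [V'L dualQ]]] [U [t [Uunit QE]]]]].
pose U' := map_mx intr U : 'M[R]_n; pose W' := map_mx intr (invmx U) : 'M[R]_n.
have UW : U' *m W' = 1%:M by rewrite -map_mxM mulmxV // map_mx1.
have WU : W' *m U' = 1%:M by rewrite -map_mxM mulVmx // map_mx1.
(* [m] is the point that the unimodular map sends to the origin. *)
pose t' := map_mx intr t : 'rV[R]_n; pose m := - t' *m W'.
have mU x : (x - m) *m U' = x *m U' + t'.
  by rewrite mulmxBl -mulmxA WU mulmx1 opprK.
have QP x : Q ((x - m) *m U') <-> dilate r A x.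
  rewrite mU QE; split => [[y rAy]|rAx]; last by exists x.
  move=> /(congr1 (fun z => (z - t') *m W')); rewrite !addrK -!mulmxA UW !mulmx1.
  by move=> <-.
have Q_surj q : Q q -> exists2 x, dilate r A x & q = (x - m) *m U'.
  by rewrite QE => -[x rAx <-]; exists x; rewrite ?mU.
pose f (v : V') : 'rV[R]_n := val v *m U'^T.
have fE x v : inner (x - m) (f v) = inner ((x - m) *m U') (val v) by rewrite inner_mulmx.
have dualP c : dual_polytope Q c <-> conv_hull (range (fun v : V' => val v)) c.
  by rewrite dualQ fset_range.
have QV' : Q = conv_hull (range (fun v : V => val v)) by rewrite QV fset_range.
exists m, V', f; split.
- move=> i; rewrite !mxE rpred_sum // => k _; rewrite !mxE rpredM ?rpredN ?intr_int //.
- move=> v i; rewrite !mxE rpred_sum // => k _; rewrite !mxE rpredM ?intr_int //.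
  exact: (V'L _ (valP v)).
- move=> g; have [eps eps0 [Q1 Q2]] := interior_direction (g *m U') Q0.
  exists eps => //; split; apply/QP; rewrite addrAC subrr.
    by rewrite add0r -scalemxAl -[X in Q X]add0r.
  by rewrite add0r mulNmx -scalemxAl -[X in Q X]add0r.
- move=> x; rewrite -QP; split => [Qx v|fx].
    rewrite fE innerC; have /dualP : conv_hull (range (fun v : V' => val v)) (val v).
      by apply: sub_conv_hull; exists v.
    exact.
  apply: contrapT => nQ; rewrite QV' in nQ.
  have [|c [c1 cq]] := scaled_separation _ nQ.
    by rewrite -QV'; exact: interior_subset Q0.
  have /dualP/conv_hullP[l [l0 l1 cE]] : dual_polytope Q c by move=> y; rewrite QV'; exact: c1.
  move: cq; rewrite ltNge => /negP; apply; rewrite innerC cE inner_sumr -l1.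
  by apply: ler_sum => v _; rewrite -[leRHS]mulr1 ler_wpM2l // -fE.
- move=> g Hg; pose g0 := g *m W'^T.
  have gE : g = g0 *m U'^T by rewrite -mulmxA -trmx_mul UW trmx1 mulmx1.
  have /dualP/conv_hullP[l [l0 l1 g0E]] : dual_polytope Q g0.
    move=> _ /Q_surj[x rAx ->]; rewrite innerC inner_mulmx -gE; exact: Hg.
  apply/conv_hullP; exists l; split => //; rewrite gE g0E mulmx_suml.
  by apply: eq_bigr => v _; rewrite scalemxAl.
Qed.

Lemma reflexive_translate (J J' : finType) (f : J -> 'rV[R]_n) (v : J' -> 'rV[R]_n) (m : 'rV[R]_n) (r : nat)
  (x0 : 'rV[R]_n) (eps : R) :
  (forall j, lattice (f j)) -> lattice m -> (forall j, lattice (v j)) ->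
  eps != 0 -> dilate r (conv_hull (range f)) x0 ->
  (forall i, dilate r (conv_hull (range f)) (x0 + eps *: delta_mx 0 i)) ->
  interior (dilate r (conv_hull (range f))) m ->
  (forall x, dilate r (conv_hull (range f)) x <-> forall j, inner (x - m) (v j) <= 1) ->
  reflexive_polytope [set x - m | x in dilate r (conv_hull (range f))].
Proof.
move=> fL mL vL eps0 Ax0 Axi mint Aineq.
set B := [set _ | _ in _].
have BE x : B x <-> dilate r (conv_hull (range f)) (x + m).
  split => [[y Ay <-]|Ax]; first by rewrite subrK.
  by exists (x + m); rewrite ?addrK.
have Brange : B = conv_hull (range (fun j => r%:R *: f j - m)).
  apply/seteqP; split => x.
    move=> [_ [y /conv_hullP[l [l0 l1 ->]] <-] <-]; apply/conv_hullP; exists l; split => //.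
    under [RHS]eq_bigr do rewrite scalerBr scalerA mulrC -scalerA.
    by rewrite sumrB -scaler_suml l1 scale1r -scaler_sumr.
  move=> /conv_hullP[l [l0 l1 ->]]; exists (r%:R *: \sum_j l j *: f j).
    by exists (\sum_j l j *: f j) => //; exact: convex_combination.
  under [RHS]eq_bigr do rewrite scalerBr scalerA mulrC -scalerA.
  by rewrite sumrB -scaler_suml l1 scale1r -scaler_sumr.
have B0 : B 0 by apply/BE; rewrite add0r; exact: interior_subset mint.
have Bineq x : B x <-> forall j, inner x (v j) <= 1.
  by rewrite BE Aineq addrK.
split.
- rewrite Brange; apply: lattice_polytope_range => j i.
  by rewrite !mxE rpredB ?mL // rpredM ?rpred_nat // fL.
- apply: (full_dimensional_corner (x0 := x0 - m) eps0); first by apply/BE; rewrite subrK.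
  by move=> i; apply/BE; rewrite addrAC subrK.
- move/nbhs_ballP: mint => [delta /= delta0 ballA]; apply: (interior_box delta0) => y Hy.
  apply/BE; apply: ballA; split => // i j; rewrite /ball /= !mxE (ord1 i) opprD addrCA subrr addr0.
  by have := Hy j; rewrite mxE subr0 normrN.
(* The origin, which always lies in the dual, joins the generators because [scaled_separation] asks
   for it in the hull. *)
pose v' (o : option J') : 'rV[R]_n := oapp v 0 o.
suff -> : dual_polytope B = conv_hull (range v').
  apply: lattice_polytope_range => -[j|] /=; first exact: vL.
  by move=> i; rewrite mxE rpred0.
apply/seteqP; split => y.
  move=> dy; apply: contrapT => nv.
  have [|c [c1 cy]] := scaled_separation _ nv; first by apply: sub_conv_hull; exists None.
  have /dy : B c by apply/Bineq => j; apply: c1; apply: sub_conv_hull; exists (Some j).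
  by rewrite innerC leNgt cy.
move=> /conv_hullP[l [l0 l1 ->]] x /Bineq xv; rewrite innerC inner_sumr -l1.
apply: ler_sum => -[j|] _; rewrite -[leRHS]mulr1 ler_wpM2l //=.
by rewrite inner0r ler01.
Qed.

Lemma gorenstein_of_inequalities (J J' : finType) (f : J -> 'rV[R]_n) (v : J' -> 'rV[R]_n)
  (r : nat) (x0 : 'rV[R]_n) (eps : R) :
  (forall j, lattice (f j)) -> (forall j, lattice (v j)) ->
  full_dimensional (conv_hull (range f)) ->
  eps != 0 -> dilate r (conv_hull (range f)) x0 ->
  (forall i, dilate r (conv_hull (range f)) (x0 + eps *: delta_mx 0 i)) ->
  interior (dilate r (conv_hull (range f))) (const_mx 1) ->
  (forall x, dilate r (conv_hull (range f)) x <-> forall j, inner (x - const_mx 1) (v j) <= 1) ->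
  gorenstein r (conv_hull (range f)).
Proof.
move=> fL vL fdim eps0 Ax0 Axi one_int Aineq; split => //; first exact: lattice_polytope_range.
exists [set x - const_mx 1 | x in dilate r (conv_hull (range f))].
  apply: (reflexive_translate fL _ vL eps0 Ax0 Axi one_int Aineq).
  by move=> i; rewrite mxE rpred1.
exists 1%:M, (const_mx (-1)); split; first exact: unitmx1.
congr (image _ _); apply/funext => x; rewrite map_mx1 mulmx1; congr (_ + _).
by apply/rowP => i; rewrite !mxE.
Qed.

End Duality.

(** * From integral inequalities back to perfection *)

Section GorensteinPerfect.
Context {R : realType} {d : nat} {le e : rel 'I_d} {e_irr : irreflexive e}.
Context (e_sym : symmetric e).

Local Notation idl := {I : {set 'I_d} | ideal (le:=le) I}.
Local Notation stb := {S : {set 'I_d} | stable e S}.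
Local Notation ideal_vertex := (@ideal_vertex R d le).
Local Notation stable_vertex := (@stable_vertex R d e).
Local Notation cayley_vertex := (@cayley_vertex R d le e).
Local Notation minkowski_vertex := (@minkowski_vertex R d le e).
Local Notation full_ideal := (@full_ideal d le).
Local Notation empty_ideal := (@empty_ideal d le).
Local Notation empty_stable := (@empty_stable d e).
Local Notation single_stable := (@single_stable d e e_irr).

Lemma sum_rho_clique (b : stb -> R) (K : {set 'I_d}) :
  \sum_(i in K) (\sum_X b X *: stable_vertex X) 0 i = \sum_X b X * #|val X :&: K|%:R.
Proof.
under eq_bigr do rewrite summxE.
rewrite exchange_big /=; apply: eq_bigr => X _; rewrite -sum1_card natr_sum mulr_sumr.
rewrite big_mkcond [RHS]big_mkcond; apply: eq_bigr => i _; rewrite mxE rhoE inE.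
by case: (i \in K); case: (i \in val X); rewrite ?andbF ?mulr1 ?mulr0.
Qed.

(* If every point dominated by the clique inequalities is dominated by a convex
   combination of stable sets, then any stable set used for the uniform weight
   [1/(N+1)] meets all cliques of size [N+1]. *)
Lemma perfect_of_fractional :
  (forall y : 'rV[R]_d, (forall i, 0 <= y 0 i) ->
    (forall K, clique e K -> \sum_(i in K) y 0 i <= 1) ->
    exists b : stb -> R, [/\ forall X, 0 <= b X, \sum_X b X = 1 &
      forall i, y 0 i <= (\sum_X b X *: stable_vertex X) 0 i]) ->
  perfect e_irr.
Proof.
move=> frac; apply: perfect_of_coloring => S N; elim: N S => [|N IH] S bound.
  exists [::]; split => // v vS; have := bound [set v]%SET (clique1 v).
  by rewrite finset.sub1set vS cards1 => /(_ isT).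
pose y : 'rV[R]_d := \row_i ((i \in S)%:R / N.+1%:R).
have N1 : 0 < N.+1%:R :> R by rewrite ltr0Sn.
have sum_y (K : {set 'I_d}) : \sum_(i in K) y 0 i = #|K :&: S|%:R / N.+1%:R.
  rewrite -sum1_card natr_sum mulr_suml big_mkcond [RHS]big_mkcond; apply: eq_bigr => i _.
  by rewrite mxE inE; case: (i \in K); case: (i \in S); rewrite //= mul0r.
have [||b [b0 b1 yb]] := frac y.
- by move=> i; rewrite mxE divr_ge0 ?ler0n.
- move=> K cK; rewrite sum_y ler_pdivrMr // mul1r ler_nat; apply: bound.
    by apply: clique_sub cK; exact: finset.subsetIl.
  exact: finset.subsetIr.
have [X bX] : exists X, 0 < b X.
  apply: contrapT => no; have : \sum_X b X = 0.
    by apply: big1 => X _; apply/eqP; rewrite eq_le b0 andbT leNgt; apply/negP => bX; apply: no; exists X.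
  by rewrite b1 => /eqP; rewrite oner_eq0.
have meets (K : {set 'I_d}) : clique e K -> K \subset S -> #|K| = N.+1 -> val X :&: K != finset.set0.
  move=> cK KS cardK; apply/eqP => XK.
  have le1 Y : b Y * #|val Y :&: K|%:R <= b Y.
    rewrite -[leRHS]mulr1 ler_wpM2l // -[1]/(1%:R) ler_nat.
    exact: card_stable_clique (valP Y) cK.
  have : \sum_(i in K) y 0 i <= \sum_Y b Y * #|val Y :&: K|%:R.
    by rewrite -sum_rho_clique; apply: ler_sum => i _; exact: yb.
  have -> : \sum_(i in K) y 0 i = 1.
    by rewrite sum_y (finset.setIidPl KS) cardK divff // gt_eqF.
  have : \sum_Y b Y * #|val Y :&: K|%:R < \sum_Y b Y.
    rewrite (bigD1 X) //= [ltRHS](bigD1 X) //= [val X]/(sval X) XK cards0 mulr0.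
    by rewrite ltr_leD // ler_sum.
  by rewrite b1 ltNge => /negP.
have [|F [sF stF coverF]] := IH (S :\: val X).
  move=> K cK; rewrite finset.subsetD => /andP[KS KX].
  have := bound K cK KS; rewrite leq_eqVlt => /orP[/eqP cardK|//].
  have := meets K cK KS cardK; rewrite finset.setIC -finset.setI_eq0 in KX *.
  by rewrite KX.
exists (val X :: F); split => /=; [by rewrite sF|by rewrite (valP X)|].
move=> v vS; have [//|vX] := boolP (v \in val X).
by apply: coverF; rewrite inE vX vS.
Qed.

(* The inequalities of the sum, read at [1 + y], have 0/1 left-hand sides
   supported on cliques. *)
Lemma perfect_of_inequalities (J : finType) (v : J -> 'rV[R]_d) :
  (forall j, lattice (v j)) ->
  (forall x, conv_hull (range minkowski_vertex) x <-> forall j, inner (x - const_mx 1) (v j) <= 1) ->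
  perfect e_irr.
Proof.
move=> vL Mineq; apply: perfect_of_fractional => y y0 yK.
have one_S (X : stb) j : inner (stable_vertex X) (v j) <= 1.
  have : conv_hull (range minkowski_vertex) (const_mx 1 + stable_vertex X).
    by apply: sub_conv_hull; exists (full_ideal, X); rewrite // /minkowski_vertex /= ideal_vertexT.
  by move=> /Mineq/(_ j); rewrite addrAC subrr add0r.
have inner_st (X : stb) j : inner (stable_vertex X) (v j) = \sum_(i in val X) v j 0 i.
  by rewrite innerC inner_rho.
have v_le1 j i : v j 0 i <= 1.
  by have := one_S (single_stable i) j; rewrite inner_st /= big_set1.
have : conv_hull (range minkowski_vertex) (const_mx 1 + y).
  apply/Mineq => j; rewrite addrAC subrr add0r.
  (* Singletons bound the coefficients by one, and two coefficients equal to one at nonadjacent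
     vertices would give two on a stable pair; so [K] is a clique. The other coefficients, integers
     below one, are nonpositive and only lower the sum. *)
  pose K := [set i | v j 0 i == 1]%SET.
  have cK : clique e K.
    apply/cliqueP => i k; rewrite !inE => /eqP vi /eqP vk ik; apply/negPn/negP => nik.
    have st : stable e [set i; k]%SET.
      apply/stableP => a b; rewrite !inE => /orP[] /eqP -> /orP[] /eqP ->; rewrite ?e_irr //.
      by rewrite e_sym.
    have := one_S (exist (fun X : {set 'I_d} => stable e X) _ st) j.
    by rewrite inner_st /= big_setU1 ?inE //= big_set1 vi vk; lra.
  apply: le_trans (yK K cK); rewrite /inner [leRHS]big_mkcond; apply: ler_sum => i _.
  rewrite inE; case: eqP => [->|/eqP ne1]; first by rewrite mulr1.
  apply: mulr_ge0_le0 => //; have lt1 : v j 0 i < 1 by rewrite lt_neqAle ne1 v_le1.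
  exact: int_le0 (vL j i) lt1.
rewrite -[conv_hull _]dilate1 => /minkowski_dilateP[//|a [b [a0 b0 a1 b1 yE]]].
(* The ideal part is at most one in each coordinate, so the stable part must dominate [y]. *)
exists b; split => // i; have /rowP/(_ i) := yE; rewrite [LHS]mxE [RHS]mxE [const_mx _ _ _]mxE.
suff : (\sum_I a I *: ideal_vertex I) 0 i <= 1 by move=> u1 yi; rewrite -(lerD2l 1) yi lerD2r.
rewrite summxE -[leRHS](mulr1n 1) -a1; apply: ler_sum => X _.
by rewrite mxE rhoE -[leRHS]mulr1 ler_wpM2l // -[1]/(1%:R) ler_nat leq_b1.
Qed.

End GorensteinPerfect.

Section Centers.
Context {R : realType} {n : nat}.

(* [- e_i / m_i] lies in the dual polytope and is a convex combination of lattice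
   points of the dual; a lattice point occurring in it is constant on the face
   [x_i = 0], hence is a multiple of [e_i]. *)
Lemma center_coordinate (B : set 'rV[R]_n) (m : 'rV[R]_n) (J : finType) (f : J -> 'rV[R]_n) :
  lattice m -> (forall j, lattice (f j)) ->
  (forall g, exists2 eps, 0 < eps & B (m + eps *: g) /\ B (m - eps *: g)) ->
  (forall x, B x <-> forall j, inner (x - m) (f j) <= 1) ->
  (forall g, (forall x, B x -> inner (x - m) g <= 1) -> conv_hull (range f) g) ->
  forall i, (forall x, B x -> 0 <= x 0 i) -> B 0 ->
  (forall k, k != i -> exists2 c : R, c != 0 & B (c *: delta_mx 0 k)) -> m 0 i = 1.
Proof.
move=> mL fL dir Bineq dual i Bi B0 Bk.
have mi_gt0 : 0 < m 0 i.
  have [eps eps0 [_ /Bi]] := dir (delta_mx 0 i).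
  by rewrite !mxE !eqxx mulr1 subr_ge0; exact: lt_le_trans.
have innerg x : inner (x - m) (- (m 0 i)^-1 *: delta_mx 0 i) = 1 - x 0 i / m 0 i.
  by rewrite innerZr inner_delta !mxE; field; rewrite gt_eqF.
have /conv_hullP[l [l0 l1 gE]] : conv_hull (range f) (- (m 0 i)^-1 *: delta_mx 0 i).
  apply: dual => x /Bi xi; rewrite innerg gerBl divr_ge0 //; exact: ltW.
have tight x : B x -> x 0 i = 0 -> forall j, l j != 0 -> inner (x - m) (f j) = 1.
  move=> Bx xi; have : \sum_j l j * (1 - inner (x - m) (f j)) = 0.
    under eq_bigr do rewrite mulrBr mulr1.
    by rewrite sumrB l1 -inner_sumr -gE innerg xi mul0r subr0 subrr.
  move=> /eqP; rewrite psumr_eq0; last first.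
    by move=> j _; rewrite mulr_ge0 // subr_ge0; move/Bineq: Bx.
  move=> /allP H j lj; have := H j (mem_index_enum _).
  by rewrite /= mulf_eq0 (negPf lj) subr_eq0 eq_sym => /eqP.
have [j lj] : exists j, l j != 0.
  apply: contrapT => no; have : \sum_j l j = 0.
    by apply: big1 => j _; apply/eqP/negPn/negP => lj; apply: no; exists j.
  by rewrite l1 => /eqP; rewrite oner_eq0.
have f0 : inner (0 - m) (f j) = 1 by apply: tight; rewrite // mxE.
have fk k : k != i -> f j 0 k = 0.
  move=> ki; have [c c0 Bc] := Bk k ki.
  have : inner (c *: delta_mx 0 k - m) (f j) = 1.
    by apply: tight => //; rewrite !mxE eqxx [i == k]eq_sym (negPf ki) mulr0.
  rewrite -[X in _ = X -> _]f0 sub0r innerDl => /(canRL (addrK _)); rewrite subrr.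
  by rewrite innerZl innerC inner_delta => /eqP; rewrite mulf_eq0 (negPf c0) => /eqP.
have : m 0 i * - f j 0 i = 1.
  rewrite -f0 sub0r innerNl /inner (bigD1 i) //= big1 ?addr0 ?mulrN // => k ki.
  by rewrite fk ?mulr0.
move=> /(int_mul_eq1 (mL i) _); rewrite rpredN fL => /(_ isT).
by rewrite gtr0_norm.
Qed.

End Centers.

Section Equivalences.
Context {R : realType} {d : nat} {le e : rel 'I_d} {e_irr : irreflexive e}.
Context (leR : reflexive le) (leT : transitive le) (leA : antisymmetric le) (e_sym : symmetric e).

Local Notation idl := {I : {set 'I_d} | ideal (le:=le) I}.
Local Notation stb := {S : {set 'I_d} | stable e S}.
Local Notation ideal_vertex := (@ideal_vertex R d le).
Local Notation stable_vertex := (@stable_vertex R d e).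
Local Notation cayley_vertex := (@cayley_vertex R d le e).
Local Notation minkowski_vertex := (@minkowski_vertex R d le e).
Local Notation full_ideal := (@full_ideal d le).
Local Notation empty_ideal := (@empty_ideal d le).
Local Notation empty_stable := (@empty_stable d e).
Local Notation single_stable := (@single_stable d e e_irr).
Local Notation C2 := (dilate 2 (conv_hull (range cayley_vertex))).

(** The Cayley trick: the last coordinate is the total weight of the ideals, so at height one of the
    twofold dilate both totals are one. *)
Lemma minkowski_slice x : conv_hull (range minkowski_vertex) x <-> C2 (row_mx x (const_mx 1)).
Proof.
rewrite -[conv_hull (range minkowski_vertex)]dilate1 minkowski_dilateP // cayley_dilateP //; split.
  move=> [a [b [a0 b0 a1 b1 ->]]]; exists a, b; split => //; first by rewrite a1 b1.
  by rewrite a1.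
move=> [a [b [a0 b0 ab /eq_row_mx[-> /rowP/(_ 0)]]]]; rewrite !mxE => a1.
by exists a, b; split => //; move: ab; rewrite -a1; lra.
Qed.

Lemma minkowski_ge0 x i : conv_hull (range minkowski_vertex) x -> 0 <= x 0 i.
Proof.
rewrite -[conv_hull _]dilate1 => /minkowski_dilateP[//|a [b [a0 b0 _ _ ->]]].
rewrite mxE !summxE addr_ge0 // sumr_ge0 // => X _; by rewrite mxE rhoE mulr_ge0 ?ler0n.
Qed.

Lemma cayley_ge0 z i : C2 z -> 0 <= z 0 (lshift 1 i).
Proof.
move=> /cayley_dilateP[//|a [b [a0 b0 _ ->]]]; rewrite row_mxEl.
rewrite mxE !summxE addr_ge0 // sumr_ge0 // => X _; by rewrite mxE rhoE mulr_ge0 ?ler0n.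
Qed.

Lemma cayley2_vertex j : C2 (2 *: cayley_vertex j).
Proof. by exists (cayley_vertex j) => //; apply: sub_conv_hull; exists j. Qed.

Lemma cayley2_origin : C2 0.
Proof.
by rewrite -(scaler0 _ 2) -(@cayley_vertex_origin R d le e); exact: cayley2_vertex.
Qed.

Lemma cayley2_delta k : C2 (2 *: delta_mx 0 k).
Proof.
case: (splitP k) => j kj.
  rewrite (_ : k = lshift 1 j); last exact: val_inj.
  by rewrite -(@cayley_vertex_single R d le e e_irr); exact: cayley2_vertex.
rewrite (_ : k = rshift d ord0); last by apply: val_inj; rewrite /= kj (ord1 j).
by rewrite -(@cayley_vertex_last R d le e); exact: cayley2_vertex.
Qed.

Lemma perfect_of_gorenstein_minkowski :
  gorenstein 1 (conv_hull (range minkowski_vertex)) -> perfect e_irr.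
Proof.
move=> /gorenstein_dual[m [J [f [mL fL]]]]; rewrite dilate1 => dir ineq dual.
have M0 : conv_hull (range minkowski_vertex) 0.
  apply: sub_conv_hull; exists (empty_ideal, empty_stable) => //.
  by rewrite /minkowski_vertex /= ideal_vertex0 stable_vertex0 addr0.
have m1 : m = const_mx 1.
  apply/rowP => i; rewrite [RHS]mxE; apply: (center_coordinate mL fL dir ineq dual) => //.
    by move=> x; exact: minkowski_ge0.
  move=> k _; exists 1; rewrite ?oner_neq0 // scale1r.
  apply: sub_conv_hull; exists (empty_ideal, single_stable k) => //.
  by rewrite /minkowski_vertex /= ideal_vertex0 stable_vertex1 add0r.
by apply: (@perfect_of_inequalities _ _ le _ _ e_sym _ f fL) => x; rewrite ineq m1.
Qed.

Lemma perfect_of_gorenstein_cayley :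
  gorenstein 2 (conv_hull (range cayley_vertex)) -> perfect e_irr.
Proof.
move=> /gorenstein_dual[m [J [f [mL fL dir ineq dual]]]].
have C0 := cayley2_origin.
have ml i : m 0 (lshift 1 i) = 1.
  apply: (center_coordinate mL fL dir ineq dual) => //; first by move=> z; exact: cayley_ge0.
  by move=> k _; exists 2; rewrite ?pnatr_eq0 //; exact: cayley2_delta.
(* Both directions around [m] stay in the dilate, so this coordinate is strictly between 0 and 2. *)
have mr : m 0 (rshift d ord0) = 1.
  have [eps eps0 [z1 z2]] := dir (delta_mx 0 (rshift d ord0)).
  have := cayley_last_bounds (ltn0Sn 1) z1; have := cayley_last_bounds (ltn0Sn 1) z2.
  rewrite !mxE !eqxx mulr1 => /andP[lo _] /andP[_ hi].
  apply/eqP; rewrite -subr_eq0; apply/eqP/int_lt1_eq0; first by rewrite rpredB ?rpred1 ?mL.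
  by rewrite ltr_norml; apply/andP; split; move: lo hi eps0; lra.
have m1 : m = row_mx (const_mx 1) (const_mx 1).
  rewrite -[LHS]hsubmxK; congr row_mx; apply/rowP => i; rewrite !mxE ?ml //.
  by rewrite (ord1 i).
apply: (@perfect_of_inequalities _ _ le _ _ e_sym _ (fun j => lsubmx (f j))).
  by move=> j i; rewrite mxE; exact: fL.
move=> x; rewrite minkowski_slice ineq m1 opp_row_mx add_row_mx subrr.
have E j : inner (row_mx (x - const_mx 1) 0) (f j) = inner (x - const_mx 1) (lsubmx (f j)).
  by rewrite -{1}[f j]hsubmxK inner_row_mx innerC [X in _ + X]innerC inner0r addr0 innerC.
by split => H j; [rewrite -E|rewrite E].
Qed.

(** * Inequalities of the sums for perfect graphs *)

Section Inequalities.
Context (perf : perfect e_irr).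

(** Integral weights can be split, so the data are multiplied by [N] and truncated. The resulting
    point stays within 2 of [N%:R *: z] in each coordinate, an error of at most [M] for the
    separating functional, whereas separation would demand a gap of [N%:R * eta], which is
    larger. *)
Lemma real_decomposition (s t : R) (u w : 'rV[R]_d) : s + t = 2 -> 0 <= s -> 0 <= t ->
  (forall i, 0 <= u 0 i) -> (forall i, u 0 i <= s) -> (forall i j, le j i -> u 0 i <= u 0 j) ->
  (forall i, 0 <= w 0 i) -> (forall K, clique e K -> \sum_(i in K) w 0 i <= t) ->
  C2 (row_mx (u + w) (const_mx s)).
Proof.
move=> st s0 t0 u0 us u_mono w0 wK; set z := row_mx _ _.
have half : conv_hull (range cayley_vertex) (2^-1 *: z) -> C2 z.
  by move=> zh; exists (2^-1 *: z); rewrite // scalerA mulfV ?scale1r // pnatr_eq0.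
apply: half; apply: contrapT => /conv_hull_separation[c [b [cb]]]; rewrite innerZr => cz.
pose eta := inner c z + 2 * b; have eta_gt0 : 0 < eta by rewrite /eta; lra.
pose M := \sum_i `|c 0 i| * 2.
have M0 : 0 <= M by apply: sumr_ge0 => i _; rewrite mulr_ge0.
pose N := Num.bound (M / eta).
have NM : M < N%:R * eta by rewrite -ltr_pdivrMr // archi_boundP // divr_ge0 // ltW.
have N0 : 0 <= N%:R :> R by rewrite ler0n.
pose fl (x : R) := Num.truncn (N%:R * x).
have fl_le x : 0 <= x -> (fl x)%:R <= N%:R * x.
  by move=> x0; have /andP[] := truncn_itv (mulr_ge0 N0 x0).
have fl_gt x : 0 <= x -> N%:R * x <= (fl x)%:R + 1.
  by move=> x0; have /andP[_ /ltW] := truncn_itv (mulr_ge0 N0 x0); rewrite -natr1.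
have fl_mono x y : x <= y -> (fl x <= fl y)%N.
  by move=> xy; apply: le_truncn; rewrite ler_wpM2l.
have [||F [sF idF cF]] := @ideal_layers _ le (fun i => fl (u 0 i)) (fl s).
- by move=> i; exact: fl_mono.
- by move=> i j ji; exact/fl_mono/u_mono.
have flsN : (fl s <= 2 * N)%N.
  rewrite -(ler_nat R) natrM; apply: le_trans (fl_le _ s0) _.
  by rewrite mulrC ler_wpM2r //; lra.
have [|G [sG stG cG]] := weighted_coloring (y := fun i => fl (w 0 i)) (N := (2 * N - fl s)%N) perf.
  move=> K cK; rewrite -(ler_nat R) natr_sum natrB // natrM.
  apply: (@le_trans _ _ (N%:R * t)).
    apply: (@le_trans _ _ (N%:R * \sum_(i in K) w 0 i)); last by rewrite ler_wpM2l // wK.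
    by rewrite mulr_sumr; apply: ler_sum => i _; exact: fl_le.
  have -> : t = 2 - s by move: st; lra.
  by rewrite mulrBr mulrC lerD2l lerN2 fl_le.
have [F' FE] := seq_sub idF; have [G' GE] := seq_sub stG.
pose zN := \sum_(X <- F') cayley_vertex (inl X) + \sum_(X <- G') cayley_vertex (inr X).
have zN_le : inner c zN + N%:R * (2 * b) <= 0.
  have sum_le (U : Type) (H : seq U) (g : U -> idl + stb) :
      inner c (\sum_(X <- H) cayley_vertex (g X)) + (size H)%:R * b <= 0.
    elim: H => [|X H IH]; first by rewrite big_nil inner0r mul0r addr0.
    by rewrite big_cons innerDr /= -natr1 mulrDl mul1r; have := cb (g X); move: IH; lra.
  have := sum_le _ F' inl; have := sum_le _ G' inr.
  have -> : size F' = fl s by rewrite -sF FE size_map.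
  have -> : size G' = (2 * N - fl s)%N by rewrite -sG GE size_map.
  rewrite natrB // natrM mulrBl innerDr; lra.
have diff_le : inner c (N%:R *: z - zN) <= M.
  apply: ler_sum => i _; apply: le_trans (ler_norm _) _; rewrite normrM ler_wpM2l //.
  rewrite /zN sum_cayley_vertices !mxE; case: (splitP i) => j ij; rewrite !mxE.
    rewrite !sum_rho_count -FE -GE cF cG.
    have := fl_le _ (u0 j); have := fl_le _ (w0 j); have := fl_gt _ (u0 j); have := fl_gt _ (w0 j).
    by rewrite ler_norml mulrDr => *; apply/andP; split; lra.
  have -> : size F' = fl s by rewrite -sF FE size_map.
  have := fl_le _ s0; have := fl_gt _ s0.
  by rewrite ler_norml => *; apply/andP; split; lra.
move: diff_le zN_le NM; rewrite innerBr innerZr /eta mulrDr; lra.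
Qed.

(** The clique condition on [x - u] involves minima, because [u] is an envelope. Letting the first
    component of [q] range over all choices of a smaller element, or of [s], replaces it by linear
    inequalities, the strongest being the one for the choice made by the envelope. *)
Lemma cayley_inequalities : exists (J : finType) (v : J -> 'rV[R]_(d + 1)),
  (forall j, lattice (v j)) /\ forall z, C2 z <-> forall j, inner (z - const_mx 1) (v j) <= 1.
Proof.
(* Pairs that are not valid receive the zero vector below, whose inequality always holds. *)
pose valid (q : {ffun 'I_d -> option 'I_d} * {set 'I_d}) :=
  clique e q.2 && [forall i, oapp (le^~ i) true (q.1 i)].
pose coef (q : {ffun 'I_d -> option 'I_d} * {set 'I_d}) : 'rV[R]_d :=
  \sum_(i in q.2) (delta_mx 0 i - oapp (delta_mx 0) 0 (q.1 i)).
(* Each choice [None] subtracts [s] instead of a coordinate of [x], which lowers the coefficient of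
   [s] by one. *)
pose last (q : {ffun 'I_d -> option 'I_d} * {set 'I_d}) : R :=
  1 - \sum_(i in q.2) (q.1 i == None)%:R.
pose v (j : ('I_d + unit) + ({ffun 'I_d -> option 'I_d} * {set 'I_d})) : 'rV[R]_(d + 1) :=
  match j with
  | inl (inl i) => - delta_mx 0 (lshift 1 i)
  | inl (inr _) => - delta_mx 0 (rshift d ord0)
  | inr q => if valid q then row_mx (coef q) (const_mx (last q)) else 0
  end.
have inner_valid (x : 'rV[R]_d) (s : R) q :
    inner (row_mx x (const_mx s : 'rV[R]_1) - const_mx 1) (row_mx (coef q) (const_mx (last q))) =
    \sum_(i in q.2) (x 0 i - oapp (x 0) s (q.1 i)) + s - 1.
  have -> : const_mx 1 = row_mx (const_mx 1) (const_mx 1) :> 'rV[R]_(d + 1) by rewrite row_mx_const.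
  rewrite opp_row_mx add_row_mx inner_row_mx.
  have -> : inner (const_mx s - const_mx 1 : 'rV[R]_1) (const_mx (last q)) = (s - 1) * last q.
    by rewrite /inner big_ord1 !mxE.
  have -> : inner (x - const_mx 1) (coef q) = \sum_(i in q.2) (x 0 i - oapp (x 0) s (q.1 i)) +
      (s - 1) * \sum_(i in q.2) (q.1 i == None)%:R.
    rewrite /coef (eq_bigr (fun i => 1 *: (delta_mx 0 i - oapp (delta_mx 0) 0 (q.1 i)))); last first.
      by move=> i _; rewrite scale1r.
    rewrite inner_sumr mulr_sumr -big_split /=; apply: eq_bigr => i _.
    rewrite mul1r innerBr inner_delta.
    by case: (q.1 i) => [j|] /=; rewrite ?inner_delta ?inner0r !mxE; ring.
  by rewrite /last; ring.
exists _, v; split.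
  move=> [[i|[]]|q] k /=; rewrite ?mxE ?rpredN ?rpred_nat //.
  case: ifP => _; last by rewrite mxE rpred0.
  rewrite mxE; case: splitP => j _; rewrite ?mxE.
    rewrite summxE rpred_sum // => i _; rewrite !mxE rpredB ?rpred_nat //.
    by case: (q.1 i) => [a|] /=; rewrite mxE ?rpred_nat ?rpred0.
  by rewrite rpredB ?rpred1 // rpred_sum // => i _; rewrite rpred_nat.
move=> z; pose x := lsubmx z; pose s := z 0 (rshift d ord0).
have zE : z = row_mx x (const_mx s).
  by rewrite -[LHS]hsubmxK; congr row_mx; apply/rowP => i; rewrite !mxE (ord1 i).
have xz i : x 0 i = z 0 (lshift 1 i) by rewrite mxE.
split.
  move=> Cz; have /cayley_dilateP[//|a [b [a0 b0 ab]]] := Cz.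
  rewrite {1}zE => /eq_row_mx[xE /rowP/(_ 0)]; rewrite !mxE => sE.
  case=> [[i|[]]|q] /=.
  - by rewrite innerNr inner_delta !mxE -xz opprB gerBl xz cayley_ge0.
  - rewrite innerNr inner_delta !mxE -/s opprB gerBl.
    by have /andP[] := cayley_last_bounds (ltn0Sn 1) Cz.
  case: ifP => [/andP[cK /forallP phi_le]|_]; last by rewrite inner0r ler01.
  rewrite zE inner_valid.
  pose u i := (\sum_I a I *: ideal_vertex I) 0 i.
  have uE i : u i = \sum_I a I * (i \in val I)%:R.
    by rewrite /u summxE; apply: eq_bigr => I _; rewrite mxE rhoE.
  have xuw i : x 0 i = u i + (\sum_S b S *: stable_vertex S) 0 i by rewrite xE mxE.
  have w_ge0 i : 0 <= (\sum_S b S *: stable_vertex S) 0 i.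
    by rewrite summxE sumr_ge0 // => S _; rewrite mxE rhoE mulr_ge0 ?ler0n.
  have u_phi i : u i <= oapp (x 0) s (q.1 i).
    have := phi_le i; case: (q.1 i) => [j|] /=.
      move=> ji; apply: (@le_trans _ _ (u j)); last by rewrite xuw lerDl.
      rewrite !uE; apply: ler_sum => I _; rewrite ler_wpM2l // ler_nat.
      by case iI: (i \in val I) => //; rewrite (idealP _ (valP I) _ _ iI ji).
    move=> _; rewrite uE sE; apply: ler_sum => I _; rewrite -[leRHS]mulr1 ler_wpM2l //.
    by rewrite -[1]/(1%:R) ler_nat leq_b1.
  suff : \sum_(i in q.2) (x 0 i - oapp (x 0) s (q.1 i)) <= \sum_S b S.
    by move: ab; rewrite -sE; lra.
  apply: (@le_trans _ _ (\sum_(i in q.2) (\sum_S b S *: stable_vertex S) 0 i)).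
    by apply: ler_sum => i _; rewrite lerBlDl xuw lerD2r.
  rewrite sum_rho_clique; apply: ler_sum => S _; rewrite -[leRHS]mulr1 ler_wpM2l //.
  by rewrite -[1]/(1%:R) ler_nat; exact: card_stable_clique (valP S) cK.
move=> ineq; rewrite zE.
have s0 : 0 <= s.
  by have := ineq (inl (inr tt)); rewrite /= innerNr inner_delta !mxE -/s opprB gerBl.
have x0 i : 0 <= x 0 i.
  by have := ineq (inl (inl i)); rewrite /= innerNr inner_delta !mxE -xz opprB gerBl.
have [phi phi_le [us ux]] := @exists_lower_envelope R d le (x 0) s.
pose u : 'rV[R]_d := \row_i oapp (x 0) s (phi i).
have uE i : u 0 i = oapp (x 0) s (phi i) by rewrite mxE.
have Kineq K : clique e K -> \sum_(i in K) (x - u) 0 i <= 2 - s.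
  move=> cK; have valid_phi : valid (finfun phi, K).
    rewrite /valid cK /=; apply/forallP => i; rewrite ffunE.
    by case E: (phi i) => [j|] //=; exact: phi_le.
  have := ineq (inr (finfun phi, K)); rewrite /v valid_phi.
  rewrite [in X in X -> _]zE inner_valid /=.
  rewrite (eq_bigr (fun i => (x - u) 0 i)); last by move=> i _; rewrite ffunE !mxE.
  lra.
rewrite (_ : x = u + (x - u)); last by rewrite addrC subrK.
apply: (@real_decomposition s (2 - s)) => //.
- by rewrite addrC subrK.
(* The empty clique bounds [s] by 2. *)
- by have := Kineq _ clique0; rewrite big_set0.
- by move=> i; rewrite uE; case: (phi i).
- by move=> i; rewrite uE.
- move=> i j ji; rewrite [u 0 j]uE; case E: (phi j) => [k|] /=; rewrite uE; last exact: us.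
  by apply: ux; exact: leT (phi_le _ _ E) ji.
- move=> i; have -> : (x - u) 0 i = x 0 i - u 0 i by rewrite [LHS]mxE [X in _ + X]mxE.
  by rewrite uE subr_ge0; apply: ux; exact: leR.
Qed.

Lemma gorenstein_cayley : gorenstein 2 (conv_hull (range cayley_vertex)).
Proof.
have [J [v [vL ineq]]] := cayley_inequalities.
have C0 := cayley2_origin.
apply: (gorenstein_of_inequalities (cayley_lattice) vL _ _ C0 _ _ ineq (eps := 2)).
- exact: full_dimensional_cayley.
- by rewrite pnatr_eq0.
- by move=> k; rewrite add0r; exact: cayley2_delta.
- exact: interior_cayley.
Qed.

Lemma gorenstein_minkowski : gorenstein 1 (conv_hull (range minkowski_vertex)).
Proof.
have [J [v [vL ineq]]] := cayley_inequalities.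
have vL' j : lattice (lsubmx (v j)) by move=> i; rewrite mxE; exact: vL.
have M0 : conv_hull (range minkowski_vertex) 0.
  apply: sub_conv_hull; exists (empty_ideal, empty_stable) => //.
  by rewrite /minkowski_vertex /= ideal_vertex0 stable_vertex0 addr0.
apply: (gorenstein_of_inequalities (minkowski_lattice) vL' (x0 := 0) (eps := 1)); rewrite ?dilate1 //.
- exact: full_dimensional_minkowski.
- move=> k; rewrite add0r scale1r.
  apply: sub_conv_hull; exists (empty_ideal, single_stable k) => //.
  by rewrite /minkowski_vertex /= ideal_vertex0 stable_vertex1 add0r.
- exact: interior_minkowski.
(* On the slice the last coordinate of the centred point vanishes, so only the first [d] entries of
   each normal matter, and they remain integral. *)
move=> x; rewrite minkowski_slice ineq -row_mx_const opp_row_mx add_row_mx subrr.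
have E j : inner (row_mx (x - const_mx 1) 0) (v j) = inner (x - const_mx 1) (lsubmx (v j)).
  by rewrite -{1}[v j]hsubmxK inner_row_mx innerC [X in _ + X]innerC inner0r addr0 innerC.
by split => H j; [rewrite -E|rewrite E].
Qed.

End Inequalities.

End Equivalences.

(** * The theorem *)

Section Labelling.
Context {R : realType} {d : nat} {disp : Order.disp_t} {P : finPOrderType disp}.
Context (p : 'I_d -> P) (p_bij : bijective p) (e : rel 'I_d).

(** The order is pulled back to the labels so that ideals and stable sets become subsets of the same
    type. *)
Definition label_le : rel 'I_d := fun i j => (p i <= p j)%O.

Lemma order_polytope_range :
  order_polytope p = conv_hull (range (@ideal_vertex R d label_le)).
Proof.
congr conv_hull; apply/seteqP; split => x.
  move=> [I /= /forall_inP idI <-]; have idX : ideal (le:=label_le) [set j | p j \in I]%SET.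
    apply/idealP => i j; rewrite !inE => pi ij.
    by have /forallP/(_ (p j))/implyP := idI _ pi; apply.
  by exists (exist (fun X : {set 'I_d} => ideal (le:=label_le) X) _ idX).
move=> [[X idX] _ <-]; have [q pK qK] := p_bij.
exists [set y | q y \in X]%SET => /=.
  apply/forall_inP => y; rewrite inE => qy; apply/forallP => z; apply/implyP => zy.
  by rewrite inE; apply: (idealP _ idX _ _ qy); rewrite /label_le !qK.
by congr rho; apply/setP => j; rewrite !inE pK.
Qed.

Lemma stable_set_polytope_range :
  stable_set_polytope e = conv_hull (range (@stable_vertex R d e)).
Proof.
congr conv_hull; apply/seteqP; split => x.
  by move=> [X /= stX <-]; exists (exist (fun X : {set 'I_d} => stable e X) _ stX).
by move=> [[X stX] _ <-]; exists X.
Qed.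

End Labelling.

Theorem theorem0p4 (R : realType) (d : nat)
  (disp : Order.disp_t) (P : finPOrderType disp)
  (p : 'I_d -> P) (p_bij : bijective p)
  (e : rel 'I_d) (e_sym : symmetric e) (e_irr : irreflexive e) :
  let OP : set 'rV[R]_d := order_polytope p in
  let QG : set 'rV[R]_d := stable_set_polytope e in
  [/\ is_codegree (cayley_sum OP QG) 2,
      is_codegree (minkowski_sum OP QG) 1,
      [<-> gorenstein 2 (cayley_sum OP QG);
           gorenstein 1 (minkowski_sum OP QG);
           perfect e_irr] &
      perfect e_irr ->
      [/\ has_regular_unimodular_triangulation (cayley_sum OP QG) /\
          has_regular_unimodular_triangulation (minkowski_sum OP QG),
          idp (cayley_sum OP QG) /\ idp (minkowski_sum OP QG) &
          minkowski_sum (OP `&` lattice) (QG `&` lattice) =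
          minkowski_sum OP QG `&` lattice]].
Proof.
move=> OP QG.
have leR : reflexive (label_le p) by move=> i; exact: lexx.
have leT : transitive (label_le p) by move=> j i k; exact: le_trans.
have leA : antisymmetric (label_le p).
  by move=> i j; rewrite /label_le => /le_anti /(bij_inj p_bij).
have CE : cayley_sum OP QG = conv_hull (range (@cayley_vertex R d (label_le p) e)).
  by rewrite /OP /QG (order_polytope_range p_bij) stable_set_polytope_range cayley_sum_range.
have ME : minkowski_sum OP QG = conv_hull (range (@minkowski_vertex R d (label_le p) e)).
  by rewrite /OP /QG (order_polytope_range p_bij) stable_set_polytope_range minkowski_sum_range.
split.
- by rewrite CE; exact: (codegree_cayley (e_irr := e_irr)).
- by rewrite ME; exact: (codegree_minkowski (e_irr := e_irr)).
- rewrite CE ME; tfae.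
  + by move=> /(perfect_of_gorenstein_cayley (e_irr := e_irr) e_sym)/(gorenstein_minkowski leR leT).
  + exact: perfect_of_gorenstein_minkowski.
  + exact: gorenstein_cayley.
move=> perf; split.
- by rewrite CE ME; split; [exact: cayley_triangulation|exact: minkowski_triangulation].
- rewrite CE ME; split; apply: idp_range.
  + exact: cayley_lattice.
  + exact: cayley_decomp.
  + exact: minkowski_lattice.
  + exact: minkowski_decomp.
rewrite /OP /QG (order_polytope_range p_bij) stable_set_polytope_range.
exact: lattice_points_minkowski.
Qed.
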